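(* Let $\mathbf T$ be a non-degenerate isoperimetric periodic $2$-tiling of $\mathbb{R}^2$ with generators $E_1,E_2$, and suppose $\mathbf T$ is of type $(6;6)$. Then the lattice admits a fundamental domain $D$ which is the union of two regular hexagons sharing an edge. Moreover, $$\frac16<\frac{|E_i|}{|E_1|+|E_2|}<\frac56\quad(i=1,2),\qquad \mathrm{Per}(\mathbf T)=2\sqrt[4]{3}\sqrt{|E_1|+|E_2|}.$$ Given $|E_1|$ and $|E_2|$, the configuration is uniquely determined up to isometries.
   Context: A lattice $G$ in $\mathbb{R}^2$ is the group of translations generated by two linearly independent vectors. A fundamental domain is a measurable set $D$ whose $G$-translates cover $\mathbb{R}^2$ up to a null set and pairwise overlap in null sets. A periodic $2$-tiling is a collection $\mathbf T=\{E_k+g:k=1,2,\ g\in G\}$ of measurable sets which pairwise overlap in null sets and cover $\mathbb{R}^2$ up to a null set. It is non-degenerate if $|E_1|,|E_2|>0$. Its perimeter is $\mathrm{Per}(\mathbf T)=\frac12(\mathrm{Per}(E_1)+\mathrm{Per}(E_2))$. $\mathbf T$ is isoperimetric if $\mathrm{Per}(\mathbf T)\le\mathrm{Per}(\mathbf T')$ for every periodic 2-tiling $\mathbf T'$, with any lattice, whose generators have the same areas. Configuration $(6;6)$ means that $E_1$ and $E_2$ are hexagons with straight edges and all angles equal to $120^\circ$. *)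

(* Defs.v *)
(* The plane R^2 is (R * R) for an
   arbitrary R : realType, with the product sigma-algebra of Borel sets and
   the product Lebesgue measure leb2; Lebesgue-measurable sets are those of
   the completion (lmeas), and |E| is the (outer) Lebesgue measure [area]. *)
From HB Require Import structures.
From mathcomp Require Import all_boot all_order all_algebra.
From mathcomp Require Import all_classical all_reals all_analysis.
Set Implicit Arguments. Unset Strict Implicit. Unset Printing Implicit Defensive.
Import Order.TTheory GRing.Theory Num.Theory.
Import numFieldNormedType.Exports.
Local Open Scope classical_set_scope.
Local Open Scope ring_scope.

Section Defs.
Variable R : realType.

Definition pt := (R * R)%type.

Definition leb2 : set pt -> \bar R :=
  ((@lebesgue_measure R) \x (@lebesgue_measure R))%E.

Definition null2 (E : set pt) : Prop :=
  exists B, [/\ measurable B, E `<=` B & leb2 B = 0%E].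

Definition lmeas (E : set pt) : Prop :=
  exists A, measurable A /\ A `<=` E /\ null2 (E `\` A).

Definition area (E : set pt) : \bar R :=
  ereal_inf [set leb2 B | B in [set B | measurable B /\ E `<=` B]].

Definition aeq2 (E F : set pt) : Prop := null2 (E `\` F) /\ null2 (F `\` E).

Definition pdx (f : pt -> R) (x : pt) : R := derive1 (fun t => f (t, x.2)) x.1.
Definition pdy (f : pt -> R) (x : pt) : R := derive1 (fun t => f (x.1, t)) x.2.

Definition C1 (f : pt -> R) : Prop :=
  [/\ forall x : pt, derivable (fun t => f (t, x.2)) x.1 1,
      forall x : pt, derivable (fun t => f (x.1, t)) x.2 1,
      continuous (pdx f) & continuous (pdy f)].

Definition admissible (p q : pt -> R) : Prop :=
  [/\ C1 p, C1 q, compact (closure [set x | p x != 0 \/ q x != 0])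
    & forall x, p x ^+ 2 + q x ^+ 2 <= 1].

(* Per(E) = sup { int_E div phi : phi admissible }.  The integral over the
   Lebesgue-measurable set E is computed on any Borel set A c E with E \ A
   null (its value does not depend on the choice of A). *)
Definition per_data (E : set pt) (w : (pt -> R) * (pt -> R) * set pt) : Prop :=
  admissible w.1.1 w.1.2 /\ [/\ measurable w.2, w.2 `<=` E & null2 (E `\` w.2)].

Definition Per (E : set pt) : \bar R :=
  ereal_sup [set (\int[leb2]_(x in w.2) (pdx w.1.1 x + pdy w.1.2 x)%:E)%E
            | w in per_data E].

Definition vadd (x y : pt) : pt := (x.1 + y.1, x.2 + y.2).
Definition transl (g : pt) (E : set pt) : set pt := [set vadd x g | x in E].

Definition lat (a b : pt) (m n : int) : pt :=
  (m%:~R * a.1 + n%:~R * b.1, m%:~R * a.2 + n%:~R * b.2).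

Definition lin_indep (a b : pt) : Prop := a.1 * b.2 - a.2 * b.1 != 0.

Definition fundamental_domain (a b : pt) (D : set pt) : Prop :=
  [/\ lmeas D,
      null2 [set x | ~ exists m n, transl (lat a b m n) D x]
    & forall m n m' n', (m, n) <> (m', n') ->
        null2 (transl (lat a b m n) D `&` transl (lat a b m' n') D)].

Definition gen (E1 E2 : set pt) (k : bool) : set pt := if k then E2 else E1.

Definition tiling (a b : pt) (E1 E2 : set pt) : Prop :=
  [/\ lin_indep a b, lmeas E1, lmeas E2,
      (forall k m n k' m' n', (k, m, n) <> (k', m', n') ->
         null2 (transl (lat a b m n) (gen E1 E2 k) `&`
                transl (lat a b m' n') (gen E1 E2 k')))
    & null2 [set x | ~ exists k m n, transl (lat a b m n) (gen E1 E2 k) x]].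

Definition nondegenerate2 (E1 E2 : set pt) : Prop :=
  (0 < area E1)%E /\ (0 < area E2)%E.

Definition PerT (E1 E2 : set pt) : \bar R := ((Per E1 + Per E2) * (2^-1)%:E)%E.

Definition isoperimetric (a b : pt) (E1 E2 : set pt) : Prop :=
  tiling a b E1 E2 /\
  forall a' b' F1 F2, tiling a' b' F1 F2 ->
    area F1 = area E1 -> area F2 = area E2 -> (PerT E1 E2 <= PerT F1 F2)%E.

Definition u (t : R) : pt := (cos t, sin t).
Definition cross (v w : pt) : R := v.1 * w.2 - v.2 * w.1.
Definition vsub (x y : pt) : pt := (x.1 - y.1, x.2 - y.2).

(* direction of the k-th edge: turning by 60 degrees at each vertex *)
Definition edir (t : R) (k : nat) : pt := u (t + k%:R * (pi / 3)).

Definition vtx (p : pt) (t : R) (l : nat -> R) (k : nat) : pt :=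
  (p.1 + \sum_(i < k) l i * (edir t i).1, p.2 + \sum_(i < k) l i * (edir t i).2).

(* closed region bounded by the (counterclockwise) hexagon with vertices
   vtx p t l 0, ..., vtx p t l 5: intersection of the left half-planes *)
Definition hex_region (p : pt) (t : R) (l : nat -> R) : set pt :=
  [set x | forall k, (k < 6)%N -> 0 <= cross (edir t k) (vsub x (vtx p t l k))].

(* a genuine hexagon with straight edges and all interior angles 120 deg *)
Definition hex120 (p : pt) (t : R) (l : nat -> R) : Prop :=
  (forall k, (k < 6)%N -> 0 < l k) /\ vtx p t l 6 = p.

Definition is_hex120 (E : set pt) : Prop :=
  exists p t l, hex120 p t l /\ aeq2 E (hex_region p t l).

Definition config66 (E1 E2 : set pt) : Prop := is_hex120 E1 /\ is_hex120 E2.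

(* union of two (closed) regular hexagons of side s sharing the edge
   [p, p + s u(t)] *)
Definition two_regular_hexagons (D : set pt) : Prop :=
  exists p t s, 0 < s /\
    D = hex_region p t (fun _ => s) `|`
        hex_region (vadd p (s * (u t).1, s * (u t).2)) (t + pi) (fun _ => s).

Definition dist2 (x y : pt) : R := (x.1 - y.1) ^+ 2 + (x.2 - y.2) ^+ 2.
Definition isometry2 (f : pt -> pt) : Prop := forall x y, dist2 (f x) (f y) = dist2 x y.

End Defs.

(* Main.v *)
Require Import Defs.
From HB Require Import structures.
From mathcomp Require Import all_boot all_order all_algebra.
From mathcomp Require Import all_classical all_reals all_analysis.
From mathcomp Require Import measurable_realfun.
From mathcomp Require Import ring lra zify.
Set Implicit Arguments. Unset Strict Implicit. Unset Printing Implicit Defensive.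
Import Order.TTheory GRing.Theory Num.Theory.
Import numFieldNormedType.Exports.
Local Open Scope classical_set_scope.
Local Open Scope ring_scope.

(** Comparing the tiles that meet near a corner shows that the tiling is
    edge-to-edge, so that all hexagons have the same three edge directions.
    Crossing an edge of a given direction either preserves or exchanges the two
    types of tiles.  Around a vertex the crossings of the three directions compose
    to the identity, and they cannot all preserve the type since a point common to
    tiles of both types exists; hence exactly one direction preserves the type.
    This forces centrally symmetric hexagons with sides (x1, y, z) and (x2, y, z)
    and determines the lattice.  Such a pattern exists for all positive x1, x2, y
    and z; it has areas (sqrt 3 / 2) (xi y + y z + z xi) and perimeter
    x1 + x2 + 2 y + 2 z.  Minimality among these patterns with the same areas
    forces y = z and x1 + x2 = 2 y.  The lattice depends on x1 and x2 through
    x1 + x2 only, so it is also the lattice of the pattern x1 = x2 = y = z of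
    regular hexagons.  The perimeter of a hexagon follows from the divergence
    theorem: the flux of an admissible field is at most the length of the boundary,
    and explicit C^1 fields are the outer normal on most of each edge. *)

(** * Measure-preserving affine maps *)

(** What is given holds only up to null sets, and the two hexagons come with twelve sides and two
    unrelated inclinations, so no corner or side is known to match. The tiles are first replaced by
    closed hexagons; disjoint interiors, covering of every point and local finiteness then carry the
    whole local analysis. Edge-to-edge is a matter of angles: a corner inside a side of another tile
    leaves a wedge of 60 degrees, too narrow for an angle of at least 120 degrees. Isoperimetry
    enters only when the shape is known, and only against patterns of the same four-parameter
    family, so minimality becomes a problem about four positive numbers. With [y = z] and
    [x1 + x2 = 2 * y] the share of a tile is [(2 * xi + y) / (6 * y)] with [0 < xi < 2 * y], which
    is the origin of 1/6 and 5/6; the perimeter is [6 * y] and the total area [3 * sqrt 3 * y^2].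
    The areas recover [x1], [x2] and [y]; only a base point and an angle remain free, and a rigid
    motion matches them. *)

Section Measure.
Variable R : realType.
Local Notation mu := (@lebesgue_measure R).
Local Notation RR := (measurableTypeR R).
Local Notation T2 := (RR * RR)%type.
Local Notation L2 := (mu \x mu)%E.

Lemma lebesgue_measure_shift (c : R) (B : set RR) : measurable B ->
  mu ((fun x : RR => (x + c : RR)) @^-1` B) = mu B.
Proof.
move=> mB.
have mf : measurable_fun setT (fun x : RR => (x + c : RR)).
  by apply: (@measurable_funD _ RR R setT idfun (cst c)) => //; exact: measurable_id.
apply/esym.
pose f : RR -> RR := fun x : RR => (x + c : RR).
have mf' : measurable_fun setT f by [].
apply: (@lebesgue_measure_unique R (pushforward mu f)) => //.
move=> X -[[a b] _ <-] /=.
rewrite /pushforward.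
have -> : f @^-1` `]a, b] = `](a - c), (b - c)]%classic.
  by apply/seteqP; split => x /=; rewrite !in_itv/= /f; lra.
rewrite !lebesgue_measure_itv/= !lte_fin.
have -> : (a - c < b - c) = (a < b) by apply/idP/idP; lra.
by case: ifP => // _; rewrite !EFinN -!EFinB; congr (_%:E); ring.
Qed.

(** Each vertical slice of the preimage is a translate of the corresponding slice of [B], so the
    slice measures agree. *)
Lemma leb2_shear_snd (f : R -> R) (B : set T2) : measurable B ->
  measurable_fun setT (fun z : T2 => (z.1, z.2 + f z.1) : T2) ->
  L2 ((fun z : T2 => (z.1, z.2 + f z.1) : T2) @^-1` B) = L2 B.
Proof.
move=> mB mS; rewrite /product_measure1; apply: eq_integral => x _ /=.
rewrite -[RHS](lebesgue_measure_shift (f x)); last exact: measurable_xsection.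
congr (mu _); apply/seteqP; split => y /=; rewrite /xsection/=; rewrite !inE//=.
Qed.

(** Slicing in the other order gives the same measure by uniqueness; this makes horizontal shears
    accessible. *)
Lemma leb2_swapE (B : set T2) : measurable B -> L2 B = (mu \x^ mu)%E B.
Proof.
move=> mB; apply: product_measure_unique => // A1 A2 mA1 mA2.
exact: product_measure2E.
Qed.

Lemma leb2_shear_fst (f : R -> R) (B : set T2) : measurable B ->
  measurable_fun setT (fun z : T2 => (z.1 + f z.2, z.2) : T2) ->
  L2 ((fun z : T2 => (z.1 + f z.2, z.2) : T2) @^-1` B) = L2 B.
Proof.
move=> mB mS; rewrite !leb2_swapE//; last first.
  by rewrite -[X in measurable X]setTI; exact: mS.
rewrite /product_measure2; apply: eq_integral => y _ /=.
rewrite -[RHS](lebesgue_measure_shift (f y)); last exact: measurable_ysection.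
congr (mu _); apply/seteqP; split => x /=; rewrite /ysection/=; rewrite !inE//=.
Qed.

Definition affmap (v d1 d2 : pt R) (z : pt R) : pt R :=
  (v.1 + z.1 * d1.1 + z.2 * d2.1, v.2 + z.1 * d1.2 + z.2 * d2.2).

Definition mpres (f : T2 -> T2) : Prop :=
  measurable_fun setT f /\
  forall B : set T2, measurable B -> L2 (f @^-1` B) = L2 B.

Lemma mpres_comp f g : mpres f -> mpres g -> mpres (f \o g).
Proof.
move=> [mf Hf] [mg Hg]; split; first exact: measurableT_comp.
move=> B mB; rewrite comp_preimage Hg ?Hf//.
by rewrite -[X in measurable X]setTI; exact: mf.
Qed.

Lemma mpres_shear_snd (f : R -> R) : measurable_fun setT (f : RR -> R) ->
  mpres (fun z : T2 => (z.1, z.2 + f z.1) : T2).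
Proof.
move=> mf; have mS : measurable_fun setT (fun z : T2 => (z.1, z.2 + f z.1) : T2).
  apply: measurable_fun_pair; first exact: measurable_fst.
  apply: (@measurable_funD _ T2 R setT snd (f \o fst)); first exact: measurable_snd.
  by apply: (measurableT_comp mf); exact: measurable_fst.
by split=> // B mB; exact: leb2_shear_snd.
Qed.

Lemma mpres_shear_fst (f : R -> R) : measurable_fun setT (f : RR -> R) ->
  mpres (fun z : T2 => (z.1 + f z.2, z.2) : T2).
Proof.
move=> mf; have mS : measurable_fun setT (fun z : T2 => (z.1 + f z.2, z.2) : T2).
  apply: measurable_fun_pair; last exact: measurable_snd.
  apply: (@measurable_funD _ T2 R setT fst (f \o snd)); first exact: measurable_fst.
  by apply: (measurableT_comp mf); exact: measurable_snd.
by split=> // B mB; exact: leb2_shear_fst.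
Qed.

Lemma measurable_mulc (c : R) : measurable_fun setT ((fun x => c * x) : RR -> R).
Proof.
by apply: (@measurable_funM _ RR R setT (cst c) idfun) => //; exact: measurable_id.
Qed.

Lemma mpres_translate (v : pt R) : mpres (vadd v).
Proof.
have -> : vadd v = (fun z : T2 => (z.1 + cst v.1 z.2, z.2) : T2) \o
                   (fun z : T2 => (z.1, z.2 + cst v.2 z.1) : T2).
  by apply/funext => z; rewrite /vadd /= !(addrC v.1) !(addrC v.2).
by apply: mpres_comp; [apply: mpres_shear_fst|apply: mpres_shear_snd]; exact: measurable_cst.
Qed.

(** A matrix of determinant 1 is a product of shears, and shears and translations preserve the
    measure. *)
Lemma mpres_affmap (v d1 d2 : pt R) : cross d1 d2 = 1 -> mpres (affmap v d1 d2).
Proof.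
have main a b c d : c != 0 -> a * d - c * b = 1 ->
    mpres (fun z : T2 => (z.1 * a + z.2 * b, z.1 * c + z.2 * d) : T2).
  move=> c0 det.
  (* With [c] nonzero three shears suffice; their coefficients are forced by [a], [c] and [d], and
     [b] then comes out right because of the determinant. *)
  have -> : (fun z : T2 => (z.1 * a + z.2 * b, z.1 * c + z.2 * d) : T2) =
    (fun z : T2 => (z.1 + ((a - 1) / c) * z.2, z.2) : T2) \o
    ((fun z : T2 => (z.1, z.2 + c * z.1) : T2) \o
    (fun z : T2 => (z.1 + ((d - 1) / c) * z.2, z.2) : T2)).
    apply/funext => z /=.
    have -> : b = (a * d - 1) / c.
      by rewrite -det opprB addrC subrK mulrAC mulfV ?mul1r.
    by congr pair; field.
  apply: mpres_comp; first exact: (mpres_shear_fst (measurable_mulc _)).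
  apply: mpres_comp; first exact: (mpres_shear_snd (measurable_mulc _)).
  exact: (mpres_shear_fst (measurable_mulc _)).
have lin a b c d : a * d - c * b = 1 ->
    mpres (fun z : T2 => (z.1 * a + z.2 * b, z.1 * c + z.2 * d) : T2).
  move=> det; have [c0|] := eqVneq c 0; last by move=> c0; exact: main.
  (* If [c = 0] then [a] is nonzero: adding the first row to the second makes the lower left entry
     [a], and a final shear subtracts it again. *)
  have -> : (fun z : T2 => (z.1 * a + z.2 * b, z.1 * c + z.2 * d) : T2) =
    (fun z : T2 => (z.1, z.2 + (-1) * z.1) : T2) \o
    (fun z : T2 => (z.1 * a + z.2 * b, z.1 * (c + a) + z.2 * (d + b)) : T2).
    by apply/funext => z /=; congr pair; ring.
  apply: mpres_comp; first exact: (mpres_shear_snd (measurable_mulc _)).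
  apply: main; last by rewrite -det; ring.
  rewrite c0 add0r; apply/eqP => a0; move: det.
  by rewrite a0 c0 !mul0r subr0 => /esym/eqP; rewrite oner_eq0.
move=> det.
have -> : affmap v d1 d2 = vadd v \o
   (fun z : T2 => (z.1 * d1.1 + z.2 * d2.1, z.1 * d1.2 + z.2 * d2.2) : T2).
  by apply/funext => z; rewrite /affmap /vadd /= !addrA.
apply: mpres_comp; first exact: mpres_translate.
by apply: lin; exact: det.
Qed.

End Measure.

(** * Integrals and null sets in the plane *)

Lemma integral_measure_preserving (d : measure_display) (T : measurableType d)
    (R : realType) (m : {measure set T -> \bar R}) (A : T -> T) (D : set T)
    (f : T -> R) :
  measurable_fun setT A -> (forall B, measurable B -> m (A @^-1` B) = m B) ->
  measurable_fun setT f -> measurable D ->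
  (\int[m]_(x in D) (f x)%:E = \int[m]_(x in A @^-1` D) (f (A x))%:E)%E.
Proof.
move=> mA HA mf mD.
transitivity (\int[pushforward m A]_(x in D) (f x)%:E)%E.
  apply: (@eq_measure_integral _ _ _ _ (pushforward m A)) => B mB _.
  by rewrite -[LHS]HA.
have mfe : measurable_fun D (EFin \o f).
  by apply/measurable_EFinP; exact: measurable_funTS.
rewrite [LHS]integralE [RHS]integralE; congr (_ - _)%E.
  etransitivity.
    exact: (@ge0_integral_pushforward _ _ _ _ _ _ mA m _ _ mD (measurable_funepos mfe)).
  by apply: eq_integral => x _; rewrite /= !funeposE.
etransitivity.
  exact: (@ge0_integral_pushforward _ _ _ _ _ _ mA m _ _ mD (measurable_funeneg mfe)).
by apply: eq_integral => x _; rewrite /= !funenegE.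
Qed.

Section Measure2.
Variable R : realType.
Local Notation mu := (@lebesgue_measure R).
Local Notation RR := (measurableTypeR R).
Local Notation T2 := (RR * RR)%type.
Local Notation L2 := (mu \x mu)%E.

Lemma continuous_ptP (f : pt R -> R) : continuous f <->
  forall (x : pt R) (e : R), 0 < e -> exists2 d : R, 0 < d &
    forall y : pt R, `|y.1 - x.1| < d -> `|y.2 - x.2| < d -> `|f y - f x| < e.
Proof.
split=> [cf x e e0|H x].
  have /cvgrPdist_lt /(_ _ e0) := cf x.
  rewrite /= => /nbhs_ballP[d /= d0 Hd]; exists d => // y y1 y2.
  rewrite distrC; apply: Hd; split; rewrite /ball/= distrC; [exact: y1|exact: y2].
apply/cvgrPdist_lt => e e0; have [d d0 Hd] := H x e e0.
exists (ball x.1 d, ball x.2 d); first by split; exact: nbhsx_ballx.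
move=> y [/= y1 y2]; rewrite distrC; apply: Hd.
  by rewrite distrC; exact: y1.
by rewrite distrC; exact: y2.
Qed.

(** Measurability refers to the product sigma-algebra, so an open set is exhibited as a countable
    union of boxes with rational centres and radii. *)
Lemma open_measurable_pt (U : set T2) :
  (forall x : pt R, U x -> exists2 d : R, 0 < d & forall y : pt R,
     `|y.1 - x.1| < d -> `|y.2 - x.2| < d -> U y) -> measurable U.
Proof.
move=> oU.
pose box (p q r : rat) : set T2 :=
  (ball (ratr p : R) (ratr r)) `*` (ball (ratr q : R) (ratr r)).
have -> : U = \bigcup_p \bigcup_q \bigcup_(r in [set r | box p q r `<=` U]) box p q r.
  apply/seteqP; split => [x Ux|x [p _ [q _ [r /= rU /rU]]]//].
  have [d d0 Hd] := oU x Ux.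
  have /rat_in_itvoo[r] : 0 < d / 2 by lra.
  rewrite in_itv/= => /andP[r0 rd].
  have /rat_in_itvoo[p] : x.1 - ratr r < x.1 + ratr r by lra.
  rewrite in_itv/= => /andP[p0 p1].
  have /rat_in_itvoo[q] : x.2 - ratr r < x.2 + ratr r by lra.
  rewrite in_itv/= => /andP[q0 q1].
  exists p => //; exists q => //; exists r => /=.
    move=> y [/=]; rewrite /ball/= !ltr_norml => /andP[h1 h2] /andP[h3 h4].
    by apply: Hd; rewrite ltr_norml; apply/andP; split; lra.
  by split => /=; rewrite /ball/= ltr_norml; apply/andP; split; lra.
apply: bigcupT_measurable_rat => p; apply: bigcupT_measurable_rat => q.
rewrite bigcup_mkcond; apply: bigcupT_measurable_rat => r; case: ifPn => // _.
by apply: measurableX; exact: measurable_ball.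
Qed.

Lemma continuous_measurable_pt (f : pt R -> R) :
  continuous f -> measurable_fun setT (f : T2 -> R).
Proof.
move=> /continuous_ptP cf.
move=> mT; apply: (measurability _ (RGenOInfty.measurableE R)) => //.
move=> /= _ [_ [c ->] <-]; rewrite setTI preimage_itvoy; apply: open_measurable_pt => x /= fx.
have [d d0 Hd] := cf x (f x - c) ltac:(lra).
exists d => // y y1 y2; have := Hd y y1 y2; rewrite ltr_norml => /andP[]; lra.
Qed.

Lemma continuous_bounded_pt (f : pt R -> R) (M : R) : continuous f ->
  exists K : R, forall x : pt R, `|x.1| <= M -> `|x.2| <= M -> `|f x| <= K.
Proof.
move=> cf.
pose B : set (R * R) := (`[- M, M]%classic : set R) `*` (`[- M, M]%classic : set R).
have cB : compact B by apply: compact_setX; exact: segment_compact.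
have : compact (f @` B).
  by apply: continuous_compact => //; exact: continuous_subspaceT.
move/compact_bounded => [K [Kr HK]]; exists (K + 1) => x x1 x2.
apply: (HK (K + 1)); first lra.
exists x => //; split => /=; rewrite in_itv/=; first by rewrite -ler_norml.
by rewrite -ler_norml.
Qed.

Definition box (M : R) : set T2 := [set x | `|x.1| <= M /\ `|x.2| <= M].

Lemma boxE M : box M = (`[- M, M]%classic : set R) `*` (`[- M, M]%classic : set R).
Proof. by apply/seteqP; split => x; rewrite /box /= !in_itv/= -!ler_norml => -[]. Qed.

Lemma measurable_box M : measurable (box M).
Proof. by rewrite boxE; apply: measurableX; exact: measurable_itv. Qed.

Lemma leb2_box_fin M : (L2 (box M) < +oo)%E.
Proof.
have fI : (mu `[(- M)%R, M]%classic < +oo)%E.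
  by rewrite lebesgue_measure_itv /=; case: ifP => _; rewrite ?ltry.
rewrite boxE product_measure1E; [|exact: measurable_itv|exact: measurable_itv].
by apply: lte_mul_pinfty => //; rewrite ge0_fin_numE.
Qed.

Lemma integrable_continuous_pt (f : pt R -> R) (D : set T2) (M : R) :
  continuous f -> measurable D -> D `<=` box M -> L2.-integrable D (EFin \o f).
Proof.
move=> cf mD DM; apply: measurable_bounded_integrable => //.
- by apply: le_lt_trans (leb2_box_fin M); apply: le_measure => //;
    rewrite inE//; exact: measurable_box.
- by apply: measurable_funTS; exact: continuous_measurable_pt.
- have [K HK] := continuous_bounded_pt M cf.
  exists K; split; first by rewrite num_real.
  move=> k Kk x /DM[x1 x2]; apply: le_trans (ltW Kk); exact: HK.
Qed.

(** [leb2] is a bare set function on [pt R]; seen as the pushforward of [L2] under the identity it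
    inherits the integration lemmas for measures on [T2]. *)
Lemma leb2_integralE (f : pt R -> R) (D : set (pt R)) : measurable D ->
  measurable_fun setT (f : T2 -> R) ->
  (\int[@leb2 R]_(x in D) (f x)%:E = \int[L2]_(x in D) (f x)%:E)%E.
Proof.
move=> mD mf.
pose i : T2 -> pt R := idfun.
have mi : measurable_fun setT i by move=> _ B mB; rewrite setTI.
have E : @leb2 R = pushforward L2 i by apply/funext => A; rewrite /pushforward preimage_id.
have mfp : measurable_fun setT (f : pt R -> R) by exact: mf.
rewrite E; etransitivity; first exact: (integralE (pushforward L2 i) D (EFin \o f)).
rewrite [RHS]integralE.
have D' : i @^-1` D = D by rewrite preimage_id.
congr (_ - _)%E.
  rewrite ge0_integral_pushforward ?D'//.
  by apply: measurable_funepos; apply/measurable_EFinP; apply: measurable_funTS.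
rewrite ge0_integral_pushforward ?D'//.
by apply: measurable_funeneg; apply/measurable_EFinP; apply: measurable_funTS.
Qed.

Lemma integral_affmap (v d1 d2 : pt R) (f : pt R -> R) (D : set T2) :
  cross d1 d2 = 1 -> measurable_fun setT (f : T2 -> R) -> measurable D ->
  (\int[L2]_(x in D) (f x)%:E =
   \int[L2]_(x in affmap v d1 d2 @^-1` D) (f (affmap v d1 d2 x))%:E)%E.
Proof.
move=> det mf mD; have [ma Ha] := mpres_affmap v det.
exact: (@integral_measure_preserving _ _ _ L2 _ D (f : T2 -> R)).
Qed.

Lemma null2P (E : set (pt R)) : null2 E <-> L2.-negligible E.
Proof.
by split => [[B [mB EB B0]]|[B [mB B0 EB]]]; exists B; split.
Qed.

Lemma null2_sub (E F : set (pt R)) : E `<=` F -> null2 F -> null2 E.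
Proof. by move=> EF [B [mB FB B0]]; exists B; split=> // x /EF/FB. Qed.

Lemma null2U (E F : set (pt R)) : null2 E -> null2 F -> null2 (E `|` F).
Proof. by move=> /null2P nE /null2P nF; apply/null2P; exact: negligibleU. Qed.

Lemma null2_bigcup (F : (set (pt R))^nat) :
  (forall n, null2 (F n)) -> null2 (\bigcup_n F n).
Proof. by move=> nF; apply/null2P; apply: negligible_bigcup => n; exact/null2P. Qed.

Lemma null2_0 : null2 (set0 : set (pt R)).
Proof. by apply/null2P; exact: negligible_set0. Qed.

Lemma null2_mpres (f g : pt R -> pt R) (E : set (pt R)) :
  mpres g -> cancel f g -> null2 E -> null2 (f @` E).
Proof.
move=> [mg Hg] fg [B [mB EB B0]]; exists (g @^-1` B); split.
- by rewrite -[X in measurable X]setTI; exact: mg.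
- by move=> _ [x Ex <-] /=; rewrite fg; exact: EB.
- by rewrite -[RHS]B0; exact: Hg.
Qed.

End Measure2.

(** * Calculus for C1 functions *)

Section Calculus.
Variable R : realType.
Local Notation mu := (@lebesgue_measure R).
Local Notation RR := (measurableTypeR R).
Local Notation T2 := (RR * RR)%type.
Local Notation L2 := (mu \x mu)%E.

Lemma is_derive_cvg (g : R -> R) (x l : R) :
  (forall e : R, 0 < e -> exists2 d : R, 0 < d & forall h : R, h != 0 -> `|h| < d ->
     `|(g (x + h) - g x) / h - l| < e) -> is_derive x 1 g l.
Proof.
move=> H.
have C : h^-1 *: ((g \o shift x) (h *: 1) - g x) @[h --> 0^'] --> l.
  apply/cvgrPdist_lt => e e0; have [d d0 Hd] := H e e0.
  exists d => //= h /=; rewrite sub0r normrN => hd h0.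
  have := Hd h h0 hd; rewrite distrC /shift /=.
  have -> : h *: (1 : R) = h by rewrite /GRing.scale/= mulr1.
  by rewrite mulrC (addrC h).
apply: DeriveDef; first by apply/cvg_ex; exists l.
exact: (cvg_lim _ C).
Qed.

Lemma MVT_pt (g g' : R -> R) (a b : R) : (forall x : R, is_derive x 1 g (g' x)) ->
  exists2 c : R, `|c - a| <= `|b - a| & g b - g a = g' c * (b - a).
Proof.
move=> dg.
have cg (i : interval R) : {within [set` i], continuous g}.
  by apply: derivable_within_continuous => x _; have [] := dg x.
have [ab|ba] := leP a b.
  have [c] := MVT_segment ab (fun x _ => dg x) (cg _).
  rewrite in_itv/= => /andP[ac cb] E; exists c => //.
  by rewrite !ger0_norm; lra.
have [c] := MVT_segment (ltW ba) (fun x _ => dg x) (cg _).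
rewrite in_itv/= => /andP[ac cb] E; exists c; last lra.
by rewrite !ler0_norm; lra.
Qed.

Lemma C1_is_derive_fst (f : pt R -> R) (y t : R) : C1 f ->
  is_derive t 1 (fun t => f (t, y)) (pdx f (t, y)).
Proof.
move=> [h _ _ _]; apply: DeriveDef; first exact: (h (t, y)).
by rewrite /pdx derive1E.
Qed.

Lemma C1_is_derive_snd (f : pt R -> R) (x t : R) : C1 f ->
  is_derive t 1 (fun t => f (x, t)) (pdy f (x, t)).
Proof.
move=> [_ h _ _]; apply: DeriveDef; first exact: (h (x, t)).
by rewrite /pdy derive1E.
Qed.

(** [C1] speaks only of partial derivatives, so the increment is taken along the axis-parallel path
    through [(x.1, y.2)], with the mean value theorem on each leg. Continuity and the chain rule
    both rest on this. *)
Lemma C1_increment (f : pt R -> R) (x y : pt R) : C1 f ->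
  exists c1 c2 : R, [/\ `|c1 - x.1| <= `|y.1 - x.1|, `|c2 - x.2| <= `|y.2 - x.2| &
   f y - f x = pdx f (c1, y.2) * (y.1 - x.1) + pdy f (x.1, c2) * (y.2 - x.2)].
Proof.
case: x y => [x1 x2] [y1 y2] /= cf.
have [c1 h1 e1] := MVT_pt x1 y1 (fun t => C1_is_derive_fst y2 t cf).
have [c2 h2 e2] := MVT_pt x2 y2 (fun t => C1_is_derive_snd x1 t cf).
by exists c1, c2; split=> //; rewrite -e1 -e2; ring.
Qed.

Lemma C1_continuous (f : pt R -> R) : C1 f -> continuous f.
Proof.
move=> cf; have [_ _ /continuous_ptP cx /continuous_ptP cy] := cf.
apply/continuous_ptP => x e e0.
have [d1 d10 H1] := cx x 1 ltr01; have [d2 d20 H2] := cy x 1 ltr01.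
(* Near [x] each partial derivative is bounded by its absolute value at [x] plus 1; [K] is the sum
   of the two bounds. *)
pose K := `|pdx f x| + `|pdy f x| + 2.
have K0 : 0 < K by rewrite /K; have := normr_ge0 (pdx f x); have := normr_ge0 (pdy f x); lra.
exists (Num.min (Num.min d1 d2) (e / K)).
  by rewrite !lt_min d10 d20 divr_gt0.
move=> y; rewrite !lt_min => /andP[/andP[y11 y12] y1e] /andP[/andP[y21 y22] y2e].
have [c1 [c2 [h1 h2 ->]]] := C1_increment x y cf.
have A1 : `|pdx f (c1, y.2)| <= `|pdx f x| + 1.
  have /= := H1 (c1, y.2) (le_lt_trans h1 y11) y21 => A.
  have := ler_normD (pdx f (c1, y.2) - pdx f x) (pdx f x); rewrite subrK; lra.
have A2 : `|pdy f (x.1, c2)| <= `|pdy f x| + 1.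
  have /= := H2 (x.1, c2); rewrite subrr normr0 => /(_ d20 (le_lt_trans h2 y22)) A.
  have := ler_normD (pdy f (x.1, c2) - pdy f x) (pdy f x); rewrite subrK; lra.
apply: (le_lt_trans (ler_normD _ _)); rewrite !normrM.
have eK : e / K * K = e by rewrite divfK ?gt_eqF.
have B1 : `|pdx f (c1, y.2)| * `|y.1 - x.1| <= (`|pdx f x| + 1) * `|y.1 - x.1|.
  by rewrite ler_wpM2r.
have B2 : `|pdy f (x.1, c2)| * `|y.2 - x.2| <= (`|pdy f x| + 1) * `|y.2 - x.2|.
  by rewrite ler_wpM2r.
have B3 : (`|pdx f x| + 1) * `|y.1 - x.1| <= (`|pdx f x| + 1) * (e / K).
  by rewrite ler_wpM2l ?ltW //; have := normr_ge0 (pdx f x); lra.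
have B4 : (`|pdy f x| + 1) * `|y.2 - x.2| < (`|pdy f x| + 1) * (e / K).
  by rewrite ltr_pM2l //; have := normr_ge0 (pdy f x); lra.
have -> : e = (`|pdx f x| + 1) * (e / K) + (`|pdy f x| + 1) * (e / K).
  by rewrite -{1}eK {2}/K; ring.
lra.
Qed.

Definition line (v d : pt R) (s : R) : pt R := (v.1 + s * d.1, v.2 + s * d.2).

Lemma C1_chain (f : pt R -> R) (v d : pt R) (s : R) : C1 f ->
  is_derive s 1 (fun s => f (line v d s))
    (pdx f (line v d s) * d.1 + pdy f (line v d s) * d.2).
Proof.
move=> cf; have [_ _ /continuous_ptP cx /continuous_ptP cy] := cf.
apply: is_derive_cvg => e e0.
set P := line v d s.
pose K := `|d.1| + `|d.2| + 1.
have K0 : 0 < K by rewrite /K; have := normr_ge0 d.1; have := normr_ge0 d.2; lra.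
have eK0 : 0 < e / K by rewrite divr_gt0.
have [d1 d10 H1] := cx P _ eK0; have [d2 d20 H2] := cy P _ eK0.
exists (Num.min d1 d2 / K); first by rewrite divr_gt0 // lt_min d10.
move=> h h0 hd.
have hd' : `|h| * K < Num.min d1 d2 by rewrite -ltr_pdivlMr.
move: hd'; rewrite lt_min => /andP[hK1 hK2].
have [c1 [c2 [h1 h2 ->]]] := C1_increment P (line v d (s + h)) cf.
have E1 : (line v d (s + h)).1 - P.1 = h * d.1 by rewrite /line /P /=; ring.
have E2 : (line v d (s + h)).2 - P.2 = h * d.2 by rewrite /line /P /=; ring.
have Q1 : `|h * d.1| <= `|h| * K.
  by rewrite normrM ler_wpM2l // /K; have := normr_ge0 d.2; lra.
have Q2 : `|h * d.2| <= `|h| * K.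
  by rewrite normrM ler_wpM2l // /K; have := normr_ge0 d.1; lra.
rewrite E1 in h1; rewrite E2 in h2.
have A1 : `|pdx f (c1, (line v d (s + h)).2) - pdx f P| < e / K.
  by apply: H1 => /=; rewrite ?E2; lra.
have A2 : `|pdy f (P.1, c2) - pdy f P| < e / K.
  by apply: H2 => /=; rewrite ?subrr ?normr0; lra.
rewrite E1 E2.
have -> : (pdx f (c1, (line v d (s + h)).2) * (h * d.1) +
  pdy f (P.1, c2) * (h * d.2)) / h - (pdx f P * d.1 + pdy f P * d.2) =
  (pdx f (c1, (line v d (s + h)).2) - pdx f P) * d.1 +
  (pdy f (P.1, c2) - pdy f P) * d.2 by field.
apply: (le_lt_trans (ler_normD _ _)); rewrite !normrM.
have B1 : `|pdx f (c1, (line v d (s + h)).2) - pdx f P| * `|d.1| <= e / K * `|d.1|.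
  by rewrite ler_wpM2r // ltW.
have B2 : `|pdy f (P.1, c2) - pdy f P| * `|d.2| <= e / K * `|d.2|.
  by rewrite ler_wpM2r // ltW.
have : e / K * K = e by rewrite divfK ?gt_eqF.
by rewrite {2}/K !mulrDr mulr1; lra.
Qed.
Lemma continuous_comp_affmap (f : pt R -> R) (v d1 d2 : pt R) :
  continuous f -> continuous (f \o affmap v d1 d2).
Proof.
move=> /continuous_ptP cf; apply/continuous_ptP => x e e0.
have [d d0 H] := cf (affmap v d1 d2 x) e e0.
pose K := `|d1.1| + `|d1.2| + `|d2.1| + `|d2.2| + 1.
have [p1 p2 p3 p4] : [/\ 0 <= `|d1.1|, 0 <= `|d1.2|, 0 <= `|d2.1| & 0 <= `|d2.2|] by [].
have K0 : 0 < K by rewrite /K; lra.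
exists (d / K); first by rewrite divr_gt0.
move=> y y1 y2 /=.
have dK : d / K * K = d by rewrite divfK ?gt_eqF.
have dK0 : 0 < d / K by rewrite divr_gt0.
have bound (a b : R) : `|a| + `|b| < K -> `|(y.1 - x.1) * a + (y.2 - x.2) * b| < d.
  move=> ab; apply: (le_lt_trans (ler_normD _ _)); rewrite !normrM.
  have : `|y.1 - x.1| * `|a| <= d / K * `|a| by rewrite ler_wpM2r // ltW.
  have : `|y.2 - x.2| * `|b| <= d / K * `|b| by rewrite ler_wpM2r // ltW.
  have : d / K * (`|a| + `|b|) < d / K * K by rewrite ltr_pM2l.
  by rewrite mulrDr; lra.
apply: H; rewrite /affmap /=.
  have -> : v.1 + y.1 * d1.1 + y.2 * d2.1 - (v.1 + x.1 * d1.1 + x.2 * d2.1) =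
    (y.1 - x.1) * d1.1 + (y.2 - x.2) * d2.1 by ring.
  by apply: bound; rewrite /K; lra.
have -> : v.2 + y.1 * d1.2 + y.2 * d2.2 - (v.2 + x.1 * d1.2 + x.2 * d2.2) =
  (y.1 - x.1) * d1.2 + (y.2 - x.2) * d2.2 by ring.
by apply: bound; rewrite /K; lra.
Qed.

Lemma continuous_line (f : pt R -> R) (v d : pt R) :
  continuous f -> continuous (fun s => f (line v d s)).
Proof.
move=> cf.
have /continuous_ptP H := continuous_comp_affmap (v := v) (d1 := d) (d2 := d) cf.
move=> s; apply/cvgrPdist_lt => e e0; have [k k0 Hk] := H (s, 0) e e0.
exists k => //= s' hs.
have := Hk (s', 0); rewrite /= subrr normr0 distrC => /(_ hs k0).
by rewrite distrC /affmap /= !mul0r !addr0.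
Qed.

Lemma continuous_slice_fst (f : pt R -> R) (y : R) :
  continuous f -> continuous (fun t => f (t, y)).
Proof.
move=> cf; have -> : (fun t => f (t, y)) = (fun s => f (line (0, y) (1, 0) s)).
  by apply/funext => t; rewrite /line /= add0r mulr1 mulr0 addr0.
exact: continuous_line.
Qed.

Lemma continuous_slice_snd (f : pt R -> R) (x : R) :
  continuous f -> continuous (fun t => f (x, t)).
Proof.
move=> cf; have -> : (fun t => f (x, t)) = (fun s => f (line (x, 0) (0, 1) s)).
  by apply/funext => t; rewrite /line /= add0r mulr1 mulr0 addr0.
exact: continuous_line.
Qed.

Lemma integrable_itv (f : R -> R) (a b : R) : continuous f ->
  mu.-integrable `[a, b] (EFin \o f).
Proof.
move=> cf; apply: (@continuous_compact_integrable R f); first exact: segment_compact.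
exact: continuous_subspaceT.
Qed.

Lemma FTC_continuous (g g' : R -> R) (a b : R) : a <= b ->
  (forall x : R, is_derive x 1 g (g' x)) -> continuous g' ->
  (\int[mu]_(x in `[a, b]) (g' x)%:E = (g b - g a)%:E)%E.
Proof.
move=> ab dg cg'.
have cg : continuous g.
  move=> x; apply: differentiable_continuous; apply/derivable1_diffP.
  by have [] := dg x.
move: ab; rewrite le_eqVlt => /predU1P[<-|ab].
  by rewrite set_itv1 integral_set1 subrr.
rewrite (continuous_FTC2 ab (F := g)) ?EFinB//.
- exact: continuous_subspaceT.
- split; first by move=> x _; have [] := dg x.
    by apply: cvg_at_right_filter; exact: cg.
  by apply: cvg_at_left_filter; exact: cg.
- by move=> x _; rewrite derive1E; have [_ ->] := dg x.
Qed.

(** * Integrals of partial derivatives over rectangles *)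

Definition rect (A B : R) : set T2 := `[0, A]%classic `*` `[0, B]%classic.

Lemma measurable_rect A B : measurable (rect A B).
Proof. by apply: measurableX; exact: measurable_itv. Qed.

Lemma integrable_rect (f : pt R -> R) A B : continuous f ->
  L2.-integrable (rect A B) (EFin \o f).
Proof.
move=> cf; apply: (integrable_continuous_pt (M := `|A| + `|B|)) => //.
  exact: measurable_rect.
move=> x [/=]; rewrite !in_itv/= => /andP[x0 xA] /andP[y0 yB]; split.
  by rewrite ger0_norm //; have := ler_norm A; have := normr_ge0 B; lra.
by rewrite ger0_norm //; have := ler_norm B; have := normr_ge0 A; lra.
Qed.

(** After extension by zero, Fubini with the inner integral in the variable of differentiation
    reduces the claim to the fundamental theorem on each slice. *)
Lemma integral_rect_fst (g g' : pt R -> R) (A B : R) : 0 <= A ->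
  (forall (y t : R), is_derive t 1 (fun t => g (t, y)) (g' (t, y))) ->
  continuous g' ->
  (\int[L2]_(x in rect A B) (g' x)%:E =
   \int[mu]_(y in `[0%R, B]) (g (A, y) - g (0%R, y))%:E)%E.
Proof.
move=> A0 dg cg'.
rewrite integral_mkcond.
rewrite -(@integral21_prod_meas1 _ _ RR RR R mu mu); last first.
  by apply/(integrable_mkcond _ (measurable_rect A B)).1; exact: integrable_rect.
rewrite [RHS]integral_mkcond; apply: eq_integral => y _.
rewrite /fubini_G /patch /=; case: ifPn => yB.
  rewrite -(FTC_continuous A0 (dg y) (continuous_slice_fst cg')).
  rewrite [RHS]integral_mkcond; apply: eq_integral => x _; rewrite /patch.
  have -> : ((x, y) \in rect A B) = (x \in `[0, A]%classic); last by [].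
  by rewrite /rect in_setX /= yB andbT.
rewrite integral0_eq // => x _.
have -> // : ((x, y) \in rect A B) = false.
by rewrite /rect in_setX /= (negbTE yB) andbF.
Qed.

Lemma integral_rect_snd (g g' : pt R -> R) (A B : R) : 0 <= B ->
  (forall (x t : R), is_derive t 1 (fun t => g (x, t)) (g' (x, t))) ->
  continuous g' ->
  (\int[L2]_(x in rect A B) (g' x)%:E =
   \int[mu]_(x in `[0%R, A]) (g (x, B) - g (x, 0%R))%:E)%E.
Proof.
move=> A0 dg cg'.
rewrite integral_mkcond.
rewrite -(@integral12_prod_meas1 _ _ RR RR R mu mu); last first.
  by apply/(integrable_mkcond _ (measurable_rect A B)).1; exact: integrable_rect.
rewrite [RHS]integral_mkcond; apply: eq_integral => x _.
rewrite /fubini_F /patch /=; case: ifPn => xA.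
  rewrite -(FTC_continuous A0 (dg x) (continuous_slice_snd cg')).
  rewrite [RHS]integral_mkcond; apply: eq_integral => y _; rewrite /patch.
  have -> : ((x, y) \in rect A B) = (y \in `[0, B]%classic); last by [].
  by rewrite /rect in_setX /= xA.
rewrite integral0_eq // => y _.
have -> // : ((x, y) \in rect A B) = false.
by rewrite /rect in_setX /= (negbTE xA).
Qed.
End Calculus.

(** * The divergence theorem on zonogons *)

Lemma integral_negligible_diff (d : measure_display) (T : measurableType d)
    (R : realType) (m : {measure set T -> \bar R}) (A B : set T) (f : T -> R) :
  measurable A -> measurable B -> m.-negligible (A `\` B) ->
  m.-negligible (B `\` A) -> measurable_fun setT f ->
  (\int[m]_(x in A) (f x)%:E = \int[m]_(x in B) (f x)%:E)%E.
Proof.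
move=> mA mB nAB nBA mf; rewrite integral_mkcond [RHS]integral_mkcond.
have mr (D : set T) : measurable D -> measurable_fun setT ((EFin \o f) \_ D)%E.
  move=> mD; apply/(measurable_restrictT _ mD).1.
  by apply/measurable_EFinP; exact: measurable_funTS.
apply: ae_eq_integral => //; [exact: mr|exact: mr|].
apply: (negligibleS _ (negligibleU nAB nBA)) => x /=.
apply: contra_notP => /not_orP[/not_andP h1 /not_andP h2] _.
rewrite /patch; case: ifPn => [|/negP]; rewrite inE => xA.
  by case: h1 => // /contrapT xB; rewrite mem_set.
by case: h2 => // xB; rewrite memNset.
Qed.

Lemma integral_setU_negligible (d : measure_display) (T : measurableType d)
    (R : realType) (m : {measure set T -> \bar R}) (A B : set T) (f : T -> R) :
  measurable A -> measurable B -> m.-negligible (A `&` B) ->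
  measurable_fun setT f ->
  (\int[m]_(x in A `|` B) (f x)%:E =
   \int[m]_(x in A) (f x)%:E + \int[m]_(x in B) (f x)%:E)%E.
Proof.
move=> mA mB nAB mf.
have -> : A `|` B = A `|` (B `\` A).
  apply/seteqP; split=> x [Ax|]; [by left| |by left|by case; right].
  by move=> Bx; have [?|?] := pselect (A x); [left|right].
have mBA : measurable (B `\` A) by exact: measurableD.
rewrite integral_setU //; last 2 first.
  by apply/measurable_EFinP; exact: measurable_funTS.
  by apply/disj_setPS => x [Ax [_ /(_ Ax)]].
congr (_ + _)%E; apply: integral_negligible_diff => //.
  by apply: (negligibleS _ (negligible_set0 m)) => x [[]].
by apply: (negligibleS _ nAB) => x [Bx /not_andP[//|/contrapT Ax]].
Qed.

Section Zonogon.
Variable R : realType.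
Local Notation mu := (@lebesgue_measure R).
Local Notation RR := (measurableTypeR R).
Local Notation T2 := (RR * RR)%type.
Local Notation L2 := (mu \x mu)%E.

Lemma continuous_linear_pt (a b : R) : continuous (fun x : pt R => a * x.1 + b * x.2).
Proof.
move=> x; apply: cvgD; apply: cvgM; try exact: cvg_cst.
  exact: cvg_fst.
exact: cvg_snd.
Qed.

Lemma null2_line (a b c : R) : a != 0 \/ b != 0 ->
  null2 [set x : pt R | a * x.1 + b * x.2 = c].
Proof.
move=> ab.
have mL : measurable ([set x | a * x.1 + b * x.2 = c] : set T2).
  have mf := continuous_measurable_pt (@continuous_linear_pt a b).
  have := mf measurableT _ (measurable_set1 c); rewrite setTI.
  by congr (measurable _).
exists [set x : pt R | a * x.1 + b * x.2 = c]; split => //.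
case: ab => [a0|b0].
  rewrite /leb2; etransitivity; first exact: leb2_swapE.
  rewrite /product_measure2 integral0_eq // => y _ /=.
  have -> : ysection ([set x | a * x.1 + b * x.2 = c] : set T2) y = [set (c - b * y) / a].
    apply/seteqP; split => x; rewrite /ysection /= inE /=.
      by move=> <-; field.
    by move=> ->; field.
  exact: lebesgue_measure_set1.
rewrite /leb2 /product_measure1 integral0_eq // => x _ /=.
have -> : xsection ([set x | a * x.1 + b * x.2 = c] : set T2) x = [set (c - a * x) / b].
  apply/seteqP; split => y; rewrite /xsection /= inE /=.
    by move=> <-; field.
  by move=> ->; field.
exact: lebesgue_measure_set1.
Qed.

(** Cramer's formulas for the inverse of [affmap v d1 d2] when the determinant is 1. *)
Definition affinv (v d1 d2 : pt R) (x : pt R) : pt R :=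
  (cross (vsub x v) d2, cross d1 (vsub x v)).

Lemma affinvK (v d1 d2 : pt R) : cross d1 d2 = 1 ->
  cancel (affinv v d1 d2) (affmap v d1 d2).
Proof.
rewrite /cross => det x; rewrite /affinv /affmap /cross /vsub /= [RHS]surjective_pairing.
congr pair.
  transitivity (v.1 + (x.1 - v.1) * (d1.1 * d2.2 - d1.2 * d2.1)); [by ring|by rewrite det; ring].
transitivity (v.2 + (x.2 - v.2) * (d1.1 * d2.2 - d1.2 * d2.1)); [by ring|by rewrite det; ring].
Qed.

Lemma affmapK (v d1 d2 : pt R) : cross d1 d2 = 1 ->
  cancel (affmap v d1 d2) (affinv v d1 d2).
Proof.
rewrite /cross => det x; rewrite /affinv /affmap /cross /vsub /= [RHS]surjective_pairing.
congr pair.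
  transitivity (x.1 * (d1.1 * d2.2 - d1.2 * d2.1)); [by ring|by rewrite det; ring].
transitivity (x.2 * (d1.1 * d2.2 - d1.2 * d2.1)); [by ring|by rewrite det; ring].
Qed.

Lemma affinvE (v d1 d2 : pt R) : affinv v d1 d2 =
  affmap (- v.1 * d2.2 + v.2 * d2.1, - d1.1 * v.2 + d1.2 * v.1)
         (d2.2, - d1.2) (- d2.1, d1.1).
Proof.
by apply/funext => x; rewrite /affinv /affmap /cross /vsub /=; congr pair; ring.
Qed.

Lemma mpres_affinv (v d1 d2 : pt R) : cross d1 d2 = 1 -> mpres (affinv v d1 d2).
Proof.
move=> det; rewrite affinvE; apply: mpres_affmap; rewrite -det /cross /=; ring.
Qed.

Lemma null2_affmap (v d1 d2 : pt R) (E : set (pt R)) : cross d1 d2 = 1 ->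
  null2 E -> null2 (affmap v d1 d2 @` E).
Proof.
by move=> det; exact: (null2_mpres (mpres_affinv v det) (affmapK v det)).
Qed.

Definition para (v d1 d2 : pt R) (A B : R) : set T2 := affinv v d1 d2 @^-1` rect A B.

Lemma measurable_para v d1 d2 A B : cross d1 d2 = 1 -> measurable (para v d1 d2 A B).
Proof.
move=> det; have [mi _] := mpres_affinv v det.
by rewrite -[X in measurable X]setTI; apply: mi => //; exact: measurable_rect.
Qed.

Lemma integral_para (f : pt R -> R) v d1 d2 A B : cross d1 d2 = 1 -> continuous f ->
  (\int[L2]_(x in para v d1 d2 A B) (f x)%:E =
   \int[L2]_(x in rect A B) (f (affmap v d1 d2 x))%:E)%E.
Proof.
move=> det cf; rewrite (@integral_affmap R v d1 d2 f _ det); last 2 first.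
- exact: continuous_measurable_pt.
- exact: measurable_para.
congr (integral _ _ _); apply/seteqP; split => x; rewrite /para /=.
  by rewrite affmapK.
by rewrite affmapK.
Qed.

(** The vector [(d.2, - d.1)] is [d] turned clockwise by a right angle, hence an outer normal with
    the length of [d] along a boundary run counterclockwise. *)
Definition fluxd (p q : pt R -> R) (d : pt R) (x : pt R) : R := p x * d.2 - q x * d.1.

Definition flux (p q : pt R -> R) (d v : pt R) (l : R) : R :=
  \int[mu]_(s in `[0, l]) fluxd p q d (line v d s).

Lemma continuous_fluxd p q d : continuous p -> continuous q -> continuous (fluxd p q d).
Proof.
move=> cp cq x; apply: cvgB; apply: cvgM; try exact: cvg_cst.
  exact: cp.
exact: cq.
Qed.

Lemma integral_itvB (f g : R -> R) (l : R) : continuous f -> continuous g ->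
  (\int[mu]_(x in `[0%R, l]) (f x - g x)%:E =
   (\int[mu]_(x in `[0%R, l]) f x - \int[mu]_(x in `[0%R, l]) g x)%:E)%E.
Proof.
move=> cf cg; rewrite -RintegralB //; [|exact: integrable_itv|exact: integrable_itv].
rewrite /Rintegral fineK //; apply: integrable_fin_num => //.
apply: (@integrable_itv R (f \- g)) => x; apply: cvgB; [exact: cf|exact: cg].
Qed.

(** In the coordinates of [affmap] the field has components [fluxd p q d2] and [- fluxd p q d1], and
    determinant 1 keeps its divergence unchanged. Each partial derivative then integrates to a
    difference of fluxes through opposite sides. *)
Lemma divergence_para p q v d1 d2 A B : C1 p -> C1 q -> cross d1 d2 = 1 ->
  0 <= A -> 0 <= B ->
  (\int[L2]_(x in para v d1 d2 A B) (pdx p x + pdy q x)%:E =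
   (flux p q d2 (line v d1 A) B - flux p q d2 v B
    + (flux p q d1 v A - flux p q d1 (line v d2 B) A))%:E)%E.
Proof.
move=> Cp Cq det A0 B0.
have [_ _ cpx cpy] := Cp; have [_ _ cqx cqy] := Cq.
have cp := C1_continuous Cp; have cq := C1_continuous Cq.
have cF : continuous (fun x => pdx p x + pdy q x).
  by move=> x; apply: cvgD; [exact: cpx|exact: cqy].
rewrite integral_para //.
pose g1 : pt R -> R := fluxd p q d2 \o affmap v d1 d2.
pose g2 : pt R -> R := fun x => - fluxd p q d1 (affmap v d1 d2 x).
pose h1 : pt R -> R := (fun x => (pdx p x * d1.1 + pdy p x * d1.2) * d2.2
   - (pdx q x * d1.1 + pdy q x * d1.2) * d2.1) \o affmap v d1 d2.
pose h2 : pt R -> R := (fun x => - ((pdx p x * d2.1 + pdy p x * d2.2) * d1.2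
   - (pdx q x * d2.1 + pdy q x * d2.2) * d1.1)) \o affmap v d1 d2.
have ch1 : continuous h1.
  apply: continuous_comp_affmap => x.
  apply: cvgB; (apply: cvgM; last exact: cvg_cst); apply: cvgD;
    (apply: cvgM; last exact: cvg_cst); [exact: cpx|exact: cpy|exact: cqx|exact: cqy].
have ch2 : continuous h2.
  apply: continuous_comp_affmap => x; apply: cvgN.
  apply: cvgB; (apply: cvgM; last exact: cvg_cst); apply: cvgD;
    (apply: cvgM; last exact: cvg_cst); [exact: cpx|exact: cpy|exact: cqx|exact: cqy].
have E x : pdx p (affmap v d1 d2 x) + pdy q (affmap v d1 d2 x) = h1 x + h2 x.
  rewrite /h1 /h2 /=; set z := affmap v d1 d2 x; move: det; rewrite /cross => det.
  have -> : pdx p z + pdy q z = (pdx p z + pdy q z) * (d1.1 * d2.2 - d1.2 * d2.1).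
    by rewrite det mulr1.
  ring.
under eq_integral do rewrite E EFinD.
rewrite integralD //; last 3 first.
- exact: measurable_rect.
- exact: integrable_rect ch1.
- exact: integrable_rect ch2.
have aff1 y t : affmap v d1 d2 (t, y) = line (line v d2 y) d1 t.
  by rewrite /affmap /line /=; congr pair; ring.
have aff2 x t : affmap v d1 d2 (x, t) = line (line v d1 x) d2 t.
  by rewrite /affmap /line /=; congr pair; ring.
have D1 (y t : R) : is_derive t 1 (fun t => g1 (t, y)) (h1 (t, y)).
  rewrite /g1 /h1 /fluxd /= aff1.
  have -> : (fun t0 => p (affmap v d1 d2 (t0, y)) * d2.2 - q (affmap v d1 d2 (t0, y)) * d2.1)
    = (fun t0 => d2.2 *: p (line (line v d2 y) d1 t0))
      - (fun t0 => d2.1 *: q (line (line v d2 y) d1 t0)).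
    by apply/funext => t0; rewrite aff1 /= mulrC (mulrC (q _)).
  rewrite (mulrC _ d2.2) (mulrC _ d2.1).
  by apply: is_deriveB; apply: is_deriveZ; exact: C1_chain.
have D2 (x t : R) : is_derive t 1 (fun t => g2 (x, t)) (h2 (x, t)).
  rewrite /g2 /h2 /fluxd /= aff2.
  have -> : (fun t0 => - (p (affmap v d1 d2 (x, t0)) * d1.2 - q (affmap v d1 d2 (x, t0)) * d1.1))
    = - ((fun t0 => d1.2 *: p (line (line v d1 x) d2 t0))
      - (fun t0 => d1.1 *: q (line (line v d1 x) d2 t0))).
    by apply/funext => t0; rewrite aff2 /= mulrC (mulrC (q _)).
  rewrite (mulrC _ d1.2) (mulrC _ d1.1).
  by apply: is_deriveN; apply: is_deriveB; apply: is_deriveZ; exact: C1_chain.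
rewrite (integral_rect_fst B A0 D1 ch1) (integral_rect_snd A B0 D2 ch2).
rewrite EFinD; congr (_ + _)%E.
  under eq_integral => y _ do rewrite /g1 /= !aff2.
  rewrite integral_itvB.
  - rewrite /flux; congr (_ - _)%:E.
    by apply: eq_Rintegral => s _; rewrite /line /= !mul0r !addr0.
  - by apply: continuous_line; exact: continuous_fluxd.
  - by apply: continuous_line; exact: continuous_fluxd.
under eq_integral => x _ do rewrite /g2 /= !aff1 opprK addrC.
rewrite integral_itvB.
- rewrite /flux; congr (_ - _)%:E.
  by apply: eq_Rintegral => s _; rewrite /line /= !mul0r !addr0.
- by apply: continuous_line; exact: continuous_fluxd.
- by apply: continuous_line; exact: continuous_fluxd.
Qed.
(* [zon p d0 d2 X Y Z] is the hexagon with sides X d0, Y (d0 + d2), Z d2 and their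
   opposites, starting at p; [zonP] describes it in the coordinates (d0, d2). *)
Definition zonP (X Y Z : R) (z : pt R) : Prop :=
  [/\ 0 <= z.1 <= X + Y, 0 <= z.2 <= Y + Z & - Z <= z.1 - z.2 <= X].

Definition zon (p d0 d2 : pt R) (X Y Z : R) : set T2 :=
  [set x | zonP X Y Z (affinv p d0 d2 x)].

Lemma cross_vaddl (d0 d2 : pt R) : cross (vadd d0 d2) d2 = cross d0 d2.
Proof. rewrite /cross /vadd /=; ring. Qed.

Lemma cross_vaddr (d0 d2 : pt R) : cross d0 (vadd d0 d2) = cross d0 d2.
Proof. rewrite /cross /vadd /=; ring. Qed.

Lemma affinv_shiftb p d0 d2 X x : cross d0 d2 = 1 ->
  affinv (line p d0 X) (vadd d0 d2) d2 x =
  ((affinv p d0 d2 x).1 - X, (affinv p d0 d2 x).2 - (affinv p d0 d2 x).1 + X).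
Proof.
rewrite /cross => det; rewrite /affinv /cross /vsub /line /vadd /=; congr pair.
  transitivity ((x.1 - p.1) * d2.2 - (x.2 - p.2) * d2.1 - X * (d0.1 * d2.2 - d0.2 * d2.1)).
    by ring.
  by rewrite det mulr1.
transitivity (d0.1 * (x.2 - p.2) - d0.2 * (x.1 - p.1) -
  ((x.1 - p.1) * d2.2 - (x.2 - p.2) * d2.1) + X * (d0.1 * d2.2 - d0.2 * d2.1)).
  by ring.
by rewrite det mulr1.
Qed.

Lemma affinv_shiftc p d0 d2 Z x : cross d0 d2 = 1 ->
  affinv (line p d2 Z) d0 (vadd d0 d2) x =
  ((affinv p d0 d2 x).1 - (affinv p d0 d2 x).2 + Z, (affinv p d0 d2 x).2 - Z).
Proof.
rewrite /cross => det; rewrite /affinv /cross /vsub /line /vadd /=; congr pair.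
  transitivity ((x.1 - p.1) * d2.2 - (x.2 - p.2) * d2.1 -
    (d0.1 * (x.2 - p.2) - d0.2 * (x.1 - p.1)) + Z * (d0.1 * d2.2 - d0.2 * d2.1)).
    by ring.
  by rewrite det mulr1.
transitivity (d0.1 * (x.2 - p.2) - d0.2 * (x.1 - p.1) - Z * (d0.1 * d2.2 - d0.2 * d2.1)).
  by ring.
by rewrite det mulr1.
Qed.

Lemma null2_affinv_line p d0 d2 (a b c : R) : cross d0 d2 = 1 -> a != 0 \/ b != 0 ->
  null2 [set x | a * (affinv p d0 d2 x).1 + b * (affinv p d0 d2 x).2 = c].
Proof.
move=> det ab.
apply: (null2_sub _ (null2_affmap p det (null2_line c ab))) => x /= xc.
by exists (affinv p d0 d2 x) => //; rewrite affinvK.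
Qed.

Section zon_integral.
Variables (p d0 d2 : pt R) (X Y Z : R).
Hypotheses (det : cross d0 d2 = 1) (X0 : 0 <= X) (Y0 : 0 <= Y) (Z0 : 0 <= Z).
Let d1 := vadd d0 d2.
Let Pa := para p d0 d2 X Z.
Let Pb := para (line p d0 X) d1 d2 Y Z.
Let Pc := para (line p d2 Z) d0 d1 X Y.

Let det1 : cross d1 d2 = 1. Proof. by rewrite cross_vaddl. Qed.
Let det2 : cross d0 d1 = 1. Proof. by rewrite cross_vaddr. Qed.

Let PaE x : Pa x <-> 0 <= (affinv p d0 d2 x).1 <= X /\ 0 <= (affinv p d0 d2 x).2 <= Z.
Proof. by rewrite /Pa /para /rect /=; rewrite !in_itv. Qed.

Let PbE x : Pb x <-> 0 <= (affinv p d0 d2 x).1 - X <= Y /\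
  0 <= (affinv p d0 d2 x).2 - (affinv p d0 d2 x).1 + X <= Z.
Proof. by rewrite /Pb /para /preimage /mkset /d1 affinv_shiftb // /rect /= !in_itv. Qed.

Let PcE x : Pc x <-> 0 <= (affinv p d0 d2 x).1 - (affinv p d0 d2 x).2 + Z <= X /\
  0 <= (affinv p d0 d2 x).2 - Z <= Y.
Proof. by rewrite /Pc /para /preimage /mkset /d1 affinv_shiftc // /rect /= !in_itv. Qed.

(** The three parallelograms meet at the inner point [p + X d0 + Z d2]. A point beyond both [X] and
    [Z] is assigned by its side of the ray in direction [d1] from there, on which the coordinates
    differ by [X - Z]. *)
Lemma zon_paraE : zon p d0 d2 X Y Z = Pa `|` (Pb `|` Pc).
Proof.
apply/seteqP; split => x; rewrite /zon /mkset /zonP; set z := affinv p d0 d2 x.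
  move=> [/andP[h1 h2] /andP[h3 h4] /andP[h5 h6]].
  have [a1|a1] := leP z.1 X; have [a2|a2] := leP z.2 Z.
  - by left; apply/PaE; rewrite -/z; split; apply/andP; split; lra.
  - by right; right; apply/PcE; rewrite -/z; split; apply/andP; split; lra.
  - by right; left; apply/PbE; rewrite -/z; split; apply/andP; split; lra.
  - have [a3|a3] := leP (z.1 - z.2) (X - Z).
      by right; right; apply/PcE; rewrite -/z; split; apply/andP; split; lra.
    by right; left; apply/PbE; rewrite -/z; split; apply/andP; split; lra.
move=> H; have {H} [H|H|H] :
    [\/ 0 <= z.1 <= X /\ 0 <= z.2 <= Z, 0 <= z.1 - X <= Y /\ 0 <= z.2 - z.1 + X <= Z |
        0 <= z.1 - z.2 + Z <= X /\ 0 <= z.2 - Z <= Y].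
  by move: H => [/PaE|[/PbE|/PcE]] H; [apply: Or31|apply: Or32|apply: Or33].
all: by move: H => [/andP[h1 h2] /andP[h3 h4]]; move: X0 Y0 Z0 => X0' Y0' Z0';
  split; apply/andP; split; lra.
Qed.

Lemma measurable_zon : measurable (zon p d0 d2 X Y Z).
Proof.
by rewrite zon_paraE; apply: measurableU; [|apply: measurableU]; exact: measurable_para.
Qed.

Lemma integral_zon (f : pt R -> R) : continuous f ->
  (\int[L2]_(x in zon p d0 d2 X Y Z) (f x)%:E =
   \int[L2]_(x in Pa) (f x)%:E +
   (\int[L2]_(x in Pb) (f x)%:E + \int[L2]_(x in Pc) (f x)%:E))%E.
Proof.
move=> cf; have mf := continuous_measurable_pt cf.
have nz : (1 : R) != 0 by rewrite oner_eq0.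
have mPa : measurable Pa by exact: measurable_para.
have mPb : measurable Pb by exact: measurable_para.
have mPc : measurable Pc by exact: measurable_para.
rewrite zon_paraE integral_setU_negligible //.
- rewrite integral_setU_negligible //.
  apply/null2P.
  apply: (null2_sub _ (null2_affinv_line p (X - Z) (a := 1) (b := - 1) det _));
    last by left.
  move=> x [/PbE [/andP[h1 h2] /andP[h3 h4]] /PcE [/andP[h5 h6] /andP[h7 h8]]].
  rewrite /mkset; lra.
- exact: measurableU.
- apply/null2P; apply: (null2_sub (F := [set x | 1 * (affinv p d0 d2 x).1 + 0 * (affinv p d0 d2 x).2 = X]
    `|` [set x | 0 * (affinv p d0 d2 x).1 + 1 * (affinv p d0 d2 x).2 = Z])).
    move=> x [/PaE [/andP[h1 h2] /andP[h3 h4]] [/PbE|/PcE] [/andP[h5 h6] /andP[h7 h8]]].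
      left; rewrite /mkset; lra.
    right; rewrite /mkset; lra.
  by apply: null2U; apply: null2_affinv_line => //; [left|right].
Qed.

(** The fluxes through the three inner segments occur once with each sign and cancel; the six outer
    sides remain. *)
Lemma divergence_zon f g : C1 f -> C1 g ->
  (\int[L2]_(x in zon p d0 d2 X Y Z) (pdx f x + pdy g x)%:E =
   (flux f g d0 p X + flux f g d1 (line p d0 X) Y
    + flux f g d2 (line (line p d0 X) d1 Y) Z
    - flux f g d0 (line (line p d2 Z) d1 Y) X
    - flux f g d1 (line p d2 Z) Y - flux f g d2 p Z)%:E)%E.
Proof.
move=> Cf Cg.
have [_ _ cpx cpy] := Cf; have [_ _ cqx cqy] := Cg.
have cF : continuous (fun x => pdx f x + pdy g x).
  by move=> x; apply: cvgD; [exact: cpx|exact: cqy].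
rewrite (integral_zon cF) /Pa /Pb /Pc !divergence_para // -!EFinD; congr (_%:E).
(* [Pb] and [Pc] reach the inner corner by different paths; identifying the two expressions lets the
   fluxes along their common side cancel. *)
have -> : line (line p d2 Z) d0 X = line (line p d0 X) d2 Z.
  by rewrite /line /=; congr pair; ring.
ring.
Qed.

Lemma leb2_para v c0 c1 A B : cross c0 c1 = 1 -> 0 <= A -> 0 <= B ->
  (\int[L2]_(x in para v c0 c1 A B) 1%:E = (A * B)%:E)%E.
Proof.
move=> det' A0 B0; rewrite (@integral_para (cst 1)) //; last by move=> x; exact: cvg_cst.
etransitivity; first exact: (@integral_cst _ _ _ L2 _ (measurable_rect A B) 1%:E).
rewrite mul1e /rect [LHS]product_measure1E; [|exact: measurable_itv|exact: measurable_itv].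
have I C : 0 <= C -> (mu `[0%R, C] = C%:E)%E.
  move=> C0; rewrite lebesgue_measure_itv /= lte_fin; case: ifPn => [_|].
    by rewrite -EFinB subr0.
  by rewrite -leNgt => C1; congr (_%:E); lra.
by rewrite /= !I // EFinM.
Qed.

Lemma leb2_zon : leb2 (zon p d0 d2 X Y Z) = (X * Z + Y * Z + X * Y)%:E.
Proof.
transitivity (\int[L2]_(x in zon p d0 d2 X Y Z) (cst 1 x)%:E)%E.
  apply/esym; etransitivity; first exact: (@integral_cst _ _ _ L2 _ measurable_zon 1%:E).
  by rewrite mul1e.
rewrite integral_zon; last by move=> x; exact: cvg_cst.
by rewrite /Pa /Pb /Pc !leb2_para // -!EFinD addrA.
Qed.

End zon_integral.

(** The outer measure is squeezed: [H] together with a null set covers [E], and any cover of [E]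
    becomes one of [H] after adding a null set. *)
Lemma area_aeq (E H : set (pt R)) : measurable H -> aeq2 E H -> area E = leb2 H.
Proof.
move=> mH [[N [mN EN N0]] [N' [mN' EN' N'0]]].
have mH' : measurable (H : set T2) by [].
apply/eqP; rewrite eq_le; apply/andP; split.
  apply: (@le_trans _ _ (leb2 (H `|` N))).
    apply: ereal_inf_lbound; exists (H `|` N) => //; split; first exact: measurableU.
    by move=> x Ex; have [Hx|Hx] := pselect (H x); [left|right; exact: EN].
  have := @measureU2 _ _ _ L2 H N mH mN.
  have N0' : L2 N = 0%E := N0.
  by move=> /le_trans; apply; rewrite [X in (_ + X)%E]N0' adde0.
apply: le_ereal_inf_tmp => _ [B [mB EB] <-].
apply: (@le_trans _ _ (leb2 (B `|` N'))).
  apply: (@le_measure _ _ _ L2); rewrite ?inE //; first exact: measurableU.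
  move=> x Hx; have [Ex|Ex] := pselect (E x); [left; exact: EB|right; exact: EN'].
have := @measureU2 _ _ _ L2 B N' mB mN'.
have N0' : L2 N' = 0%E := N'0.
by move=> /le_trans; apply; rewrite [X in (_ + X)%E]N0' adde0.
Qed.
End Zonogon.

(** * The perimeter of a zonogon *)

Section Cutoff.
Variable R : realType.

Lemma C1_intro (f fx fy : pt R -> R) :
  (forall y t : R, is_derive t 1 (fun t => f (t, y)) (fx (t, y))) ->
  (forall x t : R, is_derive t 1 (fun t => f (x, t)) (fy (x, t))) ->
  continuous fx -> continuous fy -> C1 f.
Proof.
move=> dx dy cx cy.
have ex : pdx f = fx.
  by apply/funext => -[x y]; rewrite /pdx derive1E /=; have [_ ->] := dx y x.
have ey : pdy f = fy.
  by apply/funext => -[x y]; rewrite /pdy derive1E /=; have [_ ->] := dy x y.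
by split; rewrite ?ex ?ey.
Qed.

Lemma C1_cst (c : R) : C1 (fun _ : pt R => c).
Proof.
apply: (@C1_intro _ (fun=> 0) (fun=> 0)).
- by move=> y t; exact: is_derive_cst.
- by move=> y t; exact: is_derive_cst.
- by move=> x; exact: cvg_cst.
- by move=> x; exact: cvg_cst.
Qed.

Lemma C1_add (f g : pt R -> R) : C1 f -> C1 g -> C1 (fun x => f x + g x).
Proof.
move=> Cf Cg; have [_ _ fx fy] := Cf; have [_ _ gx gy] := Cg.
apply: (@C1_intro _ (fun x => pdx f x + pdx g x) (fun x => pdy f x + pdy g x)).
- by move=> y t; apply: is_deriveD; exact: C1_is_derive_fst.
- by move=> y t; apply: is_deriveD; exact: C1_is_derive_snd.
- by move=> x; apply: cvgD; [exact: fx|exact: gx].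
- by move=> x; apply: cvgD; [exact: fy|exact: gy].
Qed.

Lemma C1_mul (f g : pt R -> R) : C1 f -> C1 g -> C1 (fun x => f x * g x).
Proof.
move=> Cf Cg; have [_ _ fx fy] := Cf; have [_ _ gx gy] := Cg.
have cf := C1_continuous Cf; have cg := C1_continuous Cg.
apply: (@C1_intro _ (fun x => f x *: pdx g x + g x *: pdx f x)
   (fun x => f x *: pdy g x + g x *: pdy f x)).
- move=> y t.
  exact: (is_deriveM (C1_is_derive_fst y t Cf) (C1_is_derive_fst y t Cg)).
- move=> x t.
  exact: (is_deriveM (C1_is_derive_snd x t Cf) (C1_is_derive_snd x t Cg)).
- move=> x; apply: cvgD; apply: cvgM; [exact: cf|exact: gx|exact: cg|exact: fx].
- move=> x; apply: cvgD; apply: cvgM; [exact: cf|exact: gy|exact: cg|exact: fy].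
Qed.

Lemma C1_comp (h h' : R -> R) (f : pt R -> R) :
  (forall t : R, is_derive t 1 h (h' t)) -> continuous h' -> C1 f ->
  C1 (fun x => h (f x)).
Proof.
move=> dh ch' Cf; have [_ _ fx fy] := Cf; have cf := C1_continuous Cf.
apply: (@C1_intro _ (fun x => h' (f x) * pdx f x) (fun x => h' (f x) * pdy f x)).
- by move=> y t; exact: (is_derive1_comp (dh _) (C1_is_derive_fst y t Cf)).
- by move=> x t; exact: (is_derive1_comp (dh _) (C1_is_derive_snd x t Cf)).
- move=> x; apply: cvgM; last exact: fx.
  by apply: continuous_comp; [exact: cf|exact: ch'].
- move=> x; apply: cvgM; last exact: fy.
  by apply: continuous_comp; [exact: cf|exact: ch'].
Qed.

Lemma C1_linear (a b c : R) : C1 (fun x : pt R => c + (a * x.1 + b * x.2)).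
Proof.
apply: (@C1_intro _ (fun=> a) (fun=> b)); last 2 first.
- by move=> x; exact: cvg_cst.
- by move=> x; exact: cvg_cst.
- move=> y t /=; apply: is_derive_cvg => e e0; exists 1 => // h h0 _.
  by have -> : (c + (a * (t + h) + b * y) - (c + (a * t + b * y))) / h - a = 0;
    [field|rewrite normr0].
- move=> y t /=; apply: is_derive_cvg => e e0; exists 1 => // h h0 _.
  by have -> : (c + (a * y + b * (t + h)) - (c + (a * y + b * t))) / h - b = 0;
    [field|rewrite normr0].
Qed.

(** The square of the positive part is a simple cutoff with continuous derivative; all bumps are
    built from it by sums, products and composition. *)
Definition pos2 (t : R) : R := Num.max t 0 ^+ 2.

Lemma pos2_pos t : 0 <= t -> pos2 t = t ^+ 2.
Proof. by move=> t0; rewrite /pos2 max_l. Qed.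

Lemma pos2_neg t : t <= 0 -> pos2 t = 0.
Proof. by move=> t0; rewrite /pos2 max_r // expr0n. Qed.

Lemma pos2_ge0 t : 0 <= pos2 t.
Proof. exact: sqr_ge0. Qed.

Lemma pos2_derive (t : R) : is_derive t 1 pos2 (2 * Num.max t 0).
Proof.
apply: is_derive_cvg => e e0; exists e => // h h0 he.
(* In all four sign cases the error of the linear approximation is at most [h^2]. *)
have key : `|pos2 (t + h) - pos2 t - 2 * Num.max t 0 * h| <= `|h| ^+ 2.
  rewrite real_normK ?num_real // ler_norml.
  have [t0|t0] := leP 0 t; have [th|th] := leP 0 (t + h).
  - by rewrite (pos2_pos th) (pos2_pos t0); apply/andP; split; nra.
  - by rewrite (pos2_neg (ltW th)) (pos2_pos t0); apply/andP; split; nra.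
  - by rewrite (pos2_pos th) (pos2_neg (ltW t0)); apply/andP; split; nra.
  - by rewrite (pos2_neg (ltW th)) (pos2_neg (ltW t0)); apply/andP; split; nra.
have hh : 0 < `|h| by rewrite normr_gt0.
have -> : (pos2 (t + h) - pos2 t) / h - 2 * Num.max t 0 =
  (pos2 (t + h) - pos2 t - 2 * Num.max t 0 * h) / h by field.
rewrite normrM normfV ltr_pdivrMr //.
by apply: (le_lt_trans key); rewrite expr2 ltr_pM2r.
Qed.

Lemma continuous_pos2' : continuous (fun t : R => 2 * Num.max t 0).
Proof.
move=> t; apply/cvgrPdist_lt => e e0; exists (e / 2) => /=; first by rewrite /=; lra.
move=> s /= ts; rewrite -mulrBr normrM ger0_norm //.
have : `|Num.max t 0 - Num.max s 0| <= `|t - s|.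
  rewrite /Num.max; case: ifPn => h1; case: ifPn => h2.
  - by rewrite subrr normr0.
  - rewrite -leNgt in h2; rewrite !ler0_norm; lra.
  - rewrite -leNgt in h1; rewrite !ger0_norm; lra.
  - by [].
lra.
Qed.

Lemma C1_pos2 (f : pt R -> R) : C1 f -> C1 (fun x => pos2 (f x)).
Proof. exact: C1_comp pos2_derive continuous_pos2'. Qed.

(* [zeta] is 1 at 0 and vanishes outside ]-d, d[; [theta] dominates [zeta], is 1 on
   [0, +oo[ and vanishes below - d. *)
Definition zeta (d s : R) : R := pos2 (1 - (s / d) * (s / d)).
Definition theta (d s : R) : R := pos2 (1 - pos2 (- s / d)).

Section bumps.
Variables (d : R) (d0 : 0 < d).

Lemma zeta_ge0 s : 0 <= zeta d s. Proof. exact: pos2_ge0. Qed.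

Lemma theta_ge0 s : 0 <= theta d s. Proof. exact: pos2_ge0. Qed.

Lemma theta_le1 s : theta d s <= 1.
Proof.
rewrite /theta; set u := pos2 (- s / d); have u0 : 0 <= u := pos2_ge0 _.
have [h|h] := leP 0 (1 - u); last by rewrite pos2_neg //; exact: ltW.
by rewrite pos2_pos //; nra.
Qed.

Lemma theta_pos s : 0 <= s -> theta d s = 1.
Proof.
move=> s0; rewrite /theta [X in 1 - X]pos2_neg ?subr0 ?pos2_pos ?expr1n //.
by rewrite mulNr oppr_le0 divr_ge0 // ltW.
Qed.

Lemma theta_neg s : s <= - d -> theta d s = 0.
Proof.
move=> s0; rewrite /theta pos2_neg //.
have h : 1 <= - s / d by rewrite ler_pdivlMr // mul1r; lra.
by rewrite pos2_pos; nra.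
Qed.

Lemma zeta_le_theta s : zeta d s <= theta d s.
Proof.
have [s0|s0] := leP 0 s.
  rewrite theta_pos // /zeta; set u := s / d * (s / d).
  have u0 : 0 <= u by rewrite /u -expr2 sqr_ge0.
  have [h|h] := leP 0 (1 - u); last by rewrite pos2_neg //; exact: ltW.
  by rewrite pos2_pos //; nra.
rewrite /theta /zeta [X in _ <= pos2 (1 - X)]pos2_pos.
  by rewrite mulNr sqrrN expr2.
by rewrite divr_ge0 ?oppr_ge0 // ltW.
Qed.

Lemma zeta0 : zeta d 0 = 1.
Proof. by rewrite /zeta mul0r mul0r subr0 pos2_pos ?expr1n. Qed.

Lemma zeta_out s : d <= `|s| -> zeta d s = 0.
Proof.
move=> ds; rewrite /zeta pos2_neg //.
have h : 1 <= `|s / d| by rewrite normrM normfV (gtr0_norm d0) ler_pdivlMr // mul1r.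
by rewrite -expr2 -real_normK ?num_real // expr2; nra.
Qed.

End bumps.

(* The sum is the probability that exactly one of n independent events occurs. *)
Lemma exactly_one_le1 (a : nat -> R) n : (forall j, 0 <= a j <= 1) ->
  \sum_(k < n) a k * \prod_(j < n | j != k :> nat) (1 - a j) <= 1.
Proof.
move=> a01.
(* The induction needs the stronger bound to which the probability that no event occurs is added. *)
suff [] : \sum_(k < n) a k * \prod_(j < n | j != k :> nat) (1 - a j)
  + \prod_(j < n) (1 - a j) <= 1 /\ 0 <= \prod_(j < n) (1 - a j) <= 1.
  by move=> h1 /andP[h2 h3]; lra.
elim: n => [|n [IH1 IH2]]; first by rewrite !big_ord0 add0r ler01 lexx.
rewrite !big_ord_recr /=.
have -> : \sum_(i < n) a i * \prod_(j < n.+1 | j != i :> nat) (1 - a j) =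
  (1 - a n) * \sum_(k < n) a k * \prod_(j < n | j != k :> nat) (1 - a j).
  rewrite mulr_sumr; apply: eq_bigr => i _.
  rewrite [in LHS]big_mkcond big_ord_recr /= -big_mkcond /=.
  have -> : n != i :> nat by rewrite neq_ltn ltn_ord orbT.
  by rewrite mulrA mulrC.
have -> : \prod_(j < n.+1 | j != n :> nat) (1 - a j) = \prod_(j < n) (1 - a j).
  rewrite [in LHS]big_mkcond big_ord_recr /= eqxx mulr1; apply: eq_bigr => i _.
  by rewrite neq_ltn ltn_ord.
move: IH1 IH2; set S := \sum_(k < n) _; set P := \prod_(j < n) _ => IH1 /andP[P0 P1].
by have /andP[a0 a1] := a01 n; split; [nra|apply/andP; split; nra].
Qed.

Lemma C1_prod (I : Type) (s : seq I) (P : pred I) (f : I -> pt R -> R) :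
  (forall i, C1 (f i)) -> C1 (fun x => \prod_(i <- s | P i) f i x).
Proof.
move=> Cf; elim: s => [|i s IH].
  have -> : (fun x => \prod_(i <- [::] | P i) f i x) = (fun=> 1).
    by apply/funext => x; rewrite big_nil.
  exact: C1_cst.
have -> : (fun x => \prod_(i0 <- (i :: s) | P i0) f i0 x) =
   (fun x => (if P i then f i x else 1) * \prod_(i0 <- s | P i0) f i0 x).
  by apply/funext => x; rewrite big_cons; case: ifP; rewrite ?mul1r.
by apply: C1_mul => //; case: (P i); [exact: Cf|exact: C1_cst].
Qed.

End Cutoff.

Section Perimeter.
Variable R : realType.
Local Notation mu := (@lebesgue_measure R).
Local Notation RR := (measurableTypeR R).
Local Notation T2 := (RR * RR)%type.
Local Notation L2 := (mu \x mu)%E.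

Lemma Rintegral_cst_itv (c l : R) : 0 <= l -> \int[mu]_(s in `[0, l]) c = c * l.
Proof.
move=> l0; rewrite Rintegral_cst; last exact: measurable_itv.
suff I : mu `[0%R, l] = l%:E by transitivity (c * fine l%:E); [congr (_ * fine _); exact: I|].
rewrite lebesgue_measure_itv /= lte_fin; case: ifPn => [_|].
  by rewrite -EFinB subr0.
by rewrite -leNgt => C1; congr (_%:E); lra.
Qed.

(** Cauchy-Schwarz by Lagrange's identity: the squares of [fluxd] and of the scalar product with [d]
    add up to the product of the squared norms. *)
Lemma fluxd_bound (f g : pt R -> R) (d : pt R) (r : R) x : 0 <= r ->
  d.1 ^+ 2 + d.2 ^+ 2 = r ^+ 2 -> f x ^+ 2 + g x ^+ 2 <= 1 -> `|fluxd f g d x| <= r.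
Proof.
move=> r0 dr fg; rewrite -(ger0_norm r0) -ler_sqr ?nnegrE // !real_normK ?num_real //.
rewrite /fluxd -dr; move: (f x) (g x) fg => a b ab.
have : 0 <= (a * d.1 + b * d.2) ^+ 2 by exact: sqr_ge0.
have : 0 <= (1 - (a ^+ 2 + b ^+ 2)) * (d.1 ^+ 2 + d.2 ^+ 2).
  by apply: mulr_ge0; [rewrite subr_ge0|apply: addr_ge0; exact: sqr_ge0].
nra.
Qed.

Lemma flux_bound (f g : pt R -> R) (d v : pt R) (r l : R) : 0 <= r -> 0 <= l ->
  continuous f -> continuous g ->
  d.1 ^+ 2 + d.2 ^+ 2 = r ^+ 2 -> (forall x, f x ^+ 2 + g x ^+ 2 <= 1) ->
  `|flux f g d v l| <= r * l.
Proof.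
move=> r0 l0 cf cg dr fg; rewrite /flux.
have cF := continuous_line (v := v) (d := d) (continuous_fluxd (d := d) cf cg).
apply: le_trans (le_normr_Rintegral _ _) _ => //; first exact: integrable_itv.
rewrite -(Rintegral_cst_itv r l0); apply: le_Rintegral => //.
- apply: (@integrable_itv R (fun s => `|fluxd f g d (line v d s)|)) => x.
  by apply: cvg_norm; exact: cF.
- by apply: (@integrable_itv R (cst r)) => x; exact: cvg_cst.
- by move=> x _; exact: fluxd_bound.
Qed.

Lemma flux_lower (f g : pt R -> R) (d v : pt R) (r e l : R) : 0 <= r -> 0 < e ->
  2 * e <= l -> continuous f -> continuous g ->
  (forall s : R, 0 <= s <= l -> 0 <= fluxd f g d (line v d s)) ->
  (forall s : R, e <= s <= l - e -> fluxd f g d (line v d s) = r) ->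
  r * (l - 2 * e) <= flux f g d v l.
Proof.
move=> r0 e0 el cf cg F0 F1; rewrite /flux.
have cF := continuous_line (v := v) (d := d) (continuous_fluxd (d := d) cf cg).
have fin : (\int[mu]_(s in `[0%R, l]) (fluxd f g d (line v d s))%:E)%E \is a fin_num.
  apply: integrable_fin_num => //; exact: integrable_itv.
rewrite -lee_fin /Rintegral fineK //.
apply: (@le_trans _ _ (\int[mu]_(s in `[e, (l - e)%R]) (fluxd f g d (line v d s))%:E)%E).
  rewrite (@eq_integral _ _ _ _ _ (cst r%:E)); last first.
    by move=> s; rewrite inE /= in_itv /= => se; rewrite F1.
  rewrite integral_cst; last exact: measurable_itv.
  rewrite /= lebesgue_measure_itv /= lte_fin; case: ifPn => [_|].
    by rewrite -EFinB -EFinM lee_fin ler_wpM2l //; lra.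
  by rewrite -leNgt => C1; rewrite mule0 lee_fin (_ : l - 2 * e = 0) ?mulr0 //; lra.
apply: ge0_subset_integral => //.
- by apply/measurable_EFinP; apply: measurable_funTS; exact: continuous_measurable_fun.
- by move=> s /=; rewrite !in_itv /= => /andP[s1 s2]; apply/andP; split; lra.
Qed.

(** The Borel set chosen in [per_data] and the closed hexagon differ by null sets, so they give the
    same integral. *)
Lemma per_integralE (E H A : set (pt R)) (F : pt R -> R) : continuous F ->
  measurable H -> aeq2 E H -> measurable A -> A `<=` E -> null2 (E `\` A) ->
  (\int[@leb2 R]_(x in A) (F x)%:E = \int[L2]_(x in H) (F x)%:E)%E.
Proof.
move=> cF mH [EH HE] mA AE EA; have mF := continuous_measurable_pt cF.
rewrite leb2_integralE //; apply: integral_negligible_diff => //.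
  by apply/null2P; apply: (null2_sub _ EH) => x [/AE Ex Hx].
apply/null2P; apply: (null2_sub _ (null2U HE EA)) => x [Hx Ax].
by have [Ex|Ex] := pselect (E x); [right|left].
Qed.

(* In the coordinates of [zonP], [edge_fun k <= 0] is the half-plane of the k-th edge
   and [edge_pt k s] runs along that edge. *)
Definition edge_fun (X Y Z : R) (k : nat) (z : pt R) : R :=
  match k with
  | 0 => - z.2 | 1 => z.1 - z.2 - X | 2 => z.1 - X - Y
  | 3 => z.2 - (Y + Z) | 4 => - Z - z.1 + z.2 | _ => - z.1
  end.

Definition edge_pt (X Y Z : R) (k : nat) (s : R) : pt R :=
  match k with
  | 0 => (s, 0) | 1 => (X + s, s) | 2 => (X + Y, Y + s)
  | 3 => (Y + s, Z + Y) | 4 => (s, Z + s) | _ => (0, s)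
  end.

Lemma edge_fun_eq0 (X Y Z : R) (k : nat) (s : R) : (k < 6)%N ->
  edge_fun X Y Z k (edge_pt X Y Z k s) = 0.
Proof. by move: k => [|[|[|[|[|[|//]]]]]] _ /=; ring. Qed.

Lemma edge_fun_le (X Y Z e s : R) (k j : nat) : 0 < e ->
  2 * e <= X -> 2 * e <= Y -> 2 * e <= Z -> (k < 6)%N -> (j < 6)%N -> j != k ->
  e <= s <= nth 0 [:: X; Y; Z; X; Y; Z] k - e ->
  edge_fun X Y Z j (edge_pt X Y Z k s) <= - e.
Proof.
move=> e0 eX eY eZ k6 j6 jk.
by move: k j k6 j6 jk => [|[|[|[|[|[|//]]]]]] [|[|[|[|[|[|//]]]]]] //= _ _ _ /andP[s1 s2]; lra.
Qed.

Variables (p d0 d2 : pt R) (X Y Z r : R).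
Hypotheses (det : cross d0 d2 = 1) (X0 : 0 < X) (Y0 : 0 < Y) (Z0 : 0 < Z) (r0 : 0 < r).
Let d1 := vadd d0 d2.
Hypotheses (nd0 : d0.1 ^+ 2 + d0.2 ^+ 2 = r ^+ 2)
  (nd1 : d1.1 ^+ 2 + d1.2 ^+ 2 = r ^+ 2) (nd2 : d2.1 ^+ 2 + d2.2 ^+ 2 = r ^+ 2).
Let H := zon p d0 d2 X Y Z.

(** The integral is a signed sum of six boundary fluxes, and the flux of an admissible field through
    a side is at most the length of that side, such as [r * X]. *)
Lemma Per_zon_le (E : set (pt R)) : aeq2 E H ->
  (Per E <= (2 * r * (X + Y + Z))%:E)%E.
Proof.
move=> EH; apply: ge_ereal_sup => _ [[[f g] A] [[/= Cf Cg _ fg] [mA AE EA]] <-] /=.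
have [_ _ fx _] := Cf; have [_ _ _ gy] := Cg.
have cF : continuous (fun x => pdx f x + pdy g x).
  by move=> x; apply: cvgD; [exact: fx|exact: gy].
rewrite (per_integralE cF _ EH) //; last by apply: measurable_zon => //; exact: ltW.
rewrite divergence_zon // ?(ltW X0) ?(ltW Y0) ?(ltW Z0) //; rewrite lee_fin -/d1.
have cf := C1_continuous Cf; have cg := C1_continuous Cg.
have B d v l : d.1 ^+ 2 + d.2 ^+ 2 = r ^+ 2 -> 0 < l ->
    - (r * l) <= flux f g d v l <= r * l.
  move=> nd l0; rewrite -ler_norml; apply: flux_bound => //; exact: ltW.
have /andP[_ h1] := B d0 p X nd0 X0.
have /andP[_ h2] := B d1 (line p d0 X) Y nd1 Y0.
have /andP[_ h3] := B d2 (line (line p d0 X) d1 Y) Z nd2 Z0.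
have /andP[h4 _] := B d0 (line (line p d2 Z) d1 Y) X nd0 X0.
have /andP[h5 _] := B d1 (line p d2 Z) Y nd1 Y0.
have /andP[h6 _] := B d2 p Z nd2 Z0.
lra.
Qed.
Local Notation edgef := (edge_fun X Y Z).

(* Equal to 1 on the k-th edge away from its end points.  The bumps add up to at most 1,
   so the combination of the outer normals with these weights is admissible. *)
Definition bumpf (e : R) (k : nat) (x : pt R) : R :=
  zeta e (edgef k (affinv p d0 d2 x)) *
  \prod_(j < 6 | j != k :> nat) (1 - theta e (edgef j (affinv p d0 d2 x))).

Definition field_x (e : R) (x : pt R) : R :=
  ((bumpf e 0 x - bumpf e 3 x) * d0.2 + (bumpf e 1 x - bumpf e 4 x) * d1.2
   + (bumpf e 2 x - bumpf e 5 x) * d2.2) / r.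

Definition field_y (e : R) (x : pt R) : R :=
  - (((bumpf e 0 x - bumpf e 3 x) * d0.1 + (bumpf e 1 x - bumpf e 4 x) * d1.1
   + (bumpf e 2 x - bumpf e 5 x) * d2.1) / r).

Lemma C1_opp (f : pt R -> R) : C1 f -> C1 (fun x => - f x).
Proof.
move=> Cf; have -> : (fun x => - f x) = (fun x => (-1) * f x).
  by apply/funext => x; rewrite mulN1r.
by apply: C1_mul => //; exact: C1_cst.
Qed.

Lemma C1_sub (f g : pt R -> R) : C1 f -> C1 g -> C1 (fun x => f x - g x).
Proof. by move=> Cf Cg; apply: C1_add => //; exact: C1_opp. Qed.

Lemma C1_mulc (f : pt R -> R) (c : R) : C1 f -> C1 (fun x => f x * c).
Proof. by move=> Cf; apply: C1_mul => //; exact: C1_cst. Qed.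

Lemma C1_affinv1 : C1 (fun x => (affinv p d0 d2 x).1).
Proof.
have -> : (fun x => (affinv p d0 d2 x).1) =
  (fun x => (p.2 * d2.1 - p.1 * d2.2) + (d2.2 * x.1 + (- d2.1) * x.2)).
  by apply/funext => x; rewrite /affinv /cross /vsub /=; ring.
exact: C1_linear.
Qed.

Lemma C1_affinv2 : C1 (fun x => (affinv p d0 d2 x).2).
Proof.
have -> : (fun x => (affinv p d0 d2 x).2) =
  (fun x => (p.1 * d0.2 - p.2 * d0.1) + ((- d0.2) * x.1 + d0.1 * x.2)).
  by apply/funext => x; rewrite /affinv /cross /vsub /=; ring.
exact: C1_linear.
Qed.

Lemma C1_edge_fun k : C1 (fun x => edgef k (affinv p d0 d2 x)).
Proof.
have C1a := C1_affinv1; have C1b := C1_affinv2.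
case: k => [|[|[|[|[|k]]]]] /=.
- exact: C1_opp.
- by apply: C1_sub; [exact: C1_sub|exact: C1_cst].
- by apply: C1_sub; [apply: C1_sub; [exact: C1a|]|]; exact: C1_cst.
- by apply: C1_sub; [exact: C1b|exact: C1_cst].
- by apply: C1_add; [apply: C1_sub; [exact: C1_cst|exact: C1a]|exact: C1b].
- exact: C1_opp.
Qed.

Lemma C1_bump e k : C1 (bumpf e k).
Proof.
apply: C1_mul.
  rewrite /zeta; apply: C1_pos2; apply: C1_sub; first exact: C1_cst.
  by apply: C1_mul; apply: C1_mulc; exact: C1_edge_fun.
apply: C1_prod => j; apply: C1_sub; first exact: C1_cst.
rewrite /theta; apply: C1_pos2; apply: C1_sub; first exact: C1_cst.
by apply: C1_pos2; apply: C1_mulc; apply: C1_opp; exact: C1_edge_fun.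
Qed.

Lemma C1_field_x e : C1 (field_x e).
Proof.
by apply: C1_mulc; apply: C1_add; [apply: C1_add|];
  apply: C1_mulc; apply: C1_sub; exact: C1_bump.
Qed.

Lemma C1_field_y e : C1 (field_y e).
Proof.
by apply: C1_opp; apply: C1_mulc; apply: C1_add; [apply: C1_add|];
  apply: C1_mulc; apply: C1_sub; exact: C1_bump.
Qed.

Section fixed_e.
Variables (e : R) (e0 : 0 < e).

Lemma bump_ge0 k x : 0 <= bumpf e k x.
Proof.
apply: mulr_ge0; first exact: zeta_ge0.
by apply: prodr_ge0 => j _; rewrite subr_ge0; exact: theta_le1.
Qed.

Lemma bump_sum x : \sum_(k < 6) bumpf e k x <= 1.
Proof.
apply: le_trans (exactly_one_le1 6 (a := fun j => theta e (edgef j (affinv p d0 d2 x))) _).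
  apply: ler_sum => k _; apply: ler_wpM2r; last exact: zeta_le_theta.
  by apply: prodr_ge0 => j _; rewrite subr_ge0; exact: theta_le1.
by move=> j; rewrite theta_ge0 theta_le1.
Qed.

Lemma bump_eq0 k j x : (j < 6)%N -> j != k ->
  0 <= edgef j (affinv p d0 d2 x) -> bumpf e k x = 0.
Proof.
move=> j6 jk hj; rewrite /bumpf (bigD1 (Ordinal j6)) //= theta_pos //.
by rewrite subrr mul0r mulr0.
Qed.

Lemma bump_eq1 k x : edgef k (affinv p d0 d2 x) = 0 ->
  (forall j, (j < 6)%N -> j != k -> edgef j (affinv p d0 d2 x) <= - e) ->
  bumpf e k x = 1.
Proof.
move=> hk hj; rewrite /bumpf hk zeta0 mul1r big1 // => j jk.
by rewrite theta_neg ?subr0 //; exact: hj.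
Qed.

(** Equal lengths of [d0], [d2] and their sum force an angle of 120 degrees between [d0] and
    [d2]. *)
Lemma dot02 : d0.1 * d2.1 + d0.2 * d2.2 = - (r ^+ 2 / 2).
Proof. by move: nd0 nd1 nd2; rewrite /d1 /vadd /= => n0 n1 n2; nra. Qed.

Lemma field_norm x : field_x e x ^+ 2 + field_y e x ^+ 2 <= 1.
Proof.
have S : bumpf e 0 x + bumpf e 1 x + bumpf e 2 x + bumpf e 3 x + bumpf e 4 x
    + bumpf e 5 x <= 1.
  by have := bump_sum x; rewrite !big_ord_recl big_ord0 addr0 !addrA.
move: S.
have := bump_ge0 0 x; have := bump_ge0 1 x; have := bump_ge0 2 x.
have := bump_ge0 3 x; have := bump_ge0 4 x; have := bump_ge0 5 x.
rewrite /field_x /field_y.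
move: (bumpf e 0 x) (bumpf e 1 x) (bumpf e 2 x) (bumpf e 3 x) (bumpf e 4 x) (bumpf e 5 x).
move=> b0 b1 b2 b3 b4 b5 h5 h4 h3 h2 h1 h0 S.
have rn : r != 0 by rewrite gt_eqF.
(* This is the squared norm of a combination of three unit vectors at steps of 60 degrees. Its mixed
   terms have coefficients 1 and -1, so it is at most [(|c0| + |c1| + |c2|)^2], which the sum of the
   bumps bounds by 1. *)
have -> : (((b0 - b3) * d0.2 + (b1 - b4) * d1.2 + (b2 - b5) * d2.2) / r) ^+ 2 +
  (- (((b0 - b3) * d0.1 + (b1 - b4) * d1.1 + (b2 - b5) * d2.1) / r)) ^+ 2 =
  (b0 - b3) ^+ 2 + (b1 - b4) ^+ 2 + (b2 - b5) ^+ 2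
  + (b0 - b3) * (b1 - b4) - (b0 - b3) * (b2 - b5) + (b1 - b4) * (b2 - b5).
  have E : (b0 - b3) ^+ 2 + (b1 - b4) ^+ 2 + (b2 - b5) ^+ 2
    + (b0 - b3) * (b1 - b4) - (b0 - b3) * (b2 - b5) + (b1 - b4) * (b2 - b5) =
    ((b0 - b3) ^+ 2 * (d0.1 ^+ 2 + d0.2 ^+ 2) + (b1 - b4) ^+ 2 * (d1.1 ^+ 2 + d1.2 ^+ 2)
     + (b2 - b5) ^+ 2 * (d2.1 ^+ 2 + d2.2 ^+ 2)
     + 2 * (b0 - b3) * (b1 - b4) * (d0.1 ^+ 2 + d0.2 ^+ 2 + (d0.1 * d2.1 + d0.2 * d2.2))
     + 2 * (b0 - b3) * (b2 - b5) * (d0.1 * d2.1 + d0.2 * d2.2)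
     + 2 * (b1 - b4) * (b2 - b5) * (d2.1 ^+ 2 + d2.2 ^+ 2 + (d0.1 * d2.1 + d0.2 * d2.2)))
    / r ^+ 2.
    by rewrite nd0 nd1 nd2 dot02; field.
  by rewrite E /d1 /vadd /=; field.
set c0 := b0 - b3; set c1 := b1 - b4; set c2 := b2 - b5.
have n0 : `|c0| <= b0 + b3 by rewrite ler_norml /c0; apply/andP; split; lra.
have n1 : `|c1| <= b1 + b4 by rewrite ler_norml /c1; apply/andP; split; lra.
have n2 : `|c2| <= b2 + b5 by rewrite ler_norml /c2; apply/andP; split; lra.
have T : (`|c0| + `|c1| + `|c2|) ^+ 2 <= 1.
  by rewrite expr_le1 ?addr_ge0 //; lra.
have q0 : `|c0| ^+ 2 = c0 ^+ 2 by rewrite real_normK ?num_real.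
have q1 : `|c1| ^+ 2 = c1 ^+ 2 by rewrite real_normK ?num_real.
have q2 : `|c2| ^+ 2 = c2 ^+ 2 by rewrite real_normK ?num_real.
have m01 : c0 * c1 <= `|c0| * `|c1| by rewrite -normrM ler_norm.
have m02 : - (c0 * c2) <= `|c0| * `|c2| by rewrite -normrM -normrN ler_norm.
have m12 : c1 * c2 <= `|c1| * `|c2| by rewrite -normrM ler_norm.
have k01 : 0 <= `|c0| * `|c1| by rewrite mulr_ge0.
have k02 : 0 <= `|c0| * `|c2| by rewrite mulr_ge0.
have k12 : 0 <= `|c1| * `|c2| by rewrite mulr_ge0.
nra.
Qed.

End fixed_e.
Section lower.
Variables (e : R) (e0 : 0 < e).

(** Where the k-th bump is nonzero all six edge functions are below [e]; the four that involve a
    single coordinate give the box. *)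
Lemma bump_support k x : (k < 6)%N -> bumpf e k x != 0 ->
  [/\ - e <= (affinv p d0 d2 x).1 <= X + Y + e &
      - e <= (affinv p d0 d2 x).2 <= Y + Z + e].
Proof.
move=> k6 bx.
have hk : `|edgef k (affinv p d0 d2 x)| < e.
  rewrite ltNge; apply/negP => hk; move: bx; rewrite /bumpf zeta_out // mul0r.
  by rewrite eqxx.
have hj j : (j < 6)%N -> edgef j (affinv p d0 d2 x) < e.
  move=> j6; have [->|jk] := eqVneq j k; first by apply: le_lt_trans (ler_norm _) hk.
  rewrite ltNge; apply/negP => h; move/eqP: bx; apply.
  by apply: (bump_eq0 e0 j6 jk); exact: le_trans (ltW e0) h.
move: (affinv p d0 d2 x) hj => z hj.
have := hj 0 isT; have := hj 2 isT; have := hj 3 isT; have := hj 5 isT.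
rewrite /= => h5 h3 h2 h0.
by split; apply/andP; split; lra.
Qed.

Lemma field_support x : field_x e x != 0 \/ field_y e x != 0 ->
  exists2 k, (k < 6)%N & bumpf e k x != 0.
Proof.
move=> fx; apply: contrapT => adjacent.
have b k : (k < 6)%N -> bumpf e k x = 0.
  by move=> k6; apply/eqP; apply: contrapT => /negP h; apply: adjacent; exists k.
by case: fx; rewrite /field_x /field_y !b // subr0 !mul0r !addr0 mul0r ?oppr0 eqxx.
Qed.

Lemma field_compact : compact (closure [set x | field_x e x != 0 \/ field_y e x != 0]).
Proof.
pose N := X + Y + Z + e.
pose M := `|p.1| + `|p.2| + N * (`|d0.1| + `|d0.2| + `|d2.1| + `|d2.2|).
have N0 : 0 <= N by rewrite /N; move: X0 Y0 Z0 e0 => ????; lra.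
pose B : set (R * R) := (`[- M, M]%classic : set R) `*` (`[- M, M]%classic : set R).
have cB : compact B by apply: compact_setX; exact: segment_compact.
apply: (subclosed_compact _ cB); first exact: closed_closure.
have clB : closed B by apply: compact_closed => //; exact: norm_hausdorff.
rewrite closureE; apply: (@smallest_sub _ _ _ _ clB) => x.
move=> /field_support[k k6 bk].
have [/andP[h1 h2] /andP[h3 h4]] := bump_support k6 bk.
have a1 : `|(affinv p d0 d2 x).1| <= N.
  by rewrite ler_norml /N; move: X0 Y0 Z0 e0 => ????; apply/andP; split; lra.
have a2 : `|(affinv p d0 d2 x).2| <= N.
  by rewrite ler_norml /N; move: X0 Y0 Z0 e0 => ????; apply/andP; split; lra.
rewrite -(affinvK p det x); move: (affinv p d0 d2 x) a1 a2 => z a1 a2.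
have bnd (u a b : R) : `|u| <= `|p.1| + `|p.2| ->
    `|a| + `|b| <= `|d0.1| + `|d0.2| + `|d2.1| + `|d2.2| ->
    `|u + z.1 * a + z.2 * b| <= M.
  move=> hu hab; apply: le_trans (ler_normD _ _) _.
  apply: (@le_trans _ _ (`|u| + N * `|a| + N * `|b|)).
    rewrite lerD //; last by rewrite normrM ler_wpM2r.
    by apply: le_trans (ler_normD _ _) _; rewrite lerD // normrM ler_wpM2r.
  rewrite /M -addrA -mulrDr lerD // ler_wpM2l //.
have q1 := normr_ge0 d0.1; have q2 := normr_ge0 d0.2.
have q3 := normr_ge0 d2.1; have q4 := normr_ge0 d2.2.
have q5 := normr_ge0 p.1; have q6 := normr_ge0 p.2.
by split; rewrite /= in_itv /= -ler_norml; apply: bnd; lra.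
Qed.

Lemma field_admissible : admissible (field_x e) (field_y e).
Proof.
split; [exact: C1_field_x|exact: C1_field_y|exact: field_compact|].
by move=> x; exact: field_norm.
Qed.

Lemma fluxd_field (d : pt R) x : fluxd (field_x e) (field_y e) d x =
  ((bumpf e 0 x - bumpf e 3 x) * (d0.1 * d.1 + d0.2 * d.2)
   + (bumpf e 1 x - bumpf e 4 x) * (d1.1 * d.1 + d1.2 * d.2)
   + (bumpf e 2 x - bumpf e 5 x) * (d2.1 * d.1 + d2.2 * d.2)) / r.
Proof. by rewrite /fluxd /field_x /field_y; field; rewrite gt_eqF. Qed.

(** On the line of edge [k] all other bumps vanish. The last three edges are run in the directions
    [d0], [d1], [d2], against the counterclockwise sense, which gives the sign -1. *)
Lemma fluxd_edge (k : nat) (c x : pt R) : (k < 6)%N ->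
  c = nth d0 [:: d0; d1; d2; d0; d1; d2] k ->
  edgef k (affinv p d0 d2 x) = 0 ->
  fluxd (field_x e) (field_y e) c x = (if (k < 3)%N then 1 else -1) * (r * bumpf e k x).
Proof.
move=> k6 ck hk; rewrite fluxd_field.
have b0 j : (j < 6)%N -> j != k -> bumpf e j x = 0.
  by move=> j6 jk; apply: (bump_eq0 e0 k6); rewrite 1?eq_sym // hk.
have m0 : d0.1 * d0.1 + d0.2 * d0.2 = r * r by rewrite -!expr2.
have m1 : d1.1 * d1.1 + d1.2 * d1.2 = r * r by rewrite -!expr2.
have m2 : d2.1 * d2.1 + d2.2 * d2.2 = r * r by rewrite -!expr2.
have rn : r != 0 by rewrite gt_eqF.
move: k k6 ck {hk} b0 => [|[|[|[|[|[|//]]]]]] _ ck b0.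
- rewrite (b0 1) // (b0 2) // (b0 3) // (b0 4) // (b0 5) //; have -> : c = d0 by [].
  by rewrite m0 (_ : (0 < 3)%N = true) //; field.
- rewrite (b0 0) // (b0 2) // (b0 3) // (b0 4) // (b0 5) //; have -> : c = d1 by [].
  by rewrite m1 (_ : (1 < 3)%N = true) //; field.
- rewrite (b0 0) // (b0 1) // (b0 3) // (b0 4) // (b0 5) //; have -> : c = d2 by [].
  by rewrite m2 (_ : (2 < 3)%N = true) //; field.
- rewrite (b0 0) // (b0 1) // (b0 2) // (b0 4) // (b0 5) //; have -> : c = d0 by [].
  by rewrite m0 (_ : (3 < 3)%N = false) //; field.
- rewrite (b0 0) // (b0 1) // (b0 2) // (b0 3) // (b0 5) //; have -> : c = d1 by [].
  by rewrite m1 (_ : (4 < 3)%N = false) //; field.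
- rewrite (b0 0) // (b0 1) // (b0 2) // (b0 3) // (b0 4) //; have -> : c = d2 by [].
  by rewrite m2 (_ : (5 < 3)%N = false) //; field.
Qed.

Lemma edge_flux_lower (k : nat) (c v : pt R) (l : R) : (k < 6)%N ->
  c = nth d0 [:: d0; d1; d2; d0; d1; d2] k -> 2 * e <= l ->
  (forall s, edgef k (affinv p d0 d2 (line v c s)) = 0) ->
  (forall s j, e <= s <= l - e -> (j < 6)%N -> j != k ->
     edgef j (affinv p d0 d2 (line v c s)) <= - e) ->
  r * (l - 2 * e) <= (if (k < 3)%N then 1 else -1) * flux (field_x e) (field_y e) c v l.
Proof.
move=> k6 ck el h0 h1; have cx := C1_continuous (C1_field_x e).
have cy := C1_continuous (C1_field_y e).
have b1 s : e <= s <= l - e -> bumpf e k (line v c s) = 1.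
  by move=> se; apply: bump_eq1 => // j; exact: h1.
have F s := fluxd_edge k6 ck (h0 s).
move: F; case: ifPn => k3 F.
  rewrite mul1r; apply: flux_lower => //; first exact: ltW.
    by move=> s _; rewrite F mul1r mulr_ge0 ?bump_ge0 // ltW.
  by move=> s se; rewrite F mul1r b1 // mulr1.
(* For the reversed edges the lower bound is applied to the opposite field, whose flux density is
   nonnegative. *)
have -> : -1 * flux (field_x e) (field_y e) c v l =
  flux (fun x => - field_x e x) (fun x => - field_y e x) c v l.
  rewrite /flux -RintegralZl //; last first.
    by apply: integrable_itv; apply: continuous_line; exact: continuous_fluxd.
  by apply: eq_Rintegral => s _; rewrite /fluxd; ring.
have G s : fluxd (fun x => - field_x e x) (fun x => - field_y e x) c (line v c s) =
   r * bumpf e k (line v c s).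
  transitivity (- fluxd (field_x e) (field_y e) c (line v c s)).
    by rewrite /fluxd; ring.
  by rewrite F mulN1r opprK.
apply: flux_lower => //; first exact: ltW.
- by move=> x; apply: cvgN; exact: cx.
- by move=> x; apply: cvgN; exact: cy.
- by move=> s _; rewrite G mulr_ge0 ?bump_ge0 // ltW.
- by move=> s se; rewrite G b1 // mulr1.
Qed.

End lower.
(** Each edge loses at most [r * e] of flux at each of its two ends, so the six edges lose at most
    [12 * r * e]. *)
Lemma Per_zon_ge_approx (E : set (pt R)) (e : R) : lmeas E -> aeq2 E H -> 0 < e ->
  2 * e <= X -> 2 * e <= Y -> 2 * e <= Z ->
  ((2 * r * (X + Y + Z) - 12 * r * e)%:E <= Per E)%E.
Proof.
move=> [A [mA [AE EA]]] EH e0 eX eY eZ.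
have adm := field_admissible e0; have [Cf Cg _ _] := adm.
have [_ _ fx _] := Cf; have [_ _ _ gy] := Cg.
have cF : continuous (fun x => pdx (field_x e) x + pdy (field_y e) x).
  by move=> x; apply: cvgD; [exact: fx|exact: gy].
apply: (@le_trans _ _ (\int[@leb2 R]_(x in A) (pdx (field_x e) x + pdy (field_y e) x)%:E)%E);
  last by apply: ereal_sup_ubound; exists ((field_x e, field_y e), A).
rewrite (per_integralE cF _ EH) //; last by apply: measurable_zon => //; exact: ltW.
rewrite divergence_zon // ?(ltW X0) ?(ltW Y0) ?(ltW Z0) //; rewrite lee_fin -/d1.
have x0 := X0; have y0 := Y0; have z0 := Z0.
have EF k c v : (k < 6)%N -> c = nth d0 [:: d0; d1; d2; d0; d1; d2] k ->
    (forall s, line v c s = affmap p d0 d2 (edge_pt X Y Z k s)) ->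
    r * (nth 0 [:: X; Y; Z; X; Y; Z] k - 2 * e) <= (if (k < 3)%N then 1 else -1) *
      flux (field_x e) (field_y e) c v (nth 0 [:: X; Y; Z; X; Y; Z] k).
  move=> k6 ck V; apply: edge_flux_lower => //.
  - by move: k k6 {ck V} => [|[|[|[|[|[|//]]]]]].
  - by move=> s; rewrite V affmapK //; exact: edge_fun_eq0.
  - by move=> s j se j6 jk; rewrite V affmapK //; apply: edge_fun_le.
have h0 := EF 0 d0 p isT erefl.
have h1 := EF 1 d1 (line p d0 X) isT erefl.
have h2 := EF 2 d2 (line (line p d0 X) d1 Y) isT erefl.
have h3 := EF 3 d0 (line (line p d2 Z) d1 Y) isT erefl.
have h4 := EF 4 d1 (line p d2 Z) isT erefl.
have h5 := EF 5 d2 p isT erefl.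
have {}h0 : r * (X - 2 * e) <= 1 * flux (field_x e) (field_y e) d0 p X.
  by apply: h0 => s; rewrite /line /affmap /=; congr pair; ring.
have {}h1 : r * (Y - 2 * e) <= 1 * flux (field_x e) (field_y e) d1 (line p d0 X) Y.
  by apply: h1 => s; rewrite /line /affmap /d1 /vadd /=; congr pair; ring.
have {}h2 : r * (Z - 2 * e) <=
    1 * flux (field_x e) (field_y e) d2 (line (line p d0 X) d1 Y) Z.
  by apply: h2 => s; rewrite /line /affmap /d1 /vadd /=; congr pair; ring.
have {}h3 : r * (X - 2 * e) <=
    -1 * flux (field_x e) (field_y e) d0 (line (line p d2 Z) d1 Y) X.
  by apply: h3 => s; rewrite /line /affmap /d1 /vadd /=; congr pair; ring.
have {}h4 : r * (Y - 2 * e) <= -1 * flux (field_x e) (field_y e) d1 (line p d2 Z) Y.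
  by apply: h4 => s; rewrite /line /affmap /d1 /vadd /=; congr pair; ring.
have {}h5 : r * (Z - 2 * e) <= -1 * flux (field_x e) (field_y e) d2 p Z.
  by apply: h5 => s; rewrite /line /affmap /=; congr pair; ring.
move: (flux _ _ _ _ _) h0 => F0 h0; move: (flux _ _ _ _ _) h1 => F1 h1.
move: (flux _ _ _ _ _) h2 => F2 h2; move: (flux _ _ _ _ _) h3 => F3 h3.
move: (flux _ _ _ _ _) h4 => F4 h4; move: (flux _ _ _ _ _) h5 => F5 h5.
lra.
Qed.

Theorem Per_zon (E : set (pt R)) : lmeas E -> aeq2 E H ->
  Per E = (2 * r * (X + Y + Z))%:E.
Proof.
move=> mE EH; apply/eqP; rewrite eq_le Per_zon_le //=.
apply/lee_subgt0Pr => k k0.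
(* The first entry keeps the total loss below [k]; the others make every side at least [2 * e]. *)
pose e := Num.min (k / (12 * r)) (Num.min (X / 2) (Num.min (Y / 2) (Z / 2))).
have e0 : 0 < e by rewrite /e !lt_min !divr_gt0 // mulr_gt0.
have ek : e <= k / (12 * r) by rewrite /e ge_min lexx.
have eX : e <= X / 2 by rewrite /e !ge_min lexx orbT.
have eY : e <= Y / 2 by rewrite /e !ge_min lexx !orbT.
have eZ : e <= Z / 2 by rewrite /e !ge_min lexx !orbT.
apply: (@le_trans _ _ (2 * r * (X + Y + Z) - 12 * r * e)%:E); last first.
  by apply: Per_zon_ge_approx => //; lra.
rewrite -EFinB lee_fin.
have : e * (12 * r) <= k by rewrite -ler_pdivlMr // mulr_gt0.
lra.
Qed.

End Perimeter.

(** * Equiangular hexagons *)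

Lemma addn5 k : (k + 5 = k.+1.+4)%N. Proof. by rewrite !addnS addn0. Qed.

Lemma addn6 k : (k + 6 = k.+2.+4)%N. Proof. by rewrite !addnS addn0. Qed.

Section Hexagons.
Variable R : realType.
Implicit Types (p x d : pt R) (t : R) (l : nat -> R).

Definition w3 : R := Num.sqrt 3 / 2.

Lemma w3_gt0 : 0 < w3.
Proof. by rewrite /w3 divr_gt0 // sqrtr_gt0. Qed.

Lemma w3_sq : w3 * w3 = 3 / 4.
Proof. by rewrite -expr2 /w3 expr_div_n sqr_sqrtr //; lra. Qed.

Lemma cos_pi3 : cos (pi / 3) = 1 / 2 :> R.
Proof.
have p0 := pi_gt0 R.
have c0 : 0 < cos (pi / 3 : R) by apply: cos_gt0_pihalf; apply/andP; split; lra.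
(* Together with the duplication formula this gives a quadratic equation with positive root 1/2. *)
have : cos ((pi / 3) *+ 2) = - cos (pi / 3 : R).
  have -> : (pi / 3 : R) *+ 2 = pi - pi / 3 by rewrite mulr2n; lra.
  by rewrite cosB cospi sinpi mul0r addr0 mulN1r.
rewrite cos_mulr2n mulr2n => H; nra.
Qed.

Lemma sin_pi3 : sin (pi / 3) = w3 :> R.
Proof.
have p0 := pi_gt0 R.
have s0 : 0 < sin (pi / 3 : R) by apply: sin_gt0_pi; apply/andP; split; lra.
have := cos2Dsin2 (pi / 3 : R); rewrite cos_pi3 => H.
by have := w3_sq; have := w3_gt0; nra.
Qed.

Lemma edirS t k : edir t k.+1 =
  ((edir t k).1 / 2 - w3 * (edir t k).2, w3 * (edir t k).1 + (edir t k).2 / 2).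
Proof.
have -> : edir t k.+1 = u ((t + k%:R * (pi / 3)) + pi / 3).
  by rewrite /edir mulrSr mulrDl mul1r addrA.
rewrite /edir; move: (t + k%:R * (pi / 3)) => a; rewrite /u cosD sinD cos_pi3 sin_pi3 /=.
by congr pair; lra.
Qed.

Lemma edir_norm t k : (edir t k).1 * (edir t k).1 + (edir t k).2 * (edir t k).2 = 1.
Proof. by rewrite /edir /u /= -!expr2 cos2Dsin2. Qed.

(** Two unit vectors at 60 degrees differ by the unit vector 60 degrees further on. This linear
    relation replaces trigonometry in most later computations with directions. *)
Lemma edirSS t k : edir t k.+2 = vsub (edir t k.+1) (edir t k).
Proof.
rewrite (edirS t k.+1) (edirS t k) /vsub /=; move: (cos _) (sin _) => c s.
have Wc : w3 * (w3 * c) = 3 / 4 * c by rewrite mulrA w3_sq.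
have Ws : w3 * (w3 * s) = 3 / 4 * s by rewrite mulrA w3_sq.
by congr pair; lra.
Qed.

Lemma edirSSS t k : edir t k.+3 = (- (edir t k).1, - (edir t k).2).
Proof. by rewrite (edirSS t k.+1) (edirSS t k) /vsub /=; congr pair; ring. Qed.

Lemma edir6 t k : edir t (k + 6) = edir t k.
Proof.
by rewrite !addnS addn0 !edirSSS !opprK -surjective_pairing.
Qed.

Lemma cross_edirS t k : cross (edir t k) (edir t k.+1) = w3.
Proof.
rewrite edirS; have := edir_norm t k; move: (edir t k) => e n; rewrite /cross /=.
by transitivity (w3 * (e.1 * e.1 + e.2 * e.2)); [ring|rewrite n mulr1].
Qed.

Lemma cross_edirSS t k : cross (edir t k) (edir t k.+2) = w3.
Proof.
rewrite edirSS -(cross_edirS t k); move: (edir _ _) (edir _ _) => e e'.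
by rewrite /cross /vsub /=; ring.
Qed.

Lemma edir_shift t k n : edir (t + k%:R * (pi / 3)) n = edir t (k + n).
Proof. by rewrite /edir (natrD _ k n) (mulrDl _ _ (pi / 3)) addrA. Qed.

Lemma vtxS p t l k : vtx p t l k.+1 = line (vtx p t l k) (edir t k) (l k).
Proof. by rewrite /vtx /line !big_ord_recr /= !addrA. Qed.

Lemma vtx0 p t l : vtx p t l 0 = p.
Proof. by rewrite /vtx !big_ord0 !addr0 -surjective_pairing. Qed.

Lemma vtx_shift p t l k n :
  vtx (vtx p t l k) (t + k%:R * (pi / 3)) (fun i => l (k + i)%N) n = vtx p t l (k + n).
Proof.
elim: n => [|n IH]; first by rewrite vtx0 addn0.
by rewrite vtxS IH edir_shift addnS vtxS.
Qed.

Lemma cross_vsub_line (e e' x v : pt R) (s : R) :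
  cross e (vsub x (line v e' s)) = cross e (vsub x v) - s * cross e e'.
Proof. by rewrite /cross /vsub /line /=; ring. Qed.

Lemma cross_self (e : pt R) : cross e e = 0.
Proof. by rewrite /cross; ring. Qed.

Lemma cross_sym (e e' : pt R) : cross e e' = - cross e' e.
Proof. by rewrite /cross; ring. Qed.

Lemma cross_vsubl (e e' x : pt R) : cross (vsub e e') x = cross e x - cross e' x.
Proof. by rewrite /cross /vsub /=; ring. Qed.

Lemma vtx_succ_cross p t l k x :
  cross (edir t k) (vsub x (vtx p t l k.+1)) = cross (edir t k) (vsub x (vtx p t l k)).
Proof. by rewrite vtxS cross_vsub_line cross_self mulr0 subr0. Qed.

(* The signed distance from x to the line carrying the k-th edge. *)
Definition hexD p t l (k : nat) (x : pt R) : R :=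
  cross (edir t k) (vsub x (vtx p t l k)).

(** A hexagon prescribes six sides only; their periodic extension makes every index legitimate, so
    that the preceding side can be written [k + 5]. *)
Definition periodic6 l := forall k, l (k + 6)%N = l k.

Lemma hex_regionE p t l x :
  hex_region p t l x <-> forall k, (k < 6)%N -> 0 <= hexD p t l k x.
Proof. by []. Qed.

Lemma vtx6 p t l k : periodic6 l -> vtx p t l 6 = p ->
  vtx p t l (k + 6) = vtx p t l k.
Proof.
move=> lp c; elim: k => [|k IH]; first by rewrite vtx0.
by rewrite addSn !vtxS IH lp edir6.
Qed.

Section closed.
Variables (p : pt R) (t : R) (l : nat -> R).
Hypotheses (lp : periodic6 l) (cl : vtx p t l 6 = p).

Lemma hexD6 k x : hexD p t l (k + 6) x = hexD p t l k x.
Proof. by rewrite /hexD vtx6 // edir6. Qed.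

(** The preceding direction is [edir t k - edir t k.+1], so the distances to three consecutive sides
    are linearly related; two neighbouring distances determine all six. *)
Lemma hexDS k x :
  hexD p t l k.+1 x = w3 * l k + hexD p t l k x - hexD p t l (k + 5) x.
Proof.
have -> : hexD p t l (k + 5) x = cross (edir t (k + 5)) (vsub x (vtx p t l k)).
  by rewrite /hexD -vtx_succ_cross -addnS vtx6.
have -> : edir t (k + 5) = vsub (edir t k) (edir t k.+1).
  rewrite !addnS addn0 edirSSS edirSS; move: (edir _ _) (edir _ _) => e e'.
  by rewrite /vsub /=; congr pair; ring.
rewrite /hexD vtxS cross_vsub_line cross_vsubl -(cross_edirS t k).
by rewrite (cross_sym (edir t k.+1) (edir t k)); ring.
Qed.

Lemma hexD_2 k x :
  hexD p t l k.+2 x = w3 * (l k + l k.+1) - hexD p t l (k + 5) x.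
Proof. by rewrite hexDS (addSnnS k 5) hexD6 hexDS; ring. Qed.

Lemma hexD_3 k x :
  hexD p t l k.+3 x = w3 * (l k.+1 + l k.+2) - hexD p t l k x.
Proof. by rewrite hexD_2 (addSnnS k 5) hexD6. Qed.

(** The distances to the opposite sides [k.+2] and [k + 5] have a constant sum, and it can be
    computed along either half of the boundary. *)
Lemma closed_sides k : l k + l k.+1 = l k.+3 + l k.+4.
Proof.
have D1 := hexD_2 k (0, 0); have := hexD_2 k.+3 (0, 0).
rewrite (_ : (k.+3 + 5 = k.+2 + 6)%N); last by rewrite addSnnS.
rewrite -[k.+3.+2]addn5.
rewrite hexD6 => D2.
have : w3 * (l k + l k.+1) = w3 * (l k.+3 + l k.+4) by lra.
by apply: mulfI; rewrite gt_eqF // w3_gt0.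
Qed.

Lemma hexD_4 k x :
  hexD p t l k.+4 x = w3 * l (k + 5)%N + hexD p t l (k + 5) x - hexD p t l k x.
Proof.
rewrite hexD_3 hexDS; have := closed_sides k.+2; rewrite -[k.+2.+4](addn6 k) lp -[k.+2.+3](addn5 k) => h.
by rewrite h; ring.
Qed.

Lemma hexD_mod k x : hexD p t l k x = hexD p t l (k %% 6)%N x.
Proof.
rewrite [in LHS](divn_eq k 6) addnC; elim: (k %/ 6)%N => [|n IH].
  by rewrite mul0n addn0.
by rewrite mulSnr addnA hexD6.
Qed.

Lemma hexD_lt6 x : (forall k, (k < 6)%N -> 0 <= hexD p t l k x) ->
  forall k, 0 <= hexD p t l k x.
Proof. by move=> H k; rewrite hexD_mod H // ltn_mod. Qed.

Lemma hexD_gt6 x : (forall k, (k < 6)%N -> 0 < hexD p t l k x) ->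
  forall k, 0 < hexD p t l k x.
Proof. by move=> H k; rewrite hexD_mod H // ltn_mod. Qed.

Lemma hexD_shift k n x :
  hexD (vtx p t l k) (t + k%:R * (pi / 3)) (fun i => l (k + i)%N) n x =
  hexD p t l (k + n) x.
Proof. by rewrite /hexD vtx_shift edir_shift. Qed.

Lemma hex_region_shift k :
  hex_region (vtx p t l k) (t + k%:R * (pi / 3)) (fun i => l (k + i)%N) =
  hex_region p t l.
Proof.
apply/seteqP; split => x H.
  move=> j j6; rewrite -/(hexD p t l j x).
  have := H ((j + 5 * k) %% 6)%N (ltn_mod _ _).
  rewrite -/(hexD _ _ _ _ x) hexD_shift hexD_mod modnDmr addnCA -mulSn mulnC.
  by rewrite addnC modnMDl modn_small.
move=> n n6; rewrite -/(hexD _ _ _ n x) hexD_shift; exact: hexD_lt6.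
Qed.

End closed.

(** * Centrally symmetric hexagons: area and perimeter *)

Definition hexl (x y z : R) (k : nat) : R := nth 0 [:: x; y; z] (k %% 3).

Lemma hexl_periodic (x y z : R) : periodic6 (hexl x y z).
Proof. by move=> k; rewrite /hexl -modnDmr addn0. Qed.

Lemma hexl_closed p t (x y z : R) : vtx p t (hexl x y z) 6 = p.
Proof.
rewrite !vtxS vtx0 /hexl /= !edirSSS !edirSS /line /vsub /=.
by rewrite [RHS]surjective_pairing; congr pair; ring.
Qed.

(* The scaling under which the frame (e0, e2) has determinant 1. *)
Definition rho3 : R := Num.sqrt w3^-1.

Lemma rho3_gt0 : 0 < rho3.
Proof. by rewrite sqrtr_gt0 invr_gt0 w3_gt0. Qed.

Lemma rho3_sq : rho3 * rho3 * w3 = 1.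
Proof.
by rewrite -expr2 sqr_sqrtr ?mulVf ?gt_eqF ?w3_gt0 // ltW // invr_gt0 w3_gt0.
Qed.

Definition sdir t k : pt R := (rho3 * (edir t k).1, rho3 * (edir t k).2).

Lemma cross_sdir t : cross (sdir t 0) (sdir t 2) = 1.
Proof.
rewrite -rho3_sq -(cross_edirSS t 0) /cross /sdir /=; ring.
Qed.

Lemma sdir1 t : vadd (sdir t 0) (sdir t 2) = sdir t 1.
Proof. by rewrite /sdir edirSS /vadd /vsub /=; congr pair; ring. Qed.

Lemma sdir_norm t k : (sdir t k).1 ^+ 2 + (sdir t k).2 ^+ 2 = rho3 ^+ 2.
Proof.
rewrite /sdir; have := edir_norm t k; move: (edir t k) => e n /=.
by transitivity (rho3 ^+ 2 * (e.1 * e.1 + e.2 * e.2)); [ring|rewrite n mulr1].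
Qed.

(** In the scaled frame the coordinates of a point are [rho3] times its distances to the sides 5 and
    0, and the six inequalities of [zonP] belong to the six sides. *)
Lemma hex_region_zon p t (x y z : R) :
  hex_region p t (hexl x y z) =
  zon p (sdir t 0) (sdir t 2) (x / rho3) (y / rho3) (z / rho3).
Proof.
have r0 := rho3_gt0; have rs := rho3_sq; have w0 := w3_gt0.
have lp := @hexl_periodic x y z; have cl := hexl_closed p t x y z.
have rw : rho3^-1 = rho3 * w3.
  by apply: (mulfI (lt0r_neq0 r0)); rewrite mulfV ?gt_eqF // mulrA rs.
have E0 q : (affinv p (sdir t 0) (sdir t 2) q).2 = rho3 * hexD p t (hexl x y z) 0 q.
  rewrite /hexD vtx0 /affinv /sdir; move: (edir _ _) (edir _ _) => e e'.
  by rewrite /cross /vsub /=; ring.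
have E5 q : (affinv p (sdir t 0) (sdir t 2) q).1 = rho3 * hexD p t (hexl x y z) 5 q.
  have -> : hexD p t (hexl x y z) 5 q = cross (edir t 5) (vsub q p).
    by rewrite /hexD -vtx_succ_cross cl.
  rewrite edirSSS /affinv /sdir; move: (edir _ _) (edir _ _) => e e'.
  by rewrite /cross /vsub /=; ring.
have E1 q : hexD p t (hexl x y z) 1 q =
    w3 * x + hexD p t (hexl x y z) 0 q - hexD p t (hexl x y z) 5 q.
  by rewrite hexDS.
have E2 q : hexD p t (hexl x y z) 2 q = w3 * (x + y) - hexD p t (hexl x y z) 5 q.
  by rewrite hexD_2.
have E3 q : hexD p t (hexl x y z) 3 q = w3 * (y + z) - hexD p t (hexl x y z) 0 q.
  by rewrite hexD_3.
have E4 q : hexD p t (hexl x y z) 4 q =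
    w3 * z + hexD p t (hexl x y z) 5 q - hexD p t (hexl x y z) 0 q.
  by rewrite hexD_4.
have P (a : R) : (0 <= rho3 * a) = (0 <= a) by rewrite pmulr_rge0.
apply/seteqP; split => q.
  rewrite hex_regionE => H.
  have h0 := H 0 isT; have h1 := H 1 isT; have h2 := H 2 isT.
  have h3 := H 3 isT; have h4 := H 4 isT; have h5 := H 5 isT.
  move: h1 h2 h3 h4; rewrite E1 E2 E3 E4 => h1 h2 h3 h4.
  rewrite /zon /mkset /zonP E0 E5 !rw.
  have g a b : b = rho3 * a -> 0 <= a -> 0 <= b by move=> ->; rewrite P.
  split; apply/andP; split; rewrite -subr_ge0.
  - by apply: g h5; ring.
  - by apply: g h2; ring.
  - by apply: g h0; ring.
  - by apply: g h3; ring.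
  - by apply: g h4; ring.
  - by apply: g h1; ring.
rewrite /zon /mkset /zonP E0 E5 !rw => -[/andP[h5 h2] /andP[h0 h3] /andP[h4 h1]].
rewrite hex_regionE => k k6; rewrite -P.
rewrite -subr_ge0 in h1; rewrite -subr_ge0 in h2; rewrite -subr_ge0 in h3.
rewrite -subr_ge0 in h4.
have g (a b : R) : a = b -> 0 <= b -> 0 <= a by move=> ->.
move: k k6 => [|[|[|[|[|[|//]]]]]] _; rewrite ?E1 ?E2 ?E3 ?E4.
- exact: h0.
- by apply: g h1; ring.
- by apply: g h2; ring.
- by apply: g h3; ring.
- by apply: g h4; ring.
- exact: h5.
Qed.

Lemma measurable_hex p t (x y z : R) : 0 < x -> 0 < y -> 0 < z ->
  measurable (hex_region p t (hexl x y z)).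
Proof.
move=> x0 y0 z0; rewrite hex_region_zon; have r0 := rho3_gt0.
by apply: measurable_zon; rewrite ?cross_sdir // ltW // divr_gt0.
Qed.

Lemma area_hex (E : set (pt R)) p t (x y z : R) : 0 < x -> 0 < y -> 0 < z ->
  aeq2 E (hex_region p t (hexl x y z)) ->
  area E = (w3 * (x * y + y * z + z * x))%:E.
Proof.
move=> x0 y0 z0 EH; rewrite (area_aeq _ EH); last exact: measurable_hex.
have r0 := rho3_gt0; rewrite hex_region_zon leb2_zon ?cross_sdir //;
  rewrite ?divr_ge0 ?ltW //.
have rw : w3 = rho3^-1 * rho3^-1.
  have := rho3_sq => h; have rn : rho3 != 0 by rewrite gt_eqF.
  by apply: (mulfI rn); apply: (mulfI rn); rewrite mulrA h; field.
congr (_%:E); rewrite rw; ring.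
Qed.

Lemma Per_hex (E : set (pt R)) p t (x y z : R) : 0 < x -> 0 < y -> 0 < z ->
  lmeas E -> aeq2 E (hex_region p t (hexl x y z)) ->
  Per E = (2 * (x + y + z))%:E.
Proof.
move=> x0 y0 z0 mE; rewrite hex_region_zon => EH; have r0 := rho3_gt0.
rewrite (Per_zon (r := rho3) _ _ _ _ _ _ _ _ mE EH) ?cross_sdir ?sdir1 ?sdir_norm //;
  rewrite ?divr_gt0 //.
by congr (_%:E); field; rewrite gt_eqF.
Qed.

End Hexagons.

(** * The periodic pattern of two symmetric hexagons *)

Section PatternArith.
Variable R : realType.
Variables (x1 x2 y z : R).
Hypotheses (x10 : 0 < x1) (x20 : 0 < x2) (y0 : 0 < y) (z0 : 0 < z).

Definition side (k : bool) : R := if k then x2 else x1.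

(** The place of a tile in the coordinates along [edir t 0] and [edir t 2]: [m] steps [(y, y + z)]
    to the next tile of a column, [n] steps [(x1 + x2, - 2 z)] past one column of each type, and
    [(x1, - z)] from the first type to the second. *)
Definition off (k : bool) (m n : int) : pt R :=
  (m%:~R * y + n%:~R * (x1 + x2) + (if k then x1 else 0),
   m%:~R * (y + z) - 2 * n%:~R * z - (if k then z else 0)).

Definition inpat (k : bool) (m n : int) (c : pt R) : Prop :=
  zonP (side k) y z (vsub c (off k m n)).

(** A discrete intermediate value argument by induction on the distance, valid for the possibly
    non-monotone borders of the columns. *)
Lemma int_step (f : int -> R) (a : R) (i : int) (N : nat) :
  f i <= a -> a < f (i + N%:Z) -> exists n, f n <= a < f (n + 1).
Proof.
elim: N => [|N IH] fi fN; first by move: fN; rewrite addr0 => fN; lra.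
have [aN|aN] := ltP a (f (i + N%:Z)); first exact: IH.
exists (i + N%:Z); apply/andP; split => //.
by move: fN; rewrite -addn1 PoszD addrA.
Qed.

(* The columns n of the pattern, in coordinates (alpha, beta), are separated by
   translates of the graph alpha = zig beta. *)
Definition zig (b : R) : R :=
  let q := (Num.floor (b / (y + z)))%:~R in q * y + Num.min y (b - q * (y + z)).

Lemma floor_rem (b : R) (q := (Num.floor (b / (y + z)))%:~R : R) :
  0 <= b - q * (y + z) < y + z.
Proof.
have S0 : 0 < y + z by move: y0 z0 => ??; lra.
have /andP[h1 h2] := floor_itv (b / (y + z)).
move: h1 h2; rewrite -/q ler_pdivlMr // ltr_pdivrMr // intrD mulrDl mul1r -/q.
by move=> h1 h2; apply/andP; split; lra.
Qed.

(** The left border of a column at height [b] is [zig (b - z)]. It dominates both left sides of the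
    tile, so a point to its right satisfies both left inequalities of [zonP]. *)
Lemma zig_shift (b : R) (q := (Num.floor (b / (y + z)))%:~R : R) :
  q * y <= zig (b - z) /\ q * y + (b - q * (y + z)) - z <= zig (b - z).
Proof.
have S0 : 0 < y + z by move: y0 z0 => ??; lra.
have yy := y0; have zz := z0.
have /andP[h1 h2] := floor_rem b; rewrite -/q in h1 h2.
have fl (j : int) : j%:~R * (y + z) <= b - z < (j%:~R + 1) * (y + z) ->
    Num.floor ((b - z) / (y + z)) = j.
  move=> /andP[j1 j2]; apply: floor_def.
  by rewrite ler_pdivlMr // ltr_pdivrMr // intrD j1 j2.
have [bz|bz] := leP z (b - q * (y + z)).
  have F : Num.floor ((b - z) / (y + z)) = Num.floor (b / (y + z)).
    by apply: fl; rewrite -/q; apply/andP; split; lra.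
  rewrite /zig F -/q; have -> : Num.min y (b - z - q * (y + z)) = b - z - q * (y + z).
    by apply: min_r; lra.
  by split; lra.
have F : Num.floor ((b - z) / (y + z)) = Num.floor (b / (y + z)) - 1.
  by apply: fl; rewrite intrB -/q; apply/andP; split; lra.
rewrite /zig F intrB -/q.
have -> : Num.min y (b - z - (q - 1) * (y + z)) = y by apply: min_l; lra.
by split; lra.
Qed.

(** The zigzag climbs [y] per period [y + z], hence stays within [y] of a line; this bounds the
    search for the column containing a given point. *)
Lemma zig_approx (b : R) : b * (y / (y + z)) - y <= zig b <= b * (y / (y + z)) + y.
Proof.
have S0 : 0 < y + z by move: y0 z0 => ??; lra.
have /andP[h1 h2] := floor_rem b; rewrite /zig.
set q := _%:~R in h1 h2 *; set b0 := b - q * (y + z) in h1 h2 *.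
have -> : b * (y / (y + z)) = q * y + b0 * (y / (y + z)).
  by rewrite /b0; field; rewrite gt_eqF.
have k0 : 0 <= y / (y + z) by rewrite divr_ge0 // ltW.
have B : 0 <= b0 * (y / (y + z)) <= y.
  apply/andP; split; first exact: mulr_ge0.
  by rewrite mulrA ler_pdivrMr // mulrC ler_wpM2l // ltW.
have yy := y0.
have M : 0 <= Num.min y b0 <= y by rewrite le_min h1 (ltW yy) /= ge_min lexx.
by move: B M => /andP[? ?] /andP[? ?]; apply/andP; split; lra.
Qed.

Lemma pattern_cover (c : pt R) : exists k m n, inpat k m n c.
Proof.
case: c => a b.
have xx1 := x10; have xx2 := x20; have yy := y0; have zz := z0.
have S0 : 0 < y + z by lra.
(* [f n] is the left border, at height [b], of the n-th column of first-type tiles. It stays within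
   [y] of a linear function of slope [s], so [i] and [N] can be read off such that
   [f i <= a < f (i + N)]. *)
pose f (n : int) : R := n%:~R * (x1 + x2) + zig (b + 2 * n%:~R * z - z).
pose s := x1 + x2 + 2 * z * (y / (y + z)).
have s0 : 0 < s by rewrite /s addr_gt0 ?addr_gt0 // !mulr_gt0 // invr_gt0.
pose c0 := (b - z) * (y / (y + z)).
have fB n : n%:~R * s + c0 - y <= f n <= n%:~R * s + c0 + y.
  have /andP[h1 h2] := zig_approx (b + 2 * n%:~R * z - z).
  rewrite /f /s /c0; move: h1 h2; set u := y / (y + z) => h1 h2.
  by apply/andP; split; lra.
pose i := Num.floor ((a - c0 - y) / s).
have fi : f i <= a.
  have /andP[h1 _] := floor_itv ((a - c0 - y) / s); rewrite -/i ler_pdivlMr // in h1.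
  by have /andP[_ h2] := fB i; lra.
pose N := absz (Num.floor (2 * y / s) + 2).
have N0 : 0 <= Num.floor (2 * y / s) + 2.
  by rewrite addr_ge0 // floor_ge0 divr_ge0 ?mulr_ge0 // ltW.
have NE : N%:Z = Num.floor (2 * y / s) + 2 by rewrite /N gez0_abs.
have fN : a < f (i + N%:Z).
  have /andP[_ h1] := floor_itv ((a - c0 - y) / s); rewrite -/i ltr_pdivrMr // in h1.
  have /andP[_ h2] := floor_itv (2 * y / s); rewrite ltr_pdivrMr // in h2.
  have /andP[h3 _] := fB (i + N%:Z); rewrite NE !intrD in h3.
  by rewrite !intrD in h1 h2; rewrite NE; lra.
have [n /andP[n1 n2]] := int_step fi fN.
rewrite /f intrD in n1 n2.
(* The n-th columns of both types share this border, so the comparison decides the type. *)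
have [h|h] := leP (a - n%:~R * (x1 + x2)) (x1 + zig (b + 2 * n%:~R * z)).
  exists false, (Num.floor ((b + 2 * n%:~R * z) / (y + z))), n.
  have /andP[r1 r2] := floor_rem (b + 2 * n%:~R * z).
  have [r3 r4] := zig_shift (b + 2 * n%:~R * z).
  move: h; rewrite /inpat /zonP /off /vsub /side /= {1}/zig.
  move: r1 r2 r3 r4 n1; set q := (Num.floor ((b + 2 * n%:~R * z) / (y + z)))%:~R.
  set Z := zig _ => r1 r2 r3 r4 n1 h.
  have m1 : Num.min y (b + 2 * n%:~R * z - q * (y + z)) <= y by rewrite ge_min lexx.
  have m2 : Num.min y (b + 2 * n%:~R * z - q * (y + z)) <= b + 2 * n%:~R * z - q * (y + z).
    by rewrite ge_min lexx orbT.
  by split; apply/andP; split; lra.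
exists true, (Num.floor ((b + 2 * n%:~R * z + z) / (y + z))), n.
have /andP[r1 r2] := floor_rem (b + 2 * n%:~R * z + z).
have [] := zig_shift (b + 2 * n%:~R * z + z); rewrite addrK => r3 r4.
have e2 : b + 2 * (n%:~R + 1) * z - z = b + 2 * n%:~R * z + z by lra.
move: n2; rewrite e2 => n2.
move: n2; rewrite /inpat /zonP /off /vsub /side /= {1}/zig.
move: r1 r2 r3 r4 h; set q := (Num.floor ((b + 2 * n%:~R * z + z) / (y + z)))%:~R.
set Z := zig _ => r1 r2 r3 r4 h n2.
have m1 : Num.min y (b + 2 * n%:~R * z + z - q * (y + z)) <= y by rewrite ge_min lexx.
have m2 : Num.min y (b + 2 * n%:~R * z + z - q * (y + z)) <= b + 2 * n%:~R * z + z - q * (y + z).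
  by rewrite ge_min lexx orbT.
by split; apply/andP; split; lra.
Qed.

Lemma int_mul_ge (i : int) (v : R) : 0 < v -> 1 <= i -> v <= i%:~R * v.
Proof. by move=> v0 i1; apply: ler_peMl; [exact: ltW|rewrite ler1z]. Qed.

Definition on_line (P : pt R -> Prop) : Prop :=
  exists a b c : R, (a != 0 \/ b != 0) /\ forall q, P q -> a * q.1 + b * q.2 = c.

(** Two tiles are separated by a line parallel to one of the three edge directions. The alternatives
    in [gen] are separation in the first coordinate, in the difference of the coordinates and in the
    second coordinate. *)
Lemma pattern_disjoint k m n k' m' n' : (k, m, n) <> (k', m', n') ->
  on_line (fun c => inpat k m n c /\ inpat k' m' n' c).
Proof.
have on1 : (1 : R) != 0 by rewrite oner_eq0.
have wl P Q : on_line (fun c => P c /\ Q c) -> on_line (fun c => Q c /\ P c).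
  by move=> [a [b [c [ab H]]]]; exists a, b, c; split => // q [? ?]; apply: H.
have xx1 := x10; have xx2 := x20; have yy := y0; have zz := z0.
have gen k0 m0 n0 k1 m1 n1 (dm := (m1 - m0)%:~R : R) (dn := (n1 - n0)%:~R : R) :
  [\/ dm * y + dn * (x1 + x2) + (if k1 then x1 else 0) - (if k0 then x1 else 0) >= side k0 + y,
      - dm * z + dn * (x1 + x2 + 2 * z) + (if k1 then x1 + z else 0) - (if k0 then x1 + z else 0)
         >= side k0 + z |
      dm * (y + z) - 2 * dn * z - (if k1 then z else 0) + (if k0 then z else 0) >= y + z] ->
  on_line (fun c => inpat k0 m0 n0 c /\ inpat k1 m1 n1 c).
  rewrite /dm /dn !intrB => -[H|H|H].
  - exists 1, 0, (side k0 + y + (off k0 m0 n0).1); split; first by left.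
    move=> q [[/andP[a1 a2] _ _] [/andP[b1 b2] _ _]].
    by move: a1 a2 b1 b2; rewrite /off /vsub /=; case: k0 H; case: k1 => /= H; lra.
  - exists 1, (-1), (side k0 + (off k0 m0 n0).1 - (off k0 m0 n0).2); split; first by left.
    move=> q [[_ _ /andP[a1 a2]] [_ _ /andP[b1 b2]]].
    by move: a1 a2 b1 b2; rewrite /off /vsub /=; case: k0 H; case: k1 => /= H; lra.
  - exists 0, 1, (y + z + (off k0 m0 n0).2); split; first by right.
    move=> q [[_ /andP[a1 a2] _] [_ /andP[b1 b2] _]].
    by move: a1 a2 b1 b2; rewrite /off /vsub /=; case: k0 H; case: k1 => /= H; lra.
have pos (i : int) (v : R) : 0 < v -> 1 <= i -> v <= i%:~R * v by exact: int_mul_ge.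
have nneg (i : int) (v : R) : 0 < v -> 0 <= i -> 0 <= i%:~R * v.
  by move=> v0 i0; rewrite mulr_ge0 ?ler0z // ltW.
have neg (i : int) (v : R) : 0 < v -> i <= 0 -> 0 <= - i%:~R * v.
  by move=> v0 i0; rewrite -mulrNz mulr_ge0 ?ler0z ?oppr_ge0 // ltW.
have step k0 m0 n0 k1 m1 n1 : (n0 < n1) || (n0 == n1) && (m0 < m1) -> k0 = k1 ->
    on_line (fun c => inpat k0 m0 n0 c /\ inpat k1 m1 n1 c).
  move=> H <-; apply: gen; have sk : 0 < side k0 <= x1 + x2 - 0.
    by rewrite /side; case: (k0); apply/andP; split; lra.
  move: sk => /andP[sk1 sk2].
  case/orP: H => [nn|/andP[/eqP -> mm]].
    have dn1 : 1 <= n1 - n0 by lia.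
    have D1 := pos _ (x1 + x2) ltac:(lra) dn1.
    have D2 := pos _ (x1 + x2 + 2 * z) ltac:(lra) dn1.
    (* In a later column, a tile of larger index [m] is separated by the first coordinate, any other
       by the difference of the coordinates. *)
    have [mm|mm] := leP 1 (m1 - m0).
      by apply: Or31; have := pos _ _ yy mm; lra.
    by apply: Or32; have := neg (m1 - m0) z zz ltac:(lia); lra.
  apply: Or33; rewrite subrr /=; have := pos (m1 - m0) (y + z) ltac:(lra) ltac:(lia).
  by lra.
have mixed m0 n0 m1 n1 :
    on_line (fun c => inpat false m0 n0 c /\ inpat true m1 n1 c).
  have [nn|nn] := leP n0 n1.
    apply: gen; rewrite /side; have D0 : 0 <= n1 - n0 by lia.
    have D1 := nneg _ (x1 + x2) ltac:(lra) D0.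
    have D2 := nneg _ (x1 + x2 + 2 * z) ltac:(lra) D0.
    have [mm|mm] := leP 1 (m1 - m0).
      by apply: Or31; have := pos _ _ yy mm; lra.
    by apply: Or32; have := neg (m1 - m0) z zz ltac:(lia); lra.
  apply: wl; apply: gen; rewrite /side; have D0 : 1 <= n0 - n1 by lia.
  have D1 := pos _ (x1 + x2) ltac:(lra) D0.
  have D2 := pos _ (x1 + x2 + 2 * z) ltac:(lra) D0.
  have [mm|mm] := leP 1 (m0 - m1).
    by apply: Or31; have := pos _ _ yy mm; lra.
  by apply: Or32; have := neg (m0 - m1) z zz ltac:(lia); lra.
move=> neq; case: k k' neq => -[] neq; last 1 first.
all: try by [exact: mixed|apply: wl; exact: mixed].
all: have [H|H] : (n < n') || (n == n') && (m < m') \/ (n' < n) || (n' == n) && (m' < m);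
  last 2 first; try by [exact: step|apply: wl; exact: step].
all: have [h1|h1] := eqVneq n n'; have [h2|h2] := eqVneq m m'; subst => //; lia.
Qed.

End PatternArith.

(** * The pattern as a tiling of the plane *)

Section Pattern.
Variable R : realType.
Implicit Types (p q g : pt R) (t : R).

Definition vcomb t (a b : R) : pt R :=
  (a * (edir t 0).1 + b * (edir t 2).1, a * (edir t 0).2 + b * (edir t 2).2).

(* The coordinates of q in the frame with origin p and axes edir t 0, edir t 2. *)
Definition skew p t q : pt R :=
  (cross (vsub q p) (edir t 2) / w3 R, cross (edir t 0) (vsub q p) / w3 R).

Lemma hex_region_skew p t (x y z : R) q :
  hex_region p t (hexl x y z) q <-> zonP x y z (skew p t q).
Proof.
rewrite hex_region_zon /zon /mkset.
have r0 := rho3_gt0 R; have rs := rho3_sq R; have w0 := w3_gt0 R.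
have -> : affinv p (sdir t 0) (sdir t 2) q = ((skew p t q).1 / rho3 R, (skew p t q).2 / rho3 R).
  have rw : (rho3 R)^-1 = rho3 R * w3 R.
    by apply: (mulfI (lt0r_neq0 r0)); rewrite mulfV ?gt_eqF // mulrA rs.
  rewrite /skew /affinv /sdir rw; move: (edir t 0) (edir t 2) => e e'.
  by rewrite /cross /vsub /=; congr pair; field; rewrite gt_eqF.
move: (skew p t q) => c.
have i0 : 0 < (rho3 R)^-1 by rewrite invr_gt0.
rewrite /zonP /= -!mulNr -!mulrDl.
have E (a b : R) : (a / rho3 R <= b / rho3 R) = (a <= b) by rewrite ler_pM2r.
have E0 (b : R) : (0 <= b / rho3 R) = (0 <= b) by rewrite pmulr_lge0.
by rewrite !E !E0.
Qed.

Lemma vcomb_cross t (a b c d : R) :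
  cross (vcomb t a b) (vcomb t c d) = w3 R * (a * d - b * c).
Proof.
rewrite -(cross_edirSS t 0) /vcomb; move: (edir t 0) (edir t 2) => e e'.
by rewrite /cross /=; ring.
Qed.

Lemma skew_vsub p t q (a b : R) : skew p t (vsub q (vcomb t a b)) = vsub (skew p t q) (a, b).
Proof.
have w0 := w3_gt0 R; rewrite /skew /vcomb; have := cross_edirSS t 0.
move: (edir t 0) (edir t 2) => e e' W.
have -> : w3 R = cross e e' by [].
have nz : e.1 * e'.2 - e.2 * e'.1 != 0 by rewrite -/(cross e e') W gt_eqF.
by rewrite /cross /vsub /=; congr pair; field.
Qed.

Lemma skew_vadd p t q (a b : R) : skew (vadd p (vcomb t a b)) t q = vsub (skew p t q) (a, b).
Proof.
rewrite -skew_vsub /skew /vsub /vadd /=; congr pair; congr (_ / _);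
  by rewrite /cross /=; ring.
Qed.

Lemma translP g (E : set (pt R)) q : transl g E q <-> E (vsub q g).
Proof.
split => [[x Ex <-]|Eq].
  by rewrite (_ : vsub _ _ = x) // /vsub /vadd /= !addrK -surjective_pairing.
by exists (vsub q g) => //; rewrite /vsub /vadd /= !subrK -surjective_pairing.
Qed.

Lemma null2_transl g (E : set (pt R)) : null2 E -> null2 (transl g E).
Proof.
have c : cancel (fun x => vadd x g) (vadd (- g.1, - g.2)).
  by move=> x; rewrite /vadd /= [RHS]surjective_pairing; congr pair; ring.
by move=> nE; exact: (null2_mpres (mpres_translate _) c nE).
Qed.

Lemma lmeas_measurable (E : set (pt R)) : measurable E -> lmeas E.
Proof. by move=> mE; exists E; split => //; split => //; rewrite setDv; exact: null2_0. Qed.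

Lemma aeq2_refl (E : set (pt R)) : aeq2 E E.
Proof. by rewrite /aeq2 setDv; split; exact: null2_0. Qed.

Lemma null2_skew_line p t (a b c : R) : a != 0 \/ b != 0 ->
  null2 [set q | a * (skew p t q).1 + b * (skew p t q).2 = c].
Proof.
move=> ab; have r0 := rho3_gt0 R; have rs := rho3_sq R; have w0 := w3_gt0 R.
apply: (null2_sub _ (null2_affinv_line p (c / rho3 R) (cross_sdir t) ab)) => q /= H.
have rw : (rho3 R)^-1 = rho3 R * w3 R.
  by apply: (mulfI (lt0r_neq0 r0)); rewrite mulfV ?gt_eqF // mulrA rs.
rewrite -H rw /sdir; move: (edir t 0) (edir t 2) => e e'.
by rewrite /cross /vsub /=; field; rewrite gt_eqF.
Qed.

(* The lattice generators and the base vertex of the second hexagon: the vectors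
   y e1 + z e2, (x1 + x2) e0 - 2 z e2 and p + x1 e0 - z e2. *)
Definition pattern_r t (y z : R) : pt R := vcomb t y (y + z).
Definition pattern_h t (x1 x2 z : R) : pt R := vcomb t (x1 + x2) (- (2 * z)).
Definition pattern_base p t (x1 z : R) : pt R := vadd p (vcomb t x1 (- z)).

Section tile.
Variables (p : pt R) (t x1 x2 y z : R).
Hypotheses (x10 : 0 < x1) (x20 : 0 < x2) (y0 : 0 < y) (z0 : 0 < z).
Let H1 := hex_region p t (hexl x1 y z).
Let H2 := hex_region (pattern_base p t x1 z) t (hexl x2 y z).
Let r := pattern_r t y z.
Let h := pattern_h t x1 x2 z.

Lemma pattern_tileP k m n q :
  transl (lat r h m n) (gen H1 H2 k) q <-> inpat x1 x2 y z k m n (skew p t q).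
Proof.
rewrite translP.
have -> : lat r h m n = vcomb t (m%:~R * y + n%:~R * (x1 + x2))
    (m%:~R * (y + z) - 2 * n%:~R * z).
  rewrite /lat /r /h /pattern_r /pattern_h /vcomb; move: (edir t 0) (edir t 2) => e e' /=.
  by congr pair; ring.
rewrite /inpat /off /side; case: k => /=.
  rewrite /H2 hex_region_skew /pattern_base skew_vadd skew_vsub.
  have -> // : vsub (vsub (skew p t q) (m%:~R * y + n%:~R * (x1 + x2),
      m%:~R * (y + z) - 2 * n%:~R * z)) (x1, - z) =
    vsub (skew p t q) (m%:~R * y + n%:~R * (x1 + x2) + x1,
      m%:~R * (y + z) - 2 * n%:~R * z - z).
  by move: (skew p t q) => c; rewrite /vsub /=; congr pair; ring.
by rewrite /H1 hex_region_skew skew_vsub addr0 subr0.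
Qed.

Lemma pattern_covers q : exists k m n, transl (lat r h m n) (gen H1 H2 k) q.
Proof.
have [k [m [n H]]] := pattern_cover x10 x20 y0 z0 (skew p t q).
by exists k, m, n; apply/pattern_tileP.
Qed.

Lemma pattern_null k m n k' m' n' : (k, m, n) <> (k', m', n') ->
  null2 (transl (lat r h m n) (gen H1 H2 k) `&` transl (lat r h m' n') (gen H1 H2 k')).
Proof.
move=> neq; have [a [b [c [ab H]]]] := pattern_disjoint x10 x20 y0 z0 neq.
apply: (null2_sub _ (null2_skew_line p t c ab)) => q [/pattern_tileP q1 /pattern_tileP q2].
exact: H.
Qed.

Lemma pattern_tiling : tiling r h H1 H2.
Proof.
have w0 := w3_gt0 R; split.
- rewrite /lin_indep -/(cross r h) vcomb_cross mulf_neq0 //; first by rewrite gt_eqF.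
  have -> : y * - (2 * z) - (y + z) * (x1 + x2) = - (2 * (y * z) + (y + z) * (x1 + x2)).
    by ring.
  by rewrite oppr_eq0 gt_eqF // addr_gt0 ?mulr_gt0 ?addr_gt0.
- by apply: lmeas_measurable; exact: measurable_hex.
- by apply: lmeas_measurable; exact: measurable_hex.
- exact: pattern_null.
- apply: (null2_sub _ (null2_0 R)) => q /=; apply; exact: pattern_covers.
Qed.

End tile.
End Pattern.

(** * Local geometry of a hexagon *)

Lemma fin_eps (R : realType) (n : nat) (Q : nat -> R -> Prop) :
  (forall (k : nat) (e e' : R), Q k e -> 0 < e' -> e' <= e -> Q k e') ->
  (forall k, (k < n)%N -> exists2 e : R, 0 < e & Q k e) ->
  exists2 e : R, 0 < e & forall k, (k < n)%N -> Q k e.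
Proof.
move=> mono; elim: n => [|n IH] H; first by exists 1.
have [e e0 He] := IH (fun k kn => H k (ltnW kn)).
have [e' e0' He'] := H n (ltnSn n).
exists (Num.min e e'); first by rewrite lt_min e0.
move=> k; rewrite ltnS leq_eqVlt => /predU1P[->|kn].
  by apply: mono He' _ _; rewrite ?lt_min ?e0 // ge_min lexx orbT.
by apply: mono (He k kn) _ _; rewrite ?lt_min ?e0 // ge_min lexx.
Qed.

Section HexLocal.
Variables (R : realType) (p : pt R) (t : R) (l : nat -> R).
Hypotheses (lp : periodic6 l) (lpos : forall k, 0 < l k) (cl : vtx p t l 6 = p).
Local Notation D := (hexD p t l).
Local Notation V := (vtx p t l).
Local Notation e := (edir t).
Let w := w3 R.
Let w0 : 0 < w := w3_gt0 R.

Lemma hexD_line k x d s : D k (line x d s) = D k x + s * cross (e k) d.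
Proof.
by rewrite /hexD; move: (e k) (V k) => f v; rewrite /cross /vsub /line /=; ring.
Qed.

Lemma hexD_vtx k : D k (V k) = 0.
Proof. by rewrite /hexD; move: (e k) (V k) => f v; rewrite /cross /vsub /=; ring. Qed.

Lemma hexD_vtxS k : D k (V k.+1) = 0.
Proof.
by rewrite /hexD -vtx_succ_cross; move: (e k) (V k.+1) => f v; rewrite /cross /vsub /=; ring.
Qed.

Lemma hexD5_vtx k : D (k + 5) (V k) = 0.
Proof. by rewrite -(vtx6 k lp cl) (addnS k 5) hexD_vtxS. Qed.

Lemma cross_e5 k d : cross (e (k + 5)) d = cross (e k) d - cross (e k.+1) d.
Proof.
rewrite addn5 edirSSS edirSS; move: (e k) (e k.+1) => f g.
by rewrite /cross /vsub /=; ring.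
Qed.

Lemma vtx_of_active k x : D k x = 0 -> D (k + 5) x = 0 -> x = V k.
Proof.
rewrite /hexD => h1; rewrite -vtx_succ_cross -(addnS k 5) (vtx6 k lp cl) cross_e5.
rewrite h1 sub0r => /eqP; rewrite oppr_eq0 => /eqP h2.
move: h1 h2; have := cross_edirS t k; move: (e k) (e k.+1) (V k) => f g v.
move=> W h1 h2; have wn : cross f g != 0 by rewrite W gt_eqF.
have E c : cross f g * c = 0 -> c = 0 by move/eqP; rewrite mulf_eq0 (negbTE wn) => /eqP.
rewrite [LHS]surjective_pairing [RHS]surjective_pairing; congr pair; apply/eqP;
  rewrite -subr_eq0; apply/eqP; apply: E.
  transitivity (cross f (vsub x v) * g.1 - cross g (vsub x v) * f.1).
    by rewrite /cross /vsub /=; ring.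
  by rewrite h1 h2 !mul0r subr0.
transitivity (cross f (vsub x v) * g.2 - cross g (vsub x v) * f.2).
  by rewrite /cross /vsub /=; ring.
by rewrite h1 h2 !mul0r subr0.
Qed.

Lemma hexD_S5 k x : D k.+1 x + D (k + 5) x = w * l k + D k x.
Proof. by rewrite hexDS // /w; ring. Qed.

Definition in_hex x := forall k, 0 <= D k x.
Definition in_int x := forall k, 0 < D k x.

Lemma in_hexP x : hex_region p t l x <-> in_hex x.
Proof. by split => [H|H k _]; [exact: hexD_lt6|exact: H]. Qed.

(** On side [k] the distances to the three far sides are sums of nonnegative distances and positive
    multiples of side lengths. Hence at most two sides, necessarily adjacent, pass through a
    point. *)
Lemma active_edge k x : in_hex x -> D k x = 0 ->
  [/\ 0 < D k.+2 x, 0 < D k.+3 x & 0 < D k.+4 x].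
Proof.
move=> H Dk; have h1 := H k.+1; have h5 := H (k + 5)%N.
have hS := hexD_S5 k x.
have l1 := mulr_gt0 w0 (lpos k.+1); have l2 := mulr_gt0 w0 (lpos k.+2).
have l5 := mulr_gt0 w0 (lpos (k + 5)%N).
split.
- by rewrite hexD_2 // -/w mulrDr; lra.
- by rewrite hexD_3 // -/w mulrDr; lra.
- by rewrite hexD_4 // -/w; lra.
Qed.

Lemma edir_mod k : e k = e (k %% 6)%N.
Proof.
rewrite [in LHS](divn_eq k 6) addnC; elim: (k %/ 6)%N => [|n IH].
  by rewrite mul0n addn0.
by rewrite mulSnr addnA edir6.
Qed.

Lemma mod6_offset j i : exists2 r, (r < 6)%N & (i %% 6 = (j + r) %% 6)%N.
Proof.
exists ((i + 5 * j) %% 6)%N; first by rewrite ltn_mod.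
by rewrite modnDmr addnCA -mulSn mulnC addnC modnMDl.
Qed.

Lemma active_near j i x : in_hex x -> D j x = 0 -> D i x = 0 ->
  [\/ e i = e j, e i = e j.+1 /\ D j.+1 x = 0 | e i = e (j + 5) /\ D (j + 5) x = 0].
Proof.
move=> H Dj; have [r r6 ir] := mod6_offset j i.
rewrite (edir_mod i) (hexD_mod lp cl i) ir -edir_mod -hexD_mod //.
have [h2 h3 h4] := active_edge H Dj.
move: r r6 {ir} => [|[|[|[|[|[|//]]]]]] _.
- by rewrite addn0 => _; apply: Or31.
- by rewrite addn1 => h; apply: Or32.
- by rewrite addn2 => h; move: h2; rewrite h ltxx.
- by rewrite addn3 => h; move: h3; rewrite h ltxx.
- by rewrite addn4 => h; move: h4; rewrite h ltxx.
- by move=> h; apply: Or33.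
Qed.

Lemma active_vtx k i : D i (V k) = 0 -> in_hex (V k) -> e i = e k \/ e i = e (k + 5).
Proof.
move=> Di H; have D0 := hexD_vtx k; have D5 := hexD5_vtx k.
have [->|[-> h1]|[-> _]] := active_near H D0 Di; [by left| |by right].
have := hexD_S5 k (V k); rewrite D0 D5 h1 !addr0 => /esym/eqP.
by rewrite mulf_eq0 !gt_eqF // lpos.
Qed.

Lemma vtx_in_hex k : in_hex (V k).
Proof.
have D0 := hexD_vtx k; have D5 := hexD5_vtx k.
have hS := hexD_S5 k (V k).
have l0 := mulr_gt0 w0 (lpos k).
have l1 := mulr_gt0 w0 (lpos k.+1); have l2 := mulr_gt0 w0 (lpos k.+2).
have l5 := mulr_gt0 w0 (lpos (k + 5)%N).
move=> j; have [r r6 jr] := mod6_offset k j.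
rewrite (hexD_mod lp cl j) jr -hexD_mod //.
move: r r6 {jr} => [|[|[|[|[|[|//]]]]]] _.
- by rewrite addn0 D0.
- by rewrite addn1; lra.
- by rewrite addn2 hexD_2 // -/w mulrDr; lra.
- by rewrite addn3 hexD_3 // -/w mulrDr; lra.
- by rewrite addn4 hexD_4 // -/w; lra.
- by rewrite D5.
Qed.

(** Only the sides through [x] constrain the direction; the other distances are positive and survive
    a small step. *)
Lemma inward_line x d : in_hex x -> (forall j, D j x = 0 -> 0 < cross (e j) d) ->
  exists2 s0 : R, 0 < s0 & forall s : R, 0 < s -> s < s0 -> in_int (line x d s).
Proof.
move=> H Hd.
have Hk k : (k < 6)%N -> exists2 s0 : R, 0 < s0 &
    forall s : R, 0 < s -> s < s0 -> 0 < D k (line x d s).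
  move=> _; have := H k; rewrite le_eqVlt => /predU1P[Dk|Dk].
    by exists 1 => // s s1 _; rewrite hexD_line -Dk add0r mulr_gt0 //; exact: Hd.
  pose c : R := `|cross (e k) d| + 1.

have c0 : 0 < c by rewrite /c; have := normr_ge0 (cross (e k) d); lra.
  exists (D k x / c); first by rewrite divr_gt0.
  move=> s s1; rewrite ltr_pdivlMr // hexD_line => s2.
  have : - (s * cross (e k) d) <= s * `|cross (e k) d|.
    by rewrite -mulrN; apply: ler_wpM2l; [exact: ltW|rewrite -normrN ler_norm].
  by move: s2; rewrite /c mulrDr mulr1; lra.
have mono k (a b : R) : (forall s : R, 0 < s -> s < a -> 0 < D k (line x d s)) ->
    0 < b -> b <= a -> forall s : R, 0 < s -> s < b -> 0 < D k (line x d s).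
  by move=> Ha _ ba s s1 s2; apply: Ha => //; exact: lt_le_trans ba.
have [s0 s00 Hs] := fin_eps mono Hk.
by exists s0 => // s s1 s2; apply: hexD_gt6 => // k k6; exact: Hs.
Qed.

Lemma weak_line x d : in_hex x -> (forall j, D j x = 0 -> 0 <= cross (e j) d) ->
  exists2 s0 : R, 0 < s0 & forall s : R, 0 < s -> s < s0 -> in_hex (line x d s).
Proof.
move=> H Hd.
have Hk k : (k < 6)%N -> exists2 s0 : R, 0 < s0 &
    forall s : R, 0 < s -> s < s0 -> 0 <= D k (line x d s).
  move=> _; have := H k; rewrite le_eqVlt => /predU1P[Dk|Dk].
    by exists 1 => // s s1 _; rewrite hexD_line -Dk add0r; apply: mulr_ge0; [exact: ltW|exact: Hd].
  pose c : R := `|cross (e k) d| + 1.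

have c0 : 0 < c by rewrite /c; have := normr_ge0 (cross (e k) d); lra.
  exists (D k x / c); first by rewrite divr_gt0.
  move=> s s1; rewrite ltr_pdivlMr // hexD_line => s2.
  have : - (s * cross (e k) d) <= s * `|cross (e k) d|.
    by rewrite -mulrN; apply: ler_wpM2l; [exact: ltW|rewrite -normrN ler_norm].
  by move: s2; rewrite /c mulrDr mulr1; lra.
have mono k (a b : R) : (forall s : R, 0 < s -> s < a -> 0 <= D k (line x d s)) ->
    0 < b -> b <= a -> forall s : R, 0 < s -> s < b -> 0 <= D k (line x d s).
  by move=> Ha _ ba s s1 s2; apply: Ha => //; exact: lt_le_trans ba.
have [s0 s00 Hs] := fin_eps mono Hk.
by exists s0 => // s s1 s2; apply: hexD_lt6 => // k k6; exact: Hs.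
Qed.

Lemma closed_line x d :
  (forall s0 : R, 0 < s0 -> exists s : R, [/\ 0 < s, s < s0 & in_hex (line x d s)]) ->
  in_hex x.
Proof.
move=> H k; rewrite leNgt; apply/negP => Dk.
pose c : R := `|cross (e k) d| + 1;
have c0 : 0 < c by rewrite /c; have := normr_ge0 (cross (e k) d); lra.
have [|s [s1 s2 /(_ k)]] := H (- D k x / c); first by rewrite divr_gt0 // oppr_gt0.
rewrite hexD_line => h.
move: s2; rewrite ltr_pdivlMr // /c mulrDr mulr1 => s2.
have : s * cross (e k) d <= s * `|cross (e k) d| by apply: ler_wpM2l; [exact: ltW|exact: ler_norm].
lra.
Qed.

Lemma cross_e k n d : cross (e (k + n)) d =
  nth 0 [:: cross (e k) d; cross (e k.+1) d; cross (e k.+1) d - cross (e k) d;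
   - cross (e k) d; - cross (e k.+1) d; cross (e k) d - cross (e k.+1) d] (n %% 6).
Proof.
rewrite edir_mod -modnDmr -edir_mod; have : (n %% 6 < 6)%N by rewrite ltn_mod.
move: (n %% 6)%N => [|[|[|[|[|[|//]]]]]] _ /=.
- by rewrite addn0.
- by rewrite addn1.
- by rewrite addn2 edirSS cross_vsubl.
- by rewrite addn3 edirSSS; move: (e k) => f; rewrite /cross /=; ring.
- by rewrite addn4 edirSSS; move: (e k.+1) => f; rewrite /cross /=; ring.
- by rewrite cross_e5.
Qed.

(** At corner [k] the bisector [edir t k.+1] points inward. Elsewhere on side [k] the direction
    [edir t k.+2] does, even at the far end, where side [k.+1] is active too. *)
Lemma interior_dir x : in_hex x -> exists d, forall j, D j x = 0 -> 0 < cross (e j) d.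
Proof.
move=> H; have [[k Dk]|nD] := pselect (exists k, D k x = 0); last first.
  by exists (0, 0) => j Dj; case: nD; exists j.
have W := w0.
have [D5|D5] := eqVneq (D (k + 5) x) 0.
  exists (e k.+1) => j Dj; have Ex := vtx_of_active Dk D5.
  rewrite Ex in Dj H; have [->|->] := active_vtx Dj H; first by rewrite cross_edirS.
  by rewrite cross_e5 cross_edirS cross_self subr0.
exists (e k.+2) => j Dj; have [->|[-> _]|[_ h]] := active_near H Dk Dj.
- by rewrite cross_edirSS.
- by rewrite cross_edirS.
- by rewrite h eqxx in D5.
Qed.

Lemma edge_hexD k s (q := line (V k) (e k) s) :
  [/\ D k q = 0, D (k + 5) q = w * s & D k.+1 q = w * (l k - s)].
Proof.
have D0 : D k q = 0 by rewrite /q hexD_line hexD_vtx cross_self mulr0 addr0.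
have D5 : D (k + 5) q = w * s.
  rewrite /q hexD_line hexD5_vtx add0r cross_e5 cross_self sub0r cross_sym opprK.
  by rewrite cross_edirS mulrC.
by split => //; have := hexD_S5 k q; rewrite D0 D5; lra.
Qed.

Lemma edge_in_hex k s : 0 <= s <= l k -> in_hex (line (V k) (e k) s).
Proof.
move=> /andP[s0 s1]; have [D0 D5 D1] := edge_hexD k s.
set q := line _ _ _ in D0 D5 D1 *.
have ws : 0 <= w * s by rewrite mulr_ge0 // ltW.
have wl : 0 <= w * (l k - s) by apply: mulr_ge0; [exact: ltW|rewrite subr_ge0].
have l1 := mulr_gt0 w0 (lpos k.+1); have l2 := mulr_gt0 w0 (lpos k.+2).
have l5 := mulr_gt0 w0 (lpos (k + 5)%N).
move=> j; have [r r6 jr] := mod6_offset k j.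
rewrite (hexD_mod lp cl j) jr -hexD_mod //.
move: r r6 {jr} => [|[|[|[|[|[|//]]]]]] _.
- by rewrite addn0 D0.
- by rewrite addn1 D1.
- by rewrite addn2 hexD_2 // -/w mulrDr D5; move: wl; rewrite mulrBr; lra.
- by rewrite addn3 hexD_3 // -/w mulrDr D0; lra.
- by rewrite addn4 hexD_4 // -/w D0 D5; lra.
- by rewrite D5.
Qed.

Lemma edge_single k s i : 0 < s < l k -> D i (line (V k) (e k) s) = 0 -> e i = e k.
Proof.
move=> /andP[s0 s1] Di; have [D0 D5 D1] := edge_hexD k s.
have H : in_hex (line (V k) (e k) s) by apply: edge_in_hex; rewrite !ltW.
have [//|[_ h]|[_ h]] := active_near H D0 Di.
  by move: h; rewrite D1 => /eqP; rewrite mulf_eq0 !gt_eqF ?subr_gt0.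
by move: h; rewrite D5 => /eqP; rewrite mulf_eq0 !gt_eqF.
Qed.

End HexLocal.

Lemma unit_parallel (R : realType) (f g : pt R) :
  f.1 * f.1 + f.2 * f.2 = 1 -> g.1 * g.1 + g.2 * g.2 = 1 -> cross f g = 0 ->
  f = g \/ f = (- g.1, - g.2).
Proof.
case: f g => [f1 f2] [g1 g2]; rewrite /cross /= => nf ng c.
pose k := f1 * g1 + f2 * g2.
have E1 : f1 = k * g1.
  transitivity (f1 * (g1 * g1 + g2 * g2)); first by rewrite ng mulr1.
  transitivity (k * g1 + g2 * (f1 * g2 - f2 * g1)); first by rewrite /k; ring.
  by rewrite c mulr0 addr0.
have E2 : f2 = k * g2.
  transitivity (f2 * (g1 * g1 + g2 * g2)); first by rewrite ng mulr1.
  transitivity (k * g2 - g1 * (f1 * g2 - f2 * g1)); first by rewrite /k; ring.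
  by rewrite c mulr0 subr0.
have : k ^+ 2 = 1.
  have <- : f1 * f1 + f2 * f2 = k ^+ 2; last by [].
  transitivity (k ^+ 2 * (g1 * g1 + g2 * g2)); last by rewrite ng mulr1.
  by rewrite E1 E2; ring.
move/eqP; rewrite sqrf_eq1 => /orP[] /eqP kk; [left|right]; rewrite E1 E2 kk;
  by rewrite ?mul1r ?mulN1r.
Qed.

Lemma edir_sync (R : realType) (t t' : R) j k n : edir t' j = edir t k ->
  edir t' (j + n) = edir t (k + n).
Proof.
by move=> H; elim: n => [|n IH]; rewrite ?addn0 // !addnS !edirS IH.
Qed.

(** * Tilings by equiangular hexagons are edge-to-edge *)

Lemma limit_quadratic (R : realType) (A B C : R) :
  (forall s0 : R, 0 < s0 -> exists s : R, [/\ 0 < s, s < s0 & 0 <= A + s * B + s * s * C]) ->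
  0 <= A.
Proof.
move=> H; rewrite leNgt; apply/negP => A0.
pose K : R := `|B| + `|C| + 1.
have [b0 c0] : 0 <= `|B| /\ 0 <= `|C| by [].
have K0 : 0 < K by rewrite /K; lra.
have [|s [s1 s2 s3]] := H (Num.min 1 (- A / K)).
  by rewrite lt_min ltr01 divr_gt0 // oppr_gt0.
move: s2; rewrite lt_min ltr_pdivlMr // => /andP[s2 s4].
have h1 : s * B <= s * `|B| by apply: ler_wpM2l; [exact: ltW|exact: ler_norm].
have h2 : s * s * C <= s * `|C|.
  apply: (@le_trans _ _ (s * s * `|C|)).
    by apply: ler_wpM2l; [rewrite mulr_ge0 // ltW|exact: ler_norm].
  by rewrite -mulrA ler_pM2l // ler_piMl // ltW.
by move: s4; rewrite /K !mulrDr mulr1; lra.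
Qed.

Lemma small_curve (R : realType) (s p q u : R) : 0 < s -> s <= 1 / 2 ->
  `|p| <= 1 -> `|q| <= 1 -> `|u + s * p + s * s * q - u| <= 1.
Proof.
move=> s1 s2 tile_base hq; have -> : u + s * p + s * s * q - u = s * p + s * s * q by ring.
apply: le_trans (ler_normD _ _) _; rewrite !normrM (gtr0_norm s1).
have r1 : s * `|p| <= s * 1 by rewrite ler_pM2l.
have r2 : s * s * `|q| <= s * s * 1 by rewrite ler_pM2l // mulr_gt0.
have r3 : s * s <= s * 1 by rewrite ler_pM2l //; lra.
lra.
Qed.

Section Tiles.
Variables (R : realType) (a b : pt R).
Variables (P : bool -> pt R) (T : bool -> R) (l : bool -> nat -> R).
Hypotheses (lp : forall i, periodic6 (l i)) (lpos : forall i k, 0 < l i k)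
  (cl : forall i, vtx (P i) (T i) (l i) 6 = P i).

Local Notation idx := (bool * int * int)%type.
Definition tile_base (tau : idx) : pt R := vadd (P tau.1.1) (lat a b tau.1.2 tau.2).
Local Notation D tau := (hexD (tile_base tau) (T tau.1.1) (l tau.1.1)).
Local Notation V tau := (vtx (tile_base tau) (T tau.1.1) (l tau.1.1)).
Local Notation e tau := (edir (T tau.1.1)).
Local Notation L tau := (l tau.1.1).
Definition in_tile (tau : idx) (x : pt R) : Prop :=
  in_hex (tile_base tau) (T tau.1.1) (l tau.1.1) x.
Definition in_tile_int (tau : idx) (x : pt R) : Prop :=
  in_int (tile_base tau) (T tau.1.1) (l tau.1.1) x.

Hypothesis disj : forall tau tau' x, in_tile_int tau x -> in_tile_int tau' x -> tau = tau'.
Hypothesis cov : forall x, exists tau, in_tile tau x.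
(** Local finiteness in the form in which it is used: a property found for arbitrarily small [s]
    among the tiles that meet the unit box around [x] is found for arbitrarily small [s] on one
    fixed tile. *)
Hypothesis pig : forall (x : pt R) (Q : idx -> R -> Prop),
  (forall s0 : R, 0 < s0 -> exists (s : R) (tau : idx), [/\ 0 < s, s < s0,
     exists y, [/\ in_tile tau y, `|y.1 - x.1| <= 1 & `|y.2 - x.2| <= 1] & Q tau s]) ->
  exists tau, forall s0 : R, 0 < s0 -> exists s : R, [/\ 0 < s, s < s0 & Q tau s].

Let w := w3 R.
Let w0 : 0 < w := w3_gt0 R.

Lemma vtx_vadd p t (l' : nat -> R) g k : vtx (vadd p g) t l' k = vadd (vtx p t l' k) g.
Proof. by rewrite /vtx /vadd /=; congr pair; ring. Qed.

Lemma cl_tile (tau : idx) : V tau 6 = tile_base tau.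
Proof. by rewrite /tile_base vtx_vadd cl. Qed.

Let lpt (tau : idx) : periodic6 (L tau) := lp tau.1.1.
Let lpost (tau : idx) : forall k, 0 < L tau k := lpos tau.1.1.

(** A direction pointing strictly into both tiles leads to a common interior point. *)
Lemma conflict tau tau' x d : in_tile tau x -> in_tile tau' x ->
  (forall j, D tau j x = 0 -> 0 < cross (e tau j) d) ->
  (forall j, D tau' j x = 0 -> 0 < cross (e tau' j) d) -> tau = tau'.
Proof.
move=> h h' H H'.
have [s s0 Hs] := inward_line (lpt tau) (cl_tile tau) h H.
have [s' s0' Hs'] := inward_line (lpt tau') (cl_tile tau') h' H'.
have m0 : 0 < Num.min s s' by rewrite lt_min s0.
have [m1 m2] : Num.min s s' <= s /\ Num.min s s' <= s'.
  by split; rewrite ge_min lexx ?orbT.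
by apply: (@disj _ _ (line x d (Num.min s s' / 2))); [apply: Hs|apply: Hs']; lra.
Qed.

Lemma conflict_int tau tau' x : in_tile tau x -> in_tile_int tau' x -> tau = tau'.
Proof.
move=> h h'.
have [d Hd] := interior_dir (lpt tau) (lpost tau) (cl_tile tau) h.
apply: (conflict h (x := x) (d := d)) => // [k|j Dj]; first exact: ltW.
by have := h' j; rewrite Dj ltxx.
Qed.

(** Where [f] points strictly inward a small multiple of [m] does no harm; where [f] runs along a
    side, [m] decides. *)
Lemma perturbed_dir tau v f m : in_tile tau v ->
  (forall j, D tau j v = 0 -> 0 <= cross (e tau j) f) ->
  (forall j, D tau j v = 0 -> cross (e tau j) f = 0 -> 0 < cross (e tau j) m) ->
  exists2 h0 : R, 0 < h0 & forall h : R, 0 < h -> h < h0 ->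
    forall j, D tau j v = 0 -> 0 < cross (e tau j) (line f m h).
Proof.
move=> hv H1 H2.
have cr c h : cross c (line f m h) = cross c f + h * cross c m.
  by rewrite /cross /line /=; ring.
have Hk k : (k < 6)%N -> exists2 h0 : R, 0 < h0 & forall h : R, 0 < h -> h < h0 ->
    D tau k v = 0 -> 0 < cross (e tau k) (line f m h).
  move=> _; have [Dk|Dk] := eqVneq (D tau k v) 0; last first.
    by exists 1 => // h _ _ /eqP; rewrite (negbTE Dk).
  have := H1 k Dk; rewrite le_eqVlt => /predU1P[ck|ck].
    by exists 1 => // h h1 _ _; rewrite cr -ck add0r; apply: mulr_gt0 => //; apply: H2.
  pose c : R := `|cross (e tau k) m| + 1.
  have c0 : 0 < c by rewrite /c; have := normr_ge0 (cross (e tau k) m); lra.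
  exists (cross (e tau k) f / c); first by rewrite divr_gt0.
  move=> h h1; rewrite ltr_pdivlMr // cr => h2 _.
  have : - (h * cross (e tau k) m) <= h * `|cross (e tau k) m|.
    by rewrite -mulrN; apply: ler_wpM2l; [exact: ltW|rewrite -normrN ler_norm].
  by move: h2; rewrite /c mulrDr mulr1; lra.
have mono k (x y : R) : (forall h : R, 0 < h -> h < x -> D tau k v = 0 ->
      0 < cross (e tau k) (line f m h)) -> 0 < y -> y <= x ->
    forall h : R, 0 < h -> h < y -> D tau k v = 0 -> 0 < cross (e tau k) (line f m h).
  by move=> Hx _ yx h h1 h2; apply: Hx => //; exact: lt_le_trans yx.
have [h0 h00 Hh] := fin_eps mono Hk.
exists h0 => // h h1 h2 j; rewrite (hexD_mod (lpt tau) (cl_tile tau) j) edir_mod.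
by apply: Hh => //; rewrite ltn_mod.
Qed.

Definition coord_le1 (f : pt R) := `|f.1| <= 1 /\ `|f.2| <= 1.

Lemma edir_coord_le1 t k : coord_le1 (edir t k : pt R).
Proof.
have := edir_norm t k; move: (edir t k) => f n.
have h1 : 0 <= f.1 * f.1 by rewrite -expr2 sqr_ge0.
have h2 : 0 <= f.2 * f.2 by rewrite -expr2 sqr_ge0.
by split; rewrite -[X in _ <= X]ger0_norm // -ler_sqr ?nnegrE // !real_normK ?num_real //
  expr2 expr1n; lra.
Qed.

(* The points v + s f + s^2 o for small s > 0 lie in finitely many tiles, so one tile
   contains such points for arbitrarily small s. *)
Lemma tile_touching tau v f o m : in_tile tau v -> coord_le1 f -> coord_le1 o ->
  (forall j, D tau j v = 0 -> 0 <= cross (e tau j) f) ->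
  (forall j, D tau j v = 0 -> cross (e tau j) f = 0 -> 0 < cross (e tau j) m) ->
  (exists2 j, D tau j v = 0 & cross (e tau j) f = 0) ->
  exists tau', [/\ in_tile tau' v,
    forall j, D tau' j v = 0 -> 0 <= cross (e tau' j) f /\
       (cross (e tau' j) f = 0 -> 0 <= cross (e tau' j) o) &
    exists2 j, D tau' j v = 0 & cross (e tau' j) f = 0].
Proof.
move=> hv [f1 f2] [q1 q2] H1 H2 [j0 Dj0 cj0].
have [tau' Ht] : exists tau', forall s0 : R, 0 < s0 -> exists s : R,
    [/\ 0 < s, s < s0 & in_tile tau' (line (line v f s) o (s * s))].
  apply: (pig (x := v)) => s0 s00.
  pose s := Num.min s0 1 / 2.
  have m0 : 0 < Num.min s0 1 by rewrite lt_min s00 ltr01.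
  have s1 : 0 < s by rewrite divr_gt0.
  have [ms0 ms1] : Num.min s0 1 <= s0 /\ Num.min s0 1 <= 1.
    by split; rewrite ge_min lexx ?orbT.
  have [tau' h] := cov (line (line v f s) o (s * s)).
  exists s, tau'; split => //; first by rewrite /s; lra.
  exists (line (line v f s) o (s * s)); split => //.
    by rewrite /line /=; apply: small_curve => //; rewrite /s; lra.
  by rewrite /line /=; apply: small_curve => //; rewrite /s; lra.
have Hq j (s0 : R) : 0 < s0 -> exists s : R, [/\ 0 < s, s < s0 &
    0 <= D tau' j v + s * cross (e tau' j) f + s * s * cross (e tau' j) o].
  move=> /Ht[s [s1 s2 /(_ j)]]; rewrite !hexD_line => h; by exists s.
have hv' : in_tile tau' v by move=> j; exact: limit_quadratic (Hq j).
have act j : D tau' j v = 0 -> 0 <= cross (e tau' j) f /\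
    (cross (e tau' j) f = 0 -> 0 <= cross (e tau' j) o).
  move=> Dj; split.
    apply: (@limit_quadratic _ _ (cross (e tau' j) o) 0) => s0 /(Hq j)[s [s1 s2]].
    rewrite Dj add0r -mulrA -mulrDr pmulr_rge0 // => h; exists s.
    by rewrite mulr0 addr0; split.
  move=> cj; have [s [s1 _]] := Hq j 1 ltr01.
  by rewrite Dj cj mulr0 !add0r pmulr_rge0 ?mulr_gt0.
exists tau'; split => //.
(* If no side of [tau'] at [v] ran along [f], then [f] would point strictly into [tau']. A slight
   turn towards [m] would point into both tiles, so [tau = tau'], although [tau] has a side along
   [f]. *)
apply: contrapT => nj.
have pos j : D tau' j v = 0 -> 0 < cross (e tau' j) f.
  move=> Dj; rewrite lt_neqAle (act j Dj).1 andbT eq_sym; apply/eqP => cj.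
  by apply: nj; exists j.
have [h0 h00 Hh] := perturbed_dir hv H1 H2.
have pos0 j : D tau' j v = 0 -> cross (e tau' j) f = 0 -> 0 < cross (e tau' j) m.
  by move=> Dj cj; have := pos j Dj; rewrite cj ltxx.
have [h0' h00' Hh'] := perturbed_dir hv' (fun j Dj => ltW (pos j Dj)) pos0.
have m0 : 0 < Num.min h0 h0' by rewrite lt_min h00.
have [m1 m2] : Num.min h0 h0' <= h0 /\ Num.min h0 h0' <= h0'.
  by split; rewrite ge_min lexx ?orbT.
have tt : tau = tau'.
  apply: (conflict hv hv' (d := line f m (Num.min h0 h0' / 2))).
    by apply: Hh; [rewrite divr_gt0|lra].
  by apply: Hh'; [rewrite divr_gt0|lra].
by have := pos j0; rewrite -tt cj0 ltxx => /(_ Dj0).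
Qed.

(** The factor 5 stands for -1 modulo 6: the value depends only on the turn from the first direction
    to the second. *)
Lemma edir_cross (t : R) k m n : cross (edir t (k + m)) (edir t (k + n)) =
  nth 0 [:: 0; w; w; 0; - w; - w] ((n + 5 * m) %% 6).
Proof.
rewrite cross_e.
have c0 q : cross (edir t k) (edir t (k + q)) = nth 0 [:: 0; w; w; 0; - w; - w] (q %% 6).
  rewrite cross_sym cross_e; have : (q %% 6 < 6)%N by rewrite ltn_mod.
  rewrite cross_self (cross_sym (edir t k.+1)) cross_edirS.
  by move: (q %% 6)%N => [|[|[|[|[|[|//]]]]]] _ /=; rewrite /w; ring.
have c1 q : cross (edir t k.+1) (edir t (k + q)) = nth 0 [:: - w; 0; w; w; 0; - w] (q %% 6).
  rewrite cross_sym cross_e; have : (q %% 6 < 6)%N by rewrite ltn_mod.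
  rewrite cross_self cross_edirS.
  by move: (q %% 6)%N => [|[|[|[|[|[|//]]]]]] _ /=; rewrite /w; ring.
rewrite !c0 !c1 -modnDmr -modnMmr modnDmr.
have -> : ((n + 5 * (m %% 6)) %% 6 = (n %% 6 + 5 * (m %% 6)) %% 6)%N by rewrite modnDml.
have : (n %% 6 < 6)%N by rewrite ltn_mod.
have : (m %% 6 < 6)%N by rewrite ltn_mod.
move: (m %% 6)%N (n %% 6)%N.
by move=> [|[|[|[|[|[|//]]]]]] [|[|[|[|[|[|//]]]]]] _ _ /=; ring.
Qed.

(** The curve leaves the corner along side [k] and bends outward in direction [k + 4]; the tile met
    there has a side running backward along side [k]. *)
Lemma tile_below_edge tau k : exists tau' j, [/\ in_tile tau' (V tau k), D tau' j (V tau k) = 0,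
  e tau' j = e tau (k + 3) &
  forall i, D tau' i (V tau k) = 0 -> 0 <= cross (e tau' i) (e tau (k + 0))].
Proof.
have hv : in_tile tau (V tau k) by exact: (vtx_in_hex (lpt tau) (lpost tau) (cl_tile tau)).
have W := w0.
have act j : D tau j (V tau k) = 0 -> e tau j = e tau (k + 0) \/ e tau j = e tau (k + 5).
  by move=> Dj; rewrite addn0; exact: (active_vtx (lpt tau) (lpost tau) (cl_tile tau) Dj hv).
have [||||||tau' [h1 h2 [j Dj cj]]] := @tile_touching tau (V tau k) (e tau (k + 0)) (e tau (k + 4))
  (e tau (k + 1)) => //.
- exact: edir_coord_le1.
- exact: edir_coord_le1.
- by move=> j /act[->|->]; rewrite edir_cross //= ltW.
- by move=> j /act[->|->] _; rewrite edir_cross.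
- exists k; first exact: hexD_vtx.
  by rewrite -{1}[k]addn0 edir_cross.
exists tau', j; split => //; last by move=> i Di; exact: (h2 i Di).1.
have := (h2 j Dj).2 cj.
have [E|E] := unit_parallel (edir_norm _ _) (edir_norm _ _) cj.
  by rewrite E edir_cross /= => h; move: h; rewrite oppr_ge0 leNgt W.
by rewrite E addn0 addn3 edirSSS.
Qed.

(** The counterpart for the preceding side: the curve follows side [k + 5] backward, in direction
    [k + 2], and bends outward in direction [k + 3]. *)
Lemma tile_beside_edge tau k : exists tau' j, [/\ in_tile tau' (V tau k), D tau' j (V tau k) = 0,
  e tau' j = e tau (k + 2) &
  forall i, D tau' i (V tau k) = 0 -> 0 <= cross (e tau' i) (e tau (k + 2))].
Proof.
have hv : in_tile tau (V tau k) by exact: (vtx_in_hex (lpt tau) (lpost tau) (cl_tile tau)).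
have W := w0.
have act j : D tau j (V tau k) = 0 -> e tau j = e tau (k + 0) \/ e tau j = e tau (k + 5).
  by move=> Dj; rewrite addn0; exact: (active_vtx (lpt tau) (lpost tau) (cl_tile tau) Dj hv).
have [||||||tau' [h1 h2 [j Dj cj]]] := @tile_touching tau (V tau k) (e tau (k + 2)) (e tau (k + 3))
  (e tau (k + 1)) => //.
- exact: edir_coord_le1.
- exact: edir_coord_le1.
- by move=> j /act[->|->]; rewrite edir_cross //= ltW.
- by move=> j /act[->|->] _; rewrite edir_cross.
- exists (k + 5)%N; first exact: (hexD5_vtx (lpt tau) (cl_tile tau)).
  by rewrite edir_cross.
exists tau', j; split => //; last by move=> i Di; exact: (h2 i Di).1.
have := (h2 j Dj).2 cj.
have [E|E] := unit_parallel (edir_norm _ _) (edir_norm _ _) cj; first by [].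
have {}E : e tau' j = e tau (k + 5).
  by rewrite E addn5 addn2 [in RHS]edirSSS.
by rewrite E edir_cross /= => h; move: h; rewrite oppr_ge0 leNgt W.
Qed.

(* No corner of a tile lies in the relative interior of an edge of another one. *)
Lemma no_junction tau k tau' j : in_tile tau' (V tau k) -> D tau' j (V tau k) = 0 ->
  (forall i, D tau' i (V tau k) = 0 -> e tau' i = e tau' j) ->
  e tau' j = e tau (k + 3) \/ e tau' j = e tau (k + 2) -> False.
Proof.
move=> h Dj single; have W := w0.
have crl c f g : cross c (line f g 1) = cross c f + cross c g :> R.
  by rewrite /cross /line /=; ring.
(* At the corner [tau] fills 120 degrees and [tau'] a half-plane bounded by the line of one side of
   [tau]. The tile beyond the other side does not fit into the remaining 60 degrees, so it overlaps
   [tau'] and equals it; its side at the corner would then have two directions. *)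
case=> E.
  have [t2 [j2 [h2 D2 E2 pos2]]] := tile_beside_edge tau k.
  have tt : tau' = t2.
    apply: (conflict h h2 (d := line (e tau (k + 3)) (e tau (k + 4)) 1)).
      by move=> i /single ->; rewrite E crl !edir_cross /= add0r.
    move=> i Di; have [->|[E3 D3]|[E5 D5]] := active_near (lpt t2) (lpost t2) (cl_tile t2) h2 D2 Di.
    - by rewrite E2 crl !edir_cross /= addr_gt0.
    - have := pos2 _ Di; rewrite E3 -addn1 (edir_sync 1 E2) -addnA edir_cross /=.
      by rewrite oppr_ge0 leNgt W.
    - by rewrite E5 (edir_sync 5 E2) -addnA crl !edir_cross /= addr0.
  move: D2 E2; rewrite -tt => /single ->; rewrite E => F.
  have := edir_cross (T tau.1.1) k 2 3; rewrite -F cross_self /= => F'.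
  by move: W; rewrite -F' ltxx.
have [t2 [j2 [h2 D2 E2 pos2]]] := tile_below_edge tau k.
have tt : tau' = t2.
  apply: (conflict h h2 (d := line (e tau (k + 4)) (e tau (k + 5)) 1)).
    by move=> i /single ->; rewrite E crl !edir_cross /= addr0.
  move=> i Di; have [->|[E3 D3]|[E5 D5]] := active_near (lpt t2) (lpost t2) (cl_tile t2) h2 D2 Di.
  - by rewrite E2 crl !edir_cross /= addr_gt0.
  - by rewrite E3 -addn1 (edir_sync 1 E2) -addnA crl !edir_cross /= add0r.
  - have := pos2 _ Di; rewrite E5 (edir_sync 5 E2) -addnA edir_cross /=.
    by rewrite oppr_ge0 leNgt W.
move: D2 E2; rewrite -tt => /single ->; rewrite E => F.
have := edir_cross (T tau.1.1) k 2 3; rewrite -F cross_self /= => F'.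
by move: W; rewrite -F' ltxx.
Qed.

(** Corner [k] of [tau] cannot lie inside the side of the tile across side [k], so it is a corner of
    that tile. With sides of different lengths, the other end of the shorter one would lie inside
    the longer one. Side [k' + 5] of the neighbour, ending in its corner [k'], is side [k] run
    backward. *)
Lemma neighbour tau k : exists tau' k', [/\ V tau k = V tau' k',
  e tau' k' = e tau (k + 4) & L tau' (k' + 5)%N = L tau k].
Proof.
have W := w0.
have [t1 [j [h1 D1 E1 pos1]]] := tile_below_edge tau k.
have Dj1 : D t1 j.+1 (V tau k) = 0.
  apply/eqP; apply: contrapT => /negP/eqP nD.
  apply: (no_junction h1 D1 _ (or_introl E1)) => i Di.
  have [//|[_ h]//|[E5 D5]] := active_near (lpt t1) (lpost t1) (cl_tile t1) h1 D1 Di.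
  have := pos1 _ Di; rewrite E5 (edir_sync 5 E1) -addnA edir_cross /=.
  by rewrite oppr_ge0 leNgt W.
have Vj : V tau k = V t1 j.+1.
  apply: (vtx_of_active (lpt t1) (cl_tile t1)) => //.
  by rewrite addSnnS (hexD6 (lpt t1) (cl_tile t1)).
exists t1, j.+1; split => //.
  by rewrite -addn1 (edir_sync 1 E1) -addnA.
rewrite addSnnS (lpt t1 j).
have E0 : e t1 j = (- (e tau k).1, - (e tau k).2) by rewrite E1 addn3 edirSSS.
have Vj0 : V t1 j = line (V tau k) (e tau k) (L t1 j).
  rewrite Vj vtxS E0; move: (V t1 j) (e tau k) (L t1 j) => v f s.
  by rewrite /line /= [LHS]surjective_pairing; congr pair; ring.
have [hlt|hgt|//] := ltgtP (L t1 j) (L tau k).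
  have s01 : 0 < L t1 j < L tau k by rewrite lpost hlt.
  exfalso; apply: (@no_junction t1 j tau k).
  - by rewrite Vj0; apply: (edge_in_hex (lpt tau) (lpost tau) (cl_tile tau)); rewrite !ltW ?lpost.
  - by rewrite Vj0; have [] := edge_hexD (lpt tau) (cl_tile tau) k (L t1 j).
  - by rewrite Vj0 => i; exact: (edge_single (lpt tau) (lpost tau) (cl_tile tau)).
  - by left; rewrite (edir_sync 3 E1) -addnA edir6.
pose s := L t1 j - L tau k.
have s01 : 0 < s < L t1 j by rewrite /s; have := lpost tau k; have := hgt; lra.
have Vk1 : V tau k.+1 = line (V t1 j) (e t1 j) s.
  rewrite vtxS Vj0 E0 /s; move: (V tau k) (e tau k) => v f.
  by rewrite /line /=; congr pair; ring.
exfalso; apply: (@no_junction tau k.+1 t1 j).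
- rewrite Vk1; apply: (edge_in_hex (lpt t1) (lpost t1) (cl_tile t1)).
  by case/andP: s01 => ? ?; rewrite !ltW.
- by rewrite Vk1; have [] := edge_hexD (lpt t1) (cl_tile t1) j s.
- by rewrite Vk1 => i; exact: (edge_single (lpt t1) (lpost t1) (cl_tile t1)).
- by right; rewrite addSnnS.
Qed.

(** Both tiles fill the same angle at the corner, so its bisector points into both. *)
Lemma same_corner tau k tau' k' : V tau k = V tau' k' -> e tau k = e tau' k' ->
  tau = tau'.
Proof.
move=> HV He; have W := w0.
have hv : in_tile tau (V tau k) by exact: (vtx_in_hex (lpt tau) (lpost tau) (cl_tile tau)).
have hv' : in_tile tau' (V tau' k') by exact: (vtx_in_hex (lpt tau') (lpost tau') (cl_tile tau')).
have hv2 := hv'; rewrite -HV in hv2.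
apply: (conflict hv hv2 (d := e tau (k + 1))) => j Dj.
  have [->|->] := active_vtx (lpt tau) (lpost tau) (cl_tile tau) Dj hv.
    by rewrite -{1}[k]addn0 edir_cross.
  by rewrite edir_cross.
rewrite HV in Dj; have [->|->] := active_vtx (lpt tau') (lpost tau') (cl_tile tau') Dj hv'.
  by rewrite -He -{1}[k]addn0 edir_cross.
by rewrite (edir_sync 5 (esym He)) edir_cross.
Qed.

Lemma line_vsub (u v : pt R) : line u (vsub v u) 1 = v.
Proof. by rewrite /line /vsub /= [RHS]surjective_pairing; congr pair; ring. Qed.

(* Join two tiles of different types by a segment and consider the last point on it
   that belongs to a tile of the first type. *)
Lemma touching_tiles : exists (q : pt R) (tau tau' : idx),
  [/\ tau.1.1 = false, tau'.1.1 = true, in_tile tau q & in_tile tau' q].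
Proof.
pose tA : idx := (false, 0, 0); pose tB : idx := (true, 0, 0).
pose A := V tA 0%N; pose B := V tB 0%N.
pose d := vsub B A.
have ctA : in_tile tA A by exact: (vtx_in_hex (lpt _) (lpost _) (cl_tile _)).
have ctB : in_tile tB B by exact: (vtx_in_hex (lpt _) (lpost _) (cl_tile _)).
pose S := [set s : R | 0 <= s <= 1 /\
  exists2 tau : idx, tau.1.1 = false & in_tile tau (line A d s)].
have lA : line A d 0 = A by rewrite /line !mul0r !addr0 -surjective_pairing.
have lB : line A d 1 = B by exact: line_vsub.
have S0 : S 0 by split; [rewrite lexx ler01|exists tA => //; rewrite lA].
have hS : has_sup S.
  by split; [exists 0|exists 1 => s [/andP[_ h] _]].
pose t := sup S.
have t0 : 0 <= t by apply: ub_le_sup => //; case: hS.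
have t1 : t <= 1 by apply: sup_le_ub; [exists 0|move=> s [/andP[_ h] _]].
pose K : R := `|d.1| + `|d.2| + 1.
have [n1 n2] : 0 <= `|d.1| /\ 0 <= `|d.2| by [].
have K0 : 0 < K by rewrite /K; lra.
have near (s c u : R) : 0 < s -> s < K^-1 -> `|c| <= K -> `|u + s * c - u| <= 1.
  move=> s0 sK cK; have -> : u + s * c - u = s * c by ring.
  rewrite normrM (gtr0_norm s0); apply: (@le_trans _ _ (K^-1 * K)).
    by apply: ler_pM => //; exact: ltW.
  by rewrite mulVf // gt_eqF.
have shift s u : line (line A d s) d u = line A d (s + u).
  by rewrite /line /=; congr pair; ring.
have shiftN s u : line (line A d s) (- d.1, - d.2) u = line A d (s - u).
  by rewrite /line /=; congr pair; ring.
have [tau ftau htau] : exists2 tau : idx, tau.1.1 = false & in_tile tau (line A d t).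
  (* If the supremum is not attained, first-type tiles approach it; local finiteness leaves one tile
     that does, and tiles are closed. *)
  have [[_ //]|nS] := pselect (S t).
  have [|tau Ht] := @pig (line A d t)
      (fun (tau : idx) s => tau.1.1 = false /\ in_tile tau (line (line A d t) (- d.1, - d.2) s)).
    move=> s0 s00.
    have m0 : 0 < Num.min s0 K^-1 by rewrite lt_min s00 invr_gt0.
    have [s Ss st] := sup_adherent m0 hS.
    have stt : s <= t by apply: ub_le_sup => //; case: hS.
    have st' : s < t.
      by rewrite lt_neqAle stt andbT; apply/eqP => E; apply: nS; rewrite -E.
    have [_ [tau ft ht]] := Ss.
    move: st; rewrite -/t ltrBlDr -ltrBlDl => st.
    have [ms0 msK] : Num.min s0 K^-1 <= s0 /\ Num.min s0 K^-1 <= K^-1.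
      by split; rewrite ge_min lexx ?orbT.
    have E : line A d s = line (line A d t) (- d.1, - d.2) (t - s).
      by rewrite shiftN; congr line; ring.
    exists (t - s), tau; split; [lra|lra| |by rewrite -E].
    exists (line A d s); split => //; rewrite E /line /=.
      by apply: near; [lra|lra|rewrite normrN /K; lra].
    by apply: near; [lra|lra|rewrite normrN /K; lra].
  exists tau; first by have [s [_ _ []]] := Ht 1 ltr01.
  apply: (closed_line (d := (- d.1, - d.2))) => s0 /Ht[s [s1 s2 [_ h]]]; by exists s.
have [tau' ttau' htau'] : exists2 tau' : idx, tau'.1.1 = true & in_tile tau' (line A d t).
  move: t1; rewrite le_eqVlt => /predU1P[->|t1]; first by exists tB; rewrite ?lB.
  have [|tau' Ht] := @pig (line A d t)
      (fun (tau : idx) s => tau.1.1 = true /\ in_tile tau (line (line A d t) d s)).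
    move=> s0 s00.
    pose m := Num.min s0 (Num.min K^-1 (1 - t)).
    have m0 : 0 < m by rewrite /m !lt_min s00 invr_gt0 K0 subr_gt0.
    have [ms0 msK mt] : [/\ m <= s0, m <= K^-1 & m <= 1 - t].
      by split; rewrite /m !ge_min lexx ?orbT.
    have [tau' h'] := cov (line (line A d t) d (m / 2)).
    exists (m / 2), tau'; split; [lra|lra| |].
      exists (line (line A d t) d (m / 2)); split => //; rewrite {1}/line /=.
        by apply: near; [lra|lra|rewrite /K; lra].
      by apply: near; [lra|lra|rewrite /K; lra].
    (* A first-type tile beyond [t] would contradict the choice of the supremum. *)
    split => //; case E : tau'.1.1 => //.
    have : S (t + m / 2).
      split; first by apply/andP; split; lra.
      by exists tau' => //; rewrite -shift.
    move/(ub_le_sup (proj2 hS)); rewrite -/t; lra.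
  exists tau'; first by have [s [_ _ []]] := Ht 1 ltr01.
  by apply: (closed_line (d := d)) => s0 /Ht[s [s1 s2 [_ h]]]; exists s.
by exists (line A d t), tau, tau'.
Qed.

Lemma on_edge (tau : idx) k q : D tau k q = 0 ->
  q = line (V tau k) (e tau k) (D tau (k + 5) q / w).
Proof.
move=> Dk; set s := _ / w.
have wn : w != 0 by rewrite gt_eqF.
have : q = line (line q (e tau k) (- s)) (e tau k) s.
  by rewrite /line /= [LHS]surjective_pairing; congr pair; ring.
move=> Eq; rewrite {1}Eq; congr line.
apply: (vtx_of_active (lpt tau) (cl_tile tau)); rewrite hexD_line.
  by rewrite Dk cross_self mulr0 addr0.
have := edir_cross (T tau.1.1) k 5 0; rewrite addn0 /= => ->.
by rewrite /s mulNr divfK // subrr.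
Qed.

(** Otherwise the first-type tiles at a point [q] of contact would fill all directions: across a
    side lies again a first-type tile, and around a corner three of them take 120 degrees each. But
    the second-type tile at [q] has interior points arbitrarily near [q], which would then lie in a
    first-type tile. *)
Lemma mixed_neighbour : exists (tau : idx) k (tau' : idx) k',
  [/\ tau.1.1 = false, tau'.1.1 = true,
  V tau k = V tau' k' & e tau' k' = e tau (k + 4)].
Proof.
apply: contrapT => nomix; have W := w0.
have iso (tau : idx) k : tau.1.1 = false -> exists (tau' : idx) k', [/\ tau'.1.1 = false,
    V tau k = V tau' k', e tau' k' = e tau (k + 4) & L tau' (k' + 5)%N = L tau k].
  move=> ft; have [tau' [k' [h1 h2 h3]]] := neighbour tau k.
  exists tau', k'; split => //; case E : tau'.1.1 => //.
  by case: nomix; exists tau, k, tau', k'.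
have [q [tau [tau1 [ft tt1 hq hq1]]]] := touching_tiles.
have corner (tau0 : idx) k d : tau0.1.1 = false -> q = V tau0 k ->
    exists2 tau' : idx, tau'.1.1 = false & in_tile tau' q /\
      forall j, D tau' j q = 0 -> 0 <= cross (e tau' j) d.
  move=> f0 Eq.
  have [ta [ka [fa Va Ea _]]] := iso tau0 k f0.
  have [tb [kb [fb Vb Eb _]]] := iso ta ka fa.
  have Eb8 : e tb kb = e tau0 (k + 8) by rewrite Eb (edir_sync 4 Ea) -addnA.
  have inh (t : idx) n : in_tile t (V t n) by exact: (vtx_in_hex (lpt t) (lpost t) (cl_tile t)).
  have at_corner (t : idx) n m : q = V t n -> e t n = e tau0 (k + m) ->
      0 <= cross (e tau0 (k + m)) d -> 0 <= cross (e tau0 (k + (m + 5))) d ->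
      in_tile t q /\ forall j, D t j q = 0 -> 0 <= cross (e t j) d.
    move=> qt et c1 c2; split; first by rewrite qt; exact: inh.
    move=> j; rewrite qt => Dj.
    have [->|->] := active_vtx (lpt t) (lpost t) (cl_tile t) Dj (inh t n).
      by rewrite et.
    by rewrite (edir_sync 5 et) -addnA.
  have e0 : e tau0 k = e tau0 (k + 0) by rewrite addn0.
  (* The signs and the order of the cross products of [d] with two consecutive directions tell which
     of the three sectors contains [d]. *)
  have [b0|b0] := leP 0 (cross (e tau0 k.+1) d).
    have [ab|ab] := leP (cross (e tau0 k.+1) d) (cross (e tau0 k) d).
      exists tau0 => //; apply: (at_corner tau0 k 0%N) => //; rewrite cross_e /=; lra.
    exists tb => //; apply: (at_corner tb kb 8) => //; first by rewrite Eq Va.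
      by rewrite cross_e /=; lra.
    by rewrite cross_e /=; lra.
  have [a0|a0] := leP 0 (cross (e tau0 k) d).
    exists tau0 => //; apply: (at_corner tau0 k 0%N) => //; rewrite cross_e /=; lra.
  exists ta => //; apply: (at_corner ta ka 4) => //; first by rewrite Eq.
    by rewrite cross_e /=; lra.
  by rewrite cross_e /=; lra.
have cone d : exists2 tau' : idx, tau'.1.1 = false & in_tile tau' q /\
    forall j, D tau' j q = 0 -> 0 <= cross (e tau' j) d.
  have [[k Dk]|nD] := pselect (exists k, D tau k q = 0); last first.
    by exists tau => //; split => // j Dj; case: nD; exists j.
  have [D5|D5] := eqVneq (D tau (k + 5) q) 0.
    by apply: (corner tau k) => //; exact: (vtx_of_active (lpt tau) (cl_tile tau)).
  have [D1|D1] := eqVneq (D tau k.+1 q) 0.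
    apply: (corner tau k.+1) => //; apply: (vtx_of_active (lpt tau) (cl_tile tau)) => //.
    by rewrite addSnnS (hexD6 (lpt tau) (cl_tile tau)).
  have single j : D tau j q = 0 -> e tau j = e tau k.
    move=> Dj; have [//|[_ h]|[_ h]] := active_near (lpt tau) (lpost tau) (cl_tile tau) hq Dk Dj.
      by rewrite h eqxx in D1.
    by rewrite h eqxx in D5.
  have [c0|c0] := leP 0 (cross (e tau k) d).
    by exists tau => //; split => // j /single ->.
  have [ta [ka [fa Va Ea La]]] := iso tau k ft.
  have Eq := on_edge Dk; set s := _ / w in Eq.
  have s0 : 0 < s by rewrite divr_gt0 // lt_neqAle eq_sym D5 hq.
  have s1 : s < L tau k.
    have := hq k.+1; rewrite le_eqVlt eq_sym (negbTE D1) /=.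
    have := hexD_S5 (lpt tau) (cl_tile tau) k q; rewrite Dk addr0 => h5 h1.
    by rewrite /s ltr_pdivrMr //; rewrite mulrC; move: h5; rewrite -/w; lra.
  have E9 : e ta (ka + 5) = (- (e tau k).1, - (e tau k).2).
    rewrite (edir_sync 5 Ea) -addnA (_ : (4 + 5 = 3 + 6)%N) // addnA edir6 addn3.
    by rewrite edirSSS.
  have q' : q = line (V ta (ka + 5)) (e ta (ka + 5)) (L ta (ka + 5)%N - s).
    have V6 : V ta ka = line (V ta (ka + 5)) (e ta (ka + 5)) (L ta (ka + 5)%N).
      by rewrite -vtxS -(addnS ka 5) (vtx6 _ (lpt ta) (cl_tile ta)).
    rewrite Eq Va V6 E9; move: (V ta (ka + 5)) (e tau k) (L ta _) => v f y.
    by rewrite /line /=; congr pair; ring.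
  have s2 : 0 < L ta (ka + 5)%N - s < L ta (ka + 5)%N by rewrite La; apply/andP; split; lra.
  exists ta => //; rewrite q'; split.
    apply: (edge_in_hex (lpt ta) (lpost ta) (cl_tile ta)).
    by case/andP: s2 => ? ?; rewrite !ltW.
  move=> j /(edge_single (lpt ta) (lpost ta) (cl_tile ta) s2) ->; rewrite E9.
  move: c0; move: (e tau k) => f; rewrite /cross /=; lra.
have [d Hd] := interior_dir (lpt tau1) (lpost tau1) (cl_tile tau1) hq1.
have [tau2 f2 [h2 H2]] := cone d.
have [s s0 Hs] := inward_line (lpt tau1) (cl_tile tau1) hq1 Hd.
have [s' s0' Hs'] := weak_line (lpt tau2) (cl_tile tau2) h2 H2.
have m0 : 0 < Num.min s s' by rewrite lt_min s0.
have [m1 m2] : Num.min s s' <= s /\ Num.min s s' <= s'.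
  by split; rewrite ge_min lexx ?orbT.
have E : tau2 = tau1.
  by apply: (@conflict_int _ _ (line q d (Num.min s s' / 2))); [apply: Hs'|apply: Hs]; lra.
by move: tt1; rewrite -E f2.
Qed.
End Tiles.

(** * Types of neighbours and the lattice *)

Lemma period6_mod (A : Type) (f : nat -> A) : (forall k, f (k + 6)%N = f k) ->
  forall k k', k = k' %[mod 6] -> f k = f k'.
Proof.
move=> H; have E k : f k = f (k %% 6)%N.
  rewrite [in LHS](divn_eq k 6); elim: (k %/ 6)%N => [//|q <-].
  by rewrite mulSn -addnA addnC H.
by move=> k k' kk; rewrite E kk -E.
Qed.

Lemma edir_inj (R : realType) (t : R) j k : edir t j = edir t k -> j = k %[mod 6].
Proof.
have [r r6 E] := mod6_offset j k.
have w0 := w3_gt0 R.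
rewrite [edir t k]edir_mod E -edir_mod => e.
suff r0 : r = 0%N by rewrite r0 addn0.
have := edir_cross t j 0 r; rewrite addn0 -e cross_self muln0 addn0 modn_small //.
move: r6 e {E}; do 6?[case: r => [|r]] => //= _; rewrite ?addnS ?addn0 => e E; try by exfalso; lra.
move: e {E}; rewrite edirSSS => E; have := edir_norm t j.
move: (edir t j) E => [c d] /= [E1 E2] N; exfalso.
have e1 : c = 0 by lra.
have e2 : d = 0 by lra.
by move: N; rewrite e1 e2; lra.
Qed.

Lemma latD (R : realType) (a b : pt R) m n m' n' :
  vadd (lat a b m n) (lat a b m' n') = lat a b (m + m') (n + n').
Proof. by rewrite /vadd /lat /=; congr pair; rewrite !intrD; ring. Qed.

Lemma latN (R : realType) (a b : pt R) m n : vsub (0, 0) (lat a b m n) = lat a b (- m) (- n).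
Proof. by rewrite /vsub /lat /=; congr pair; rewrite !rmorphN /=; ring. Qed.

Lemma vaddA (R : realType) (x y z : pt R) : vadd x (vadd y z) = vadd (vadd x y) z.
Proof. by rewrite /vadd /= !addrA. Qed.

Lemma vadd_eq (R : realType) (x y g : pt R) : x = vadd y g <-> y = vadd x (vsub (0, 0) g).
Proof.
by split => ->; rewrite [LHS]surjective_pairing /vadd /vsub /=; congr pair; ring.
Qed.

Lemma transl_hex (R : realType) (g p : pt R) t l :
  transl g (hex_region p t l) = hex_region (vadd p g) t l.
Proof.
have E k x : cross (edir t k) (vsub (vsub x g) (vtx p t l k)) =
    cross (edir t k) (vsub x (vtx (vadd p g) t l k)).
  rewrite vtx_vadd; move: (edir t k) (vtx p t l k) => e v.
  by rewrite /cross /vsub /vadd /=; ring.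
apply/seteqP; split => x; rewrite translP => H k k6; first by rewrite -E; exact: H.
by rewrite E; exact: H.
Qed.

Lemma in_tileP (R : realType) (a b : pt R) P T l tau x :
    (forall i, periodic6 (l i)) -> (forall i, vtx (P i) (T i) (l i) 6 = P i) ->
  in_tile a b P T l tau x <->
  transl (lat a b tau.1.2 tau.2) (hex_region (P tau.1.1) (T tau.1.1) (l tau.1.1)) x.
Proof.
by move=> lp cl; rewrite transl_hex in_hexP // vtx_vadd cl.
Qed.

Lemma lat_lat (R : realType) (a b : pt R) m1 n1 m2 n2 m n :
  lat (lat a b m1 n1) (lat a b m2 n2) m n = lat a b (m * m1 + n * m2) (m * n1 + n * n2).
Proof. by rewrite /lat /=; congr pair; rewrite !intrD !intrM; ring. Qed.

Lemma int_point (R : realType) (p : pt R) t l : periodic6 l -> (forall k, 0 < l k) ->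
  vtx p t l 6 = p -> exists q, in_int p t l q.
Proof.
move=> lp lpos cl; have h := vtx_in_hex lp lpos cl 0.
have [d Hd] := interior_dir lp lpos cl h.
have [s s0 Hs] := inward_line lp cl h Hd.
by exists (line (vtx p t l 0) d (s / 2)); apply: Hs; lra.
Qed.

Lemma transl_transl (R : realType) (g g' : pt R) E :
  transl g (transl g' E) = transl (vadd g' g) E.
Proof.
have vE (x : pt R) : vsub (vsub x g) g' = vsub x (vadd g' g).
  by rewrite /vsub /vadd /=; congr pair; ring.
by apply/seteqP; split => x; rewrite !translP vE.
Qed.

(* H1 is the first hexagon of the pattern, H2 the second one up to a lattice vector, and
   (a, b) generates the lattice of the pattern. *)
Definition hex_pattern (R : realType) (a b : pt R) (H1 H2 : set (pt R))
    (p : pt R) (t x1 x2 y z : R) : Prop :=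
  [/\ [/\ 0 < x1, 0 < x2, 0 < y & 0 < z], H1 = hex_region p t (hexl x1 y z),
      exists m n, transl (lat a b m n) H2 = hex_region (pattern_base p t x1 z) t (hexl x2 y z)
    & forall v, (exists m n, v = lat a b m n) <->
                (exists m n, v = lat (pattern_r t y z) (pattern_h t x1 x2 z) m n)].

(** * Tilings in which both hexagons have the same edge directions *)

Section Aligned.
Variables (R : realType) (a b : pt R) (P : bool -> pt R) (t : R) (l : bool -> nat -> R).
Hypotheses (lp : forall i, periodic6 (l i)) (lpos : forall i k, 0 < l i k)
  (cl : forall i, vtx (P i) t (l i) 6 = P i).
Local Notation in_tile := (in_tile a b P (fun=> t) l).
Local Notation in_tile_int := (in_tile_int a b P (fun=> t) l).
Local Notation V i := (vtx (P i) t (l i)).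
Local Notation G := (lat a b).
Hypothesis disj : forall tau tau' x, in_tile_int tau x -> in_tile_int tau' x -> tau = tau'.
Hypothesis nbr : forall tau k, exists tau' k',
  [/\ vtx (tile_base a b P tau) t (l tau.1.1) k = vtx (tile_base a b P tau') t (l tau'.1.1) k',
      edir t k' = edir t (k + 4) & l tau'.1.1 (k' + 5) = l tau.1.1 k].

(* Some translate of tile j lies across the k-th edge of tile i: their corners k and
   k + 4 then coincide. *)
Definition adjacent i k j := exists m n, V i k = vadd (V j (k + 4)) (G m n).

Lemma lmod i k k' : k = k' %[mod 6] -> l i k = l i k'.
Proof. exact: (period6_mod (f := l i) (lp i)). Qed.

Lemma Vmod i k k' : k = k' %[mod 6] -> V i k = V i k'.
Proof. by apply: (period6_mod (f := V i)) => n; rewrite vtx6. Qed.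

Lemma same_cornerV i k m n i' m' n' :
  vadd (V i k) (G m n) = vadd (V i' k) (G m' n') -> (i, m, n) = (i', m', n').
Proof.
move=> E; apply: (same_corner (T := fun=> t) lp lpos cl disj (k := k) (k' := k)) => //.
by rewrite /tile_base /= !vtx_vadd.
Qed.

Lemma adjacent_ex i k : exists j, adjacent i k j.
Proof.
have [[[j m] n] [k' [/= E /edir_inj e _]]] := nbr (i, 0, 0) k.
exists j, m, n; move: E; rewrite /tile_base /= !vtx_vadd (Vmod j e) => <-.
by rewrite [LHS]surjective_pairing /vadd /lat /=; congr pair; ring.
Qed.

Lemma adjacent_uniq i k j j' : adjacent i k j -> adjacent i k j' -> j = j'.
Proof. by move=> [m [n E]] [m' [n']]; rewrite E => /same_cornerV[->]. Qed.

Lemma adjacent_inj i i' k j : adjacent i k j -> adjacent i' k j -> i = i'.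
Proof.
move=> [m [n /vadd_eq]]; rewrite latN => E [m' [n' /vadd_eq]]; rewrite latN E.
by move=> /same_cornerV[->].
Qed.

Lemma adjacent_len i k j : adjacent i k j -> l j (k + 3) = l i k.
Proof.
move=> [m [n E]]; have [[[j' m'] n'] [k' [/= E' /edir_inj e L]]] := nbr (i, 0, 0) k.
move: E'; rewrite /tile_base /= !vtx_vadd (Vmod j' e) E -vaddA latD => /same_cornerV[jj _ _].
rewrite -L -jj; apply: lmod; rewrite -(modnDml k') e modnDml -addnA.
by rewrite -[(4 + 5)%N]/(3 + 6)%N addnA modnDr.
Qed.

(** Crossing the sides [k], [k + 4] and [k + 2] in turn circles a corner and returns to the first
    tile. *)
Lemma adjacent_cycle i k j j' : adjacent i k j -> adjacent j (k + 4) j' -> adjacent j' (k + 2) i.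
Proof.
move=> [m [n E]] [m' [n' E']].
exists (- (m' + m)), (- (n' + n)); rewrite -latN; apply: (iffLR (vadd_eq _ _ _)).
rewrite -latD vaddA (@Vmod i (k + 2 + 4) k); last by rewrite -addnA modnDr.
rewrite E E'; congr (vadd (vadd _ _) _).
by apply: Vmod; rewrite -addnA -[(4 + 4)%N]/(2 + 6)%N addnA modnDr.
Qed.

Lemma adjacent_rev i k j : adjacent i k j -> adjacent j (k + 3) i.
Proof.
move=> N; have L := adjacent_len N; case: N => m [n E].
exists (- m), (- n); rewrite -latN; apply: (iffLR (vadd_eq _ _ _)).
have -> : V i (k + 3 + 4) = V i k.+1.
  by apply: Vmod; rewrite -addnA -[(3 + 4)%N]/(1 + 6)%N addnA modnDr addn1.
move: E; rewrite [in V j (k + 4)]addnS !vtxS L !addnS addn0 edirSSS => ->.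
by move: (V j _) (edir t k) => v e; rewrite /line /vadd /=; congr pair; ring.
Qed.

Definition swaps k : bool := `[< adjacent false k true >].

(** Crossing a given side is an injective map on the two types, hence the identity or the exchange,
    and its value on the first type fixes the other. *)
Lemma adjacent_swaps i k : adjacent i k (i (+) swaps k).
Proof.
have [j H] := adjacent_ex false k; have [j' H'] := adjacent_ex true k.
have -> : swaps k = j.
  rewrite /swaps; apply/asboolP/idP => [/adjacent_uniq/(_ H) <- //|jj].
  by move: H; rewrite jj.
case: i => //=; case: (boolP j) H => jj H; case: j' H' => // H'.
- by have := adjacent_inj H H'.
- by have := adjacent_inj H H'.
Qed.

Lemma adjacent_swapsE i k j : adjacent i k j -> j = i (+) swaps k.
Proof. by move=> H; apply: adjacent_uniq H (adjacent_swaps i k). Qed.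

Lemma swaps3 k : swaps (k + 3) = swaps k.
Proof.
have /adjacent_rev/adjacent_swapsE := adjacent_swaps false k.
by case: (swaps k); case: (swaps (k + 3)).
Qed.

Lemma swaps_sum k : swaps k (+) swaps k.+1 (+) swaps k.+2 = false.
Proof.
have /(adjacent_cycle (adjacent_swaps false k))/adjacent_swapsE :=
  adjacent_swaps (false (+) swaps k) (k + 4).
rewrite -[in swaps k.+1]addn1 -[in swaps k.+2]addn2 -(swaps3 (k + 1)) -addnA.
by case: (swaps k); case: (swaps (k + _)); case: (swaps _).
Qed.

Lemma swaps_base : (exists k, swaps k) -> exists k, [/\ ~~ swaps k, swaps k.+1 & swaps k.+2].
Proof.
move=> [k sk]; have := swaps_sum k; have := swaps3 k; rewrite sk !addnS addn0.
case E1 : (swaps k.+1); case E2 : (swaps k.+2) => //= E3 _.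
- have E4 := swaps3 k.+1; rewrite E1 !addnS addn0 in E4.
  by exists k.+2; rewrite E2 E3 E4.
- by exists k.+1; rewrite E1 E2 E3.
Qed.

Section Base.
Variable k : nat.
Hypotheses (sk : ~~ swaps k) (sk1 : swaps k.+1) (sk2 : swaps k.+2).
Let t' : R := t + k%:R * (pi / 3).
Let x1 := l false k.
Let x2 := l true k.
Let y := l false k.+1.
Let z := l false k.+2.

(** Side [k] equals its opposite because crossing it keeps the type. By [closed_sides] the other
    opposite sides are then equal as well, and crossing them identifies [y] and [z] of both
    types. *)
Lemma base_len i n : l i (k + n)%N = hexl (l i k) y z n.
Proof.
have L0 j := adjacent_len (adjacent_swaps j k); have L1 j := adjacent_len (adjacent_swaps j k.+1).
have L2 j := adjacent_len (adjacent_swaps j k.+2).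
rewrite (negbTE sk) in L0; rewrite sk1 in L1; rewrite sk2 in L2.
have C0 j := closed_sides (lp j) (cl j) k; have C1 j := closed_sides (lp j) (cl j) k.+1.
have -> : l i (k + n)%N = l i (k + n %% 6)%N by apply: lmod; rewrite modnDmr.
rewrite /hexl /y /z; have -> : (n %% 3 = (n %% 6) %% 3)%N by rewrite modn_dvdm.
move: {L0} (L0 false) (L0 true) {L1} (L1 false) (L1 true) {L2} (L2 false) (L2 true).
move: {C0} (C0 false) (C0 true) {C1} (C1 false) (C1 true) (ltn_pmod n (isT : 0 < 6)%N).
rewrite /= !addnS !addn0.
move: (n %% 6)%N; do 6?[case=> [|]] => //; rewrite ?addnS ?addn0 /=; case: i => *; lra.
Qed.

Lemma base_structure : hex_pattern a b (hex_region (P false) t (l false))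
  (hex_region (P true) t (l true)) (V false k) t' x1 x2 y z.
Proof.
have lE i : (fun n => l i (k + n)%N) = hexl (l i k) y z.
  by apply/funext => n; exact: base_len.
have HE i : hex_region (P i) t (l i) = hex_region (V i k) t' (hexl (l i k) y z).
  by rewrite -lE /t' hex_region_shift.
have e0E : edir t' 0 = edir t k by rewrite edir_shift addn0.
have e2E : edir t' 2 = edir t k.+2 by rewrite edir_shift addn2.
have V5 i : V i (k.+1 + 4) = vadd (V i k) (vcomb t' 0 z).
  have -> : V i k = V i (k + 6) by rewrite vtx6.
  rewrite !addnS !addn0 [in RHS]vtxS /vcomb e0E e2E edirSSS.
  have -> : l i k.+1.+4 = z by have := base_len i 5; rewrite addn5.
  move: (V i _) (edir t _) (edir t _) => v e e'.
  by rewrite [LHS]surjective_pairing /line /vadd /=; congr pair; ring.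
have V4 : V false (k + 4) = vadd (V false k) (pattern_r t' y z).
  rewrite !addnS addn0 !vtxS /pattern_r /vcomb e0E e2E edirSSS.
  have -> : l false k.+3 = x1 by have := base_len false 3; rewrite !addnS addn0.
  rewrite edirSS -/x1 -/y -/z; move: (V _ _) (edir t _) (edir t _) => v e e'.
  by rewrite /line /vadd /vsub /=; congr pair; ring.
have V1 i : V i k.+1 = vadd (V i k) (vcomb t' (l i k) 0).
  rewrite vtxS /vcomb e0E; move: (V _ _) (edir t _) (edir t' _) => v e e'.
  by rewrite /line /vadd /=; congr pair; ring.
have N0 := adjacent_swaps false k; rewrite (negbTE sk) in N0; case: N0 => m [n]; rewrite V4 => Er.
have {m n Er} [m1 [n1 rE]] : exists m n, pattern_r t' y z = G m n.
  exists (- m), (- n); rewrite -latN.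
  move: Er; move: (V _ _) (pattern_r _ _ _) => v r E.
  have := congr1 fst E; have := congr1 snd E; rewrite /vsub /vadd /= => E2 E1.
  by rewrite [LHS]surjective_pairing; congr pair; lra.
have [m0 [n0 E1]] := adjacent_swaps false k.+1.
have [m2 [n2 E2]] := adjacent_swaps true k.+1.
rewrite sk1 /= !V5 !V1 -/x1 -/x2 in E1 E2.
have pE : vadd (V true k) (G m0 n0) = pattern_base (V false k) t' x1 z.
  rewrite /pattern_base; move: E1; rewrite /vcomb; move: (edir t' 0) (edir t' 2) (V _ _) (V _ _) (G _ _).
  move=> e e' v v' g E; have := congr1 fst E; have := congr1 snd E; rewrite /vadd /= => {}E2 {}E1.
  by congr pair; lra.
have hE : pattern_h t' x1 x2 z = G (m0 + m2) (n0 + n2).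
  rewrite -latD; move: pE E2; rewrite /pattern_base /pattern_h /vcomb.
  move: (edir t' 0) (edir t' 2) (V _ _) (V _ _) (G _ _) (G _ _).
  move=> e e' v v' g g' E F; have := congr1 fst E; have := congr1 snd E.
  have := congr1 fst F; have := congr1 snd F; rewrite /vadd /= => ? ? ? ?.
  by congr pair; lra.
have H2E : transl (G m0 n0) (hex_region (P true) t (l true)) =
    hex_region (pattern_base (V false k) t' x1 z) t' (hexl x2 y z).
  by rewrite HE transl_hex pE.
split; [by split; exact: lpos | exact: HE | by exists m0, n0 | move=> v; split]; last first.
  by move=> [m [n ->]]; rewrite rE hE lat_lat; do 2 eexists.
(* The pattern lattice might still be a proper sublattice. But the pattern covers an interior point
   of the first hexagon shifted by [v], and the pattern tile there is a tile of the given tiling; by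
   disjointness it is that shifted hexagon. *)
move=> [m [n vE]].
have [q Hq] : exists q, in_tile_int (false, m, n) q.
  by apply: int_point => //=; rewrite vtx_vadd cl.
have [i [m' [n' Hc]]] := pattern_covers (V false k) t' (lpos false k) (lpos true k)
  (lpos false k.+1) (lpos false k.+2) q.
exists m', n'; rewrite vE; rewrite -[l false k]/x1 -[l true k]/x2 -/y -/z in Hc.
move: Hc; rewrite rE hE lat_lat; move: (m' * m1 + _) (m' * n1 + _) => M N Hc.
case: i Hc => /=; rewrite -?H2E -?HE ?transl_transl ?latD => Hc; last first.
  suff /(conflict_int lp lpos cl disj)/(_ Hq)[-> ->] : in_tile (false, M, N) q by [].
  exact/in_tileP.
suff /(conflict_int lp lpos cl disj)/(_ Hq) : in_tile (true, m0 + M, n0 + N) q by [].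
exact/in_tileP.
Qed.

End Base.

Lemma aligned_structure i k j : adjacent i k j -> i <> j ->
  exists p t' x1 x2 y z, hex_pattern a b (hex_region (P false) t (l false))
    (hex_region (P true) t (l true)) p t' x1 x2 y z.
Proof.
move=> H ij; have [|k0 [s0 s1 s2]] := swaps_base.
  by exists k; move: (adjacent_swapsE H) ij; case: (swaps k) => //; rewrite addbF => ->.
by have := base_structure s0 s1 s2; do 6 eexists; eassumption.
Qed.

End Aligned.

(** * From tilings up to null sets to tilings by closed hexagons *)

Section HexTiling.
Variable R : realType.

Lemma null2_box (E : set (pt R)) (x : pt R) (d : R) : 0 < d ->
  (forall y : pt R, `|y.1 - x.1| < d -> `|y.2 - x.2| < d -> E y) -> ~ null2 E.
Proof.
move=> d0 H [B [mB EB B0]].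
pose I (c : R) : set R := `[c - d / 2, c + d / 2]%classic.
have mI c : measurable (I c : set (measurableTypeR R)) by exact: measurable_itv.
have LI c : @lebesgue_measure R (I c) = d%:E.
  rewrite lebesgue_measure_itv /= lte_fin ifT; first by rewrite -EFinD; congr EFin; lra.
  lra.
have IE : I x.1 `*` I x.2 `<=` B.
  move=> y [/=]; rewrite /I /= !in_itv /= => /andP[h1 h2] /andP[h3 h4]; apply: EB; apply: H.
    by rewrite ltr_norml; lra.
  by rewrite ltr_norml; lra.
have : ((@leb2 R) (I x.1 `*` I x.2) <= (@leb2 R) B)%E.
  by apply: (@le_measure _ _ _ ((@lebesgue_measure R) \x (@lebesgue_measure R))%E);
    rewrite ?inE //; exact: measurableX.
rewrite B0 /leb2 product_measure1E; [|exact: mI|exact: mI].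
by rewrite /= !LI -EFinM lee_fin leNgt mulr_gt0.
Qed.

Lemma lmeas_aeq (E F : set (pt R)) : lmeas E -> aeq2 E F -> lmeas F.
Proof.
move=> [A [mA [AE EA]]] [[B [mB EFB B0]] FE].
exists (A `\` B); split; first exact: measurableD.
split => [x [Ax Bx]|].
  by apply: contrapT => Fx; apply: Bx; apply: EFB; split => //; exact: AE.
have nB : null2 B by exists B; split.
apply: (null2_sub _ (null2U (null2U FE EA) nB)) => x [Fx nx].
have [Ex|Ex] := pselect (E x); last by left; left.
have [Ax|Ax] := pselect (A x); last by left; right.
by right; apply: contrapT => Bx; apply: nx.
Qed.

Lemma aeq2_sym (E F : set (pt R)) : aeq2 E F -> aeq2 F E.
Proof. by case. Qed.

Lemma aeq2_transl g (E F : set (pt R)) : aeq2 E F -> aeq2 (transl g E) (transl g F).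
Proof.
have H (A B : set (pt R)) : null2 (A `\` B) -> null2 (transl g A `\` transl g B).
  move=> /(null2_transl g); apply: null2_sub => x [/translP Ax Bx].
  by apply/translP; split => // Bx'; apply: Bx; apply/translP.
by move=> [EF FE]; split; exact: H.
Qed.

Lemma null2_countable (I : countType) (F : I -> set (pt R)) :
  (forall i, null2 (F i)) -> null2 [set x | exists i, F i x].
Proof.
move=> nF; pose G n := if @unpickle I n is Some i then F i else set0.
apply: (null2_sub _ (@null2_bigcup R G _)).
  by move=> x [i Fi]; exists (pickle i) => //; rewrite /G pickleK.
by move=> n; rewrite /G; case: (unpickle n) => [i|]; [exact: nF | exact: null2_0].
Qed.

Lemma tiling_aeq (a b : pt R) E1 E2 F1 F2 : tiling a b E1 E2 -> aeq2 E1 F1 -> aeq2 E2 F2 ->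
  tiling a b F1 F2.
Proof.
move=> [li m1 m2 ov unc] e1 e2.
have ek k : aeq2 (gen E1 E2 k) (gen F1 F2 k) by case: k.
split => //; [exact: lmeas_aeq e1|exact: lmeas_aeq e2| |].
- move=> k m n k' m' n' neq.
  have [_ n1] := aeq2_transl (lat a b m n) (ek k).
  have [_ n2] := aeq2_transl (lat a b m' n') (ek k').
  apply: (null2_sub _ (null2U (null2U n1 n2) (ov _ _ _ _ _ _ neq))) => x [h1 h2].
  have [?|?] := pselect (transl (lat a b m n) (gen E1 E2 k) x); last by left; left.
  have [?|?] := pselect (transl (lat a b m' n') (gen E1 E2 k') x); last by left; right.
  by right.
- pose D (i : bool * int * int) := transl (lat a b i.1.2 i.2) (gen E1 E2 i.1.1) `\`
    transl (lat a b i.1.2 i.2) (gen F1 F2 i.1.1).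
  have nD i : null2 (D i) by have [] := aeq2_transl (lat a b i.1.2 i.2) (ek i.1.1).
  apply: (null2_sub _ (null2U unc (null2_countable nD))) => x Hx.
  have [[k [m [n Ex]]]|] := pselect (exists k m n, transl (lat a b m n) (gen E1 E2 k) x);
    last by left.
  by right; exists (k, m, n); split => // Fx; apply: Hx; exists k, m, n.
Qed.

Lemma pigeonhole_seq (A : eqType) (s : seq A) (Q : A -> R -> Prop) :
  (forall s0 : R, 0 < s0 -> exists (r : R) (i : A), [/\ 0 < r, r < s0, i \in s & Q i r]) ->
  exists i, forall s0 : R, 0 < s0 -> exists r : R, [/\ 0 < r, r < s0 & Q i r].
Proof.
elim: s => [|i s IH] H; first by have [r [i []]] := H 1 ltr01.
have [Hi|/existsNP[s1 /not_implyP[s10 Hi]]] := pselect (forall s0 : R, 0 < s0 ->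
  exists r : R, [/\ 0 < r, r < s0 & Q i r]); first by exists i.
apply: IH => s0 s00; have [|r [j [r0]]] := H (Num.min s0 s1); first by rewrite lt_min s00.
rewrite lt_min => /andP[r1 r2]; rewrite inE => /predU1P[-> Qi|js Qj].
  by case: Hi; exists r.
by exists r, j.
Qed.

Lemma hexD_lip (p : pt R) t l k (x y : pt R) (d : R) :
  `|y.1 - x.1| <= d -> `|y.2 - x.2| <= d -> hexD p t l k x - 2 * d <= hexD p t l k y.
Proof.
move=> h1 h2; have [e1 e2] := edir_coord_le1 t k.
have -> : hexD p t l k y = hexD p t l k x + cross (edir t k) (vsub y x).
  rewrite /hexD; move: (edir t k) (vtx p t l k) => e v; rewrite /cross /vsub /=; ring.
rewrite /cross /vsub; move: (edir t k) e1 e2 => [c e] /= e1 e2.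
have : `|c * (y.2 - x.2)| <= 1 * d by rewrite normrM; exact: ler_pM.
have : `|e * (y.1 - x.1)| <= 1 * d by rewrite normrM; exact: ler_pM.
by rewrite !ler_norml; lra.
Qed.

Lemma in_int_box (p : pt R) t l x : periodic6 l -> vtx p t l 6 = p -> in_int p t l x ->
  exists2 d : R, 0 < d & forall y : pt R, `|y.1 - x.1| < d -> `|y.2 - x.2| < d ->
    in_hex p t l y.
Proof.
move=> lp cl H.
pose Q k (d : R) := 2 * d <= hexD p t l k x.
have [||d d0 Hd] := @fin_eps R 6 Q.
- by move=> k e e'; rewrite /Q; lra.
- by move=> k _; exists (hexD p t l k x / 2); [have := H k; lra|rewrite /Q; lra].
exists d => // y y1 y2; apply: hexD_lt6 => // k k6.
by have := hexD_lip p t l k (ltW y1) (ltW y2); have := Hd k k6; rewrite /Q; lra.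
Qed.

(** Opposite distances have a constant sum, so the distances to the sides 0 and 1 are bounded;
    Cramer's rule turns this into bounds on the coordinates. *)
Lemma in_hex_bounded (p : pt R) t l : periodic6 l -> vtx p t l 6 = p ->
  exists B : R, forall z : pt R, in_hex p t l z -> `|z.1| <= B /\ `|z.2| <= B.
Proof.
move=> lp cl; have w0 := w3_gt0 R.
pose c := cross (edir t 1) (vsub (vtx p t l 1) p).
pose K := w3 R * (l 1%N + l 2) + (w3 R * (l 2 + l 3)) + `|c|.
exists (`|p.1| + `|p.2| + K / w3 R) => z Hz.
have D0 := Hz 0%N; have D1 := Hz 1%N.
have := Hz 3; rewrite (hexD_3 lp cl) => D3; have := Hz 4; rewrite (hexD_3 lp cl) => D4.
have E1 : cross (edir t 1) (vsub z p) = hexD p t l 1 z + c.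
  rewrite /c /hexD; move: (edir t 1) (vtx p t l 1) => e v; rewrite /cross /vsub /=; ring.
have E0 : cross (edir t 0) (vsub z p) = hexD p t l 0 z by rewrite /hexD vtx0.
have cw := cross_edirS t 0.
have cb : `|hexD p t l 0 z| + `|hexD p t l 1 z + c| <= K.
  rewrite ger0_norm //; apply: le_trans (lerD (lexx _) (ler_normD _ _)) _.
  by rewrite (ger0_norm D1) /K; lra.
have [[u1 u2] [v1 v2]] := (edir_coord_le1 t 0, edir_coord_le1 t 1).
have F (f g : R) : `|f| <= 1 -> `|g| <= 1 ->
    `|hexD p t l 0 z * f - (hexD p t l 1 z + c) * g| <= K.
  move=> f1 g1; apply: le_trans (ler_normB _ _) _; rewrite !normrM; apply: le_trans cb.
  by apply: lerD; rewrite ler_piMr.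
have Z1 : z.1 = p.1 + (hexD p t l 0 z * (edir t 1).1 - (hexD p t l 1 z + c) * (edir t 0).1) / w3 R.
  rewrite -E0 -E1 -cw; rewrite -cw in w0; move: (edir t 0) (edir t 1) w0 => e e'.
  by rewrite /cross /vsub /= => w0; field; rewrite gt_eqF.
have Z2 : z.2 = p.2 + (hexD p t l 0 z * (edir t 1).2 - (hexD p t l 1 z + c) * (edir t 0).2) / w3 R.
  rewrite -E0 -E1 -cw; rewrite -cw in w0; move: (edir t 0) (edir t 1) w0 => e e'.
  by rewrite /cross /vsub /= => w0; field; rewrite gt_eqF.
have [p1 p2] : 0 <= `|p.1| /\ 0 <= `|p.2| by [].
have n (f : R) : `|f| <= K -> `|f / w3 R| <= K / w3 R.
  by move=> fK; rewrite normrM normfV (gtr0_norm w0) ler_pM2r // invr_gt0.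
rewrite Z1 Z2; split; apply: le_trans (ler_normD _ _) _.
  by have := n _ (F _ _ v1 u1); lra.
by have := n _ (F _ _ v2 u2); lra.
Qed.

Definition int_range (N : nat) : seq int :=
  [seq Posz k | k <- iota 0 N.+1] ++ [seq - Posz k | k <- iota 0 N.+1].

Lemma mem_int_range N (m : int) : (`|m| <= N)%N -> m \in int_range N.
Proof.
move=> mN; rewrite mem_cat; case: m mN => k kN.
  by rewrite map_f // mem_iota.
apply/orP; right; apply/mapP; exists k.+1; last by rewrite NegzE.
by rewrite mem_iota.
Qed.

(** Cramer's rule bounds the integer coefficients in terms of the size of the vector. *)
Lemma lat_bounded (a b : pt R) (K : R) : lin_indep a b -> exists N : nat, forall m n,
  `|(lat a b m n).1| <= K -> `|(lat a b m n).2| <= K -> (`|m| <= N)%N /\ (`|n| <= N)%N.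
Proof.
move=> li; pose dt := a.1 * b.2 - a.2 * b.1.
have d0 : 0 < `|dt| by rewrite normr_gt0.
pose C := K * (`|a.1| + `|a.2| + `|b.1| + `|b.2|) / `|dt|.
exists (Num.trunc C) => m n; rewrite /lat /=.
set g1 := m%:~R * a.1 + _; set g2 := m%:~R * a.2 + _ => h1 h2.
have K0 : 0 <= K by apply: le_trans h1.
have F (i : int) (f g : R) : i%:~R * dt = g1 * f - g2 * g ->
    `|f| + `|g| <= `|a.1| + `|a.2| + `|b.1| + `|b.2| -> (`|i| <= Num.trunc C)%N.
  move=> E fg; have iC : (`|i|%N)%:R <= C.
    rewrite natr_absz intr_norm /C ler_pdivlMr // -normrM E.
    apply: le_trans (ler_normB _ _) _; rewrite !normrM.
    apply: (@le_trans _ _ (K * (`|f| + `|g|))); last exact: ler_wpM2l.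
    by rewrite mulrDr; apply: lerD; exact: ler_wpM2r.
  by rewrite truncn_ge_nat //; apply: le_trans iC.
have [? ? ? ?] : [/\ 0 <= `|a.1|, 0 <= `|a.2|, 0 <= `|b.1| & 0 <= `|b.2|] by [].
split.
  by apply: (F m b.2 b.1); [rewrite /dt /g1 /g2; ring | lra].
by apply: (F n (- a.2) (- a.1)); [rewrite /dt /g1 /g2; ring | rewrite !normrN; lra].
Qed.

Variables (a b : pt R) (P : bool -> pt R) (T : bool -> R) (l : bool -> nat -> R).
Hypotheses (lp : forall i, periodic6 (l i)) (cl : forall i, vtx (P i) (T i) (l i) 6 = P i).
Let H i := hex_region (P i) (T i) (l i).
Hypothesis til : tiling a b (H false) (H true).
Local Notation in_tile := (in_tile a b P T l).
Local Notation in_tile_int := (in_tile_int a b P T l).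

Let Hk (k : bool) : gen (H false) (H true) k = H k. Proof. by case: k. Qed.

Lemma tile_disjoint tau tau' x : in_tile_int tau x -> in_tile_int tau' x -> tau = tau'.
Proof.
move=> h h'; apply: contrapT => neq.
have clt (i : bool * int * int) : vtx (tile_base a b P i) (T i.1.1) (l i.1.1) 6 = tile_base a b P i.
  by rewrite /tile_base vtx_vadd cl.
have [d d0 Hd] := in_int_box (lp tau.1.1) (clt tau) h.
have [d' d0' Hd'] := in_int_box (lp tau'.1.1) (clt tau') h'.
have [_ _ _ ov _] := til.
case: tau tau' neq {h h'} Hd Hd' => [[k m] n] [[k' m'] n'] neq Hd Hd'.
apply: (@null2_box _ x (Num.min d d')) (ov _ _ _ _ _ _ neq); first by rewrite lt_min d0.
move=> y; rewrite !lt_min !Hk => /andP[y1 y2] /andP[y3 y4]; split.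
  by apply/(@in_tileP _ a b P T l (k, m, n)) => //; exact: Hd.
by apply/(@in_tileP _ a b P T l (k', m', n')) => //; exact: Hd'.
Qed.

(** A tile meeting the unit box around [x] has a bounded translation vector, so only finitely many
    index triples occur. *)
Lemma tile_pigeonhole (x : pt R) (Q : bool * int * int -> R -> Prop) :
  (forall s0 : R, 0 < s0 -> exists (s : R) tau, [/\ 0 < s, s < s0,
     exists y, [/\ in_tile tau y, `|y.1 - x.1| <= 1 & `|y.2 - x.2| <= 1] & Q tau s]) ->
  exists tau, forall s0 : R, 0 < s0 -> exists s : R, [/\ 0 < s, s < s0 & Q tau s].
Proof.
move=> HQ; have [li _ _ _ _] := til.
have [B0 HB0] := in_hex_bounded (lp false) (cl false).
have [B1 HB1] := in_hex_bounded (lp true) (cl true).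
have [N HN] := lat_bounded (`|x.1| + `|x.2| + 1 + `|B0| + `|B1|) li.
pose s := [seq (i, mn.1, mn.2) | i <- [:: false; true],
   mn <- [seq (m, n) | m <- int_range N, n <- int_range N]].
apply: (@pigeonhole_seq _ s) => s0 s00; have [r [tau [r0 r1 [y [cy y1 y2]] Qr]]] := HQ s0 s00.
exists r, tau; split => //.
have zE : in_hex (P tau.1.1) (T tau.1.1) (l tau.1.1) (vsub y (lat a b tau.1.2 tau.2)).
  by apply/in_hexP => //; apply/translP; apply/in_tileP.
have [z1 z2] : `|y.1 - (lat a b tau.1.2 tau.2).1| <= `|B0| + `|B1| /\
    `|y.2 - (lat a b tau.1.2 tau.2).2| <= `|B0| + `|B1|.
  have [n0 n1] : 0 <= `|B0| /\ 0 <= `|B1| by [].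
  have [m0 m1] := (ler_norm B0, ler_norm B1).
  by move: zE; case: tau.1.1 => [/HB1|/HB0] [] /=; lra.
have bd (u v g B : R) : `|v - u| <= 1 -> `|v - g| <= B -> `|g| <= `|u| + 1 + B.
  by move=> h1 h2; have := ler_norm u; have := ler_norm (- u); rewrite normrN;
    move: h1 h2; rewrite !ler_norml; lra.
have [x1 x2] : 0 <= `|x.1| /\ 0 <= `|x.2| by [].
have [||mN nN] := HN tau.1.2 tau.2.
- by have := bd _ _ _ _ y1 z1; lra.
- by have := bd _ _ _ _ y2 z2; lra.
case: tau mN nN {cy Qr zE z1 z2} => [[i m] n] /= mN nN.
apply/allpairsP; exists (i, (m, n)); split => //; first by case: i; rewrite !inE.
by apply/allpairsP; exists (m, n); split => //; exact: mem_int_range.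
Qed.

(** The uncovered set is null and contains no box, so tiles come arbitrarily near to [x]. By local
    finiteness a single tile does, and being closed it contains [x]. *)
Lemma tile_cover x : exists tau, in_tile tau x.
Proof.
have [_ _ _ _ nc] := til.
pose Q tau (s : R) := exists y : pt R, [/\ in_tile tau y, `|y.1 - x.1| <= s & `|y.2 - x.2| <= s].
have [|tau Ht] := @tile_pigeonhole x Q.
  move=> s0 s00; pose s := Num.min s0 1 / 2.
  have m0 : 0 < Num.min s0 1 by rewrite lt_min s00 ltr01.
  have [m1 m2] : Num.min s0 1 <= s0 /\ Num.min s0 1 <= 1 by split; rewrite ge_min lexx ?orbT.
  have sp : 0 < s by rewrite /s; lra.
  have [[y [tau [cy y1 y2]]]|C] := pselect (exists y tau,
      [/\ in_tile tau y, `|y.1 - x.1| < s & `|y.2 - x.2| < s]).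
    exists s, tau; split => //; [by rewrite /s; lra | | by exists y; split => //; exact: ltW].
    by exists y; split => //; apply: ltW; [apply: lt_le_trans y1 _|apply: lt_le_trans y2 _];
      rewrite /s; lra.
  case: (@null2_box _ x s sp _ nc) => y y1 y2 [k [m [n]]]; rewrite Hk => ky.
  by apply: C; exists y, (k, m, n); split => //; apply/in_tileP.
exists tau => k; rewrite leNgt; apply/negP => D0.
set d := hexD _ _ _ k x in D0.
have [|s [s1 s2 [y [cy y1 y2]]]] := Ht (- d / 2); first by lra.
have := @hexD_lip (tile_base a b P tau) (T tau.1.1) (l tau.1.1) k y x s.
rewrite ![`|x.1 - _|]distrC ![`|x.2 - _|]distrC => /(_ y1 y2).
by have := cy k; rewrite -/d; lra.
Qed.

End HexTiling.

Lemma vtx_ext (R : realType) (p : pt R) t t' l l' k :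
  (forall i, edir t i = edir t' i) -> (forall i, (i < k)%N -> l i = l' i) ->
  vtx p t l k = vtx p t' l' k.
Proof.
by move=> eE lE; rewrite /vtx; congr pair; congr (_ + _); apply: eq_bigr => i _;
  rewrite eE lE.
Qed.

Lemma hex_region_ext (R : realType) (p : pt R) t t' l l' :
  (forall i, edir t i = edir t' i) -> (forall i, (i < 6)%N -> l i = l' i) ->
  hex_region p t l = hex_region p t' l'.
Proof.
move=> eE lE; have vE k : (k < 6)%N -> vtx p t l k = vtx p t' l' k.
  by move=> k6; apply: vtx_ext => // i ik; apply: lE; exact: ltn_trans k6.
by apply/seteqP; split => x H k k6; have := H k k6; rewrite eE vE.
Qed.

Lemma hex120_periodic (R : realType) (E : set (pt R)) : is_hex120 E ->
  exists p t l, [/\ periodic6 l, forall k, 0 < l k, vtx p t l 6 = p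
    & aeq2 E (hex_region p t l)].
Proof.
move=> [p [t [l [[lpos cl] aE]]]]; exists p, t, (fun k => l (k %% 6)%N).
have lE i : (i < 6)%N -> l i = l (i %% 6)%N by move=> i6; rewrite modn_small.
split.
- by move=> k; rewrite modnDr.
- by move=> k; apply: lpos; rewrite ltn_mod.
- by rewrite -[RHS]cl; apply: vtx_ext => // i /lE.
- by rewrite -(@hex_region_ext _ p t t l).
Qed.

(** A side between tiles of both types ties the inclinations of the two hexagons together;
    renumbering the corners of the second one gives common directions, and the aligned case
    applies. *)
Theorem tiling_structure (R : realType) (a b : pt R) E1 E2 :
  tiling a b E1 E2 -> config66 E1 E2 -> exists H1 H2 p t x1 x2 y z,
    [/\ aeq2 E1 H1, aeq2 E2 H2 & hex_pattern a b H1 H2 p t x1 x2 y z].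
Proof.
move=> til0 [/hex120_periodic[p1 [t1 [l1 [lp1 lpos1 cl1 a1]]]]].
move=> /hex120_periodic[p2 [t2 [l2 [lp2 lpos2 cl2 a2]]]].
exists (hex_region p1 t1 l1), (hex_region p2 t2 l2).
suff [p [t [x1 [x2 [y [z H]]]]]] : exists p t x1 x2 y z,
    hex_pattern a b (hex_region p1 t1 l1) (hex_region p2 t2 l2) p t x1 x2 y z.
  by exists p, t, x1, x2, y, z.
have til := tiling_aeq til0 a1 a2.
have {til0 a1 a2 E1 E2} [c [eS [k [m [n vE]]]]] : exists c,
    (forall j, edir t2 (c + j) = edir t1 j) /\ exists k m n,
    vtx p1 t1 l1 k = vadd (vtx p2 t2 l2 (c + (k + 4))) (lat a b m n).
  pose P (i : bool) := if i then p2 else p1; pose T (i : bool) := if i then t2 else t1.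
  pose l (i : bool) := if i then l2 else l1.
  have lp i : periodic6 (l i) by case: i.
  have lpos i k : 0 < l i k by case: i.
  have cl i : vtx (P i) (T i) (l i) 6 = P i by case: i.
  have [[[i m] n] [k [[[j m'] n'] [k' [/= i0 j1]]]]] := mixed_neighbour lp lpos cl
    (tile_disjoint lp cl til) (tile_cover lp cl til) (tile_pigeonhole lp cl til).
  rewrite {}i0 {}j1 /tile_base /= !vtx_vadd => vE eE.
  (* The shift makes direction [c] of the second hexagon equal to direction 0 of the first; 5 again
     stands for -1 modulo 6. *)
  exists (k' + (2 + 5 * k))%N; split.
    move=> j'; rewrite -addnA (edir_sync _ eE) edir_mod [RHS]edir_mod; congr edir.
    by rewrite (_ : k + 4 + (2 + 5 * k + j') = k.+1 * 6 + j')%N ?modnMDl //; lia.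
  exists k, (m' - m), (n' - n); rewrite -latD vaddA -latN.
  apply: (iffLR (vadd_eq _ _ _)); rewrite vE; congr vadd.
  apply: (period6_mod (f := vtx p2 t2 l2)) => [j'|]; first by rewrite vtx6.
  by rewrite (_ : k' + (2 + 5 * k) + (k + 4) = k.+1 * 6 + k')%N ?modnMDl //; lia.
pose P (i : bool) := if i then vtx p2 t2 l2 c else p1.
pose l (i : bool) := if i then (fun j => l2 (c + j)%N) else l1.
have eS' j : edir t1 j = edir (t2 + c%:R * (pi / 3)) j by rewrite edir_shift eS.
have vS j : vtx (P true) t1 (l true) j = vtx p2 t2 l2 (c + j).
  by rewrite -vtx_shift; exact: vtx_ext.
have lp i : periodic6 (l i) by case: i => //= j; rewrite addnA lp2.
have lpos i j : 0 < l i j by case: i => /=.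
have cl i : vtx (P i) t1 (l i) 6 = P i by case: i => //; rewrite vS vtx6.
have H2E : hex_region p2 t2 l2 = hex_region (P true) t1 (l true).
  by rewrite -(hex_region_shift lp2 cl2 c); apply: hex_region_ext.
have {}til : tiling a b (hex_region (P false) t1 (l false)) (hex_region (P true) t1 (l true)).
  by rewrite -H2E.
rewrite H2E; apply: (aligned_structure lp lpos cl (@tile_disjoint _ a b P (fun=> t1) l lp cl til)
   (@neighbour _ a b P (fun=> t1) l lp lpos cl (@tile_disjoint _ a b P (fun=> t1) l lp cl til)
   (@tile_cover _ a b P (fun=> t1) l lp cl til) (@tile_pigeonhole _ a b P (fun=> t1) l lp cl til))
   (i := false) (j := true) (k := k)) => //.
by exists m, n; rewrite vS.
Qed.

(** * Optimal sides *)

Lemma small_pos (R : realType) (a b c d : R) : 0 < a -> 0 < b -> 0 < c -> 0 < d ->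
  exists e : R, [/\ 0 < e, e <= a, e <= b, e <= c & e <= d].
Proof.
move=> a0 b0 c0 d0; exists (Num.min (Num.min a b) (Num.min c d)).
by rewrite !lt_min a0 b0 c0 d0 !ge_min !lexx ?orbT.
Qed.

(* If y <> z, moving y and z towards each other at constant y + z shortens the pattern.
   If y = z, then s |-> C / (2 s) + 3 s, with C = 2 y (x1 + x2) + 2 y^2, is the length of
   the pattern with y = z = s and the same areas; it is stationary only at C = 6 y^2. *)
Lemma optimal_sides (R : realType) (x1 x2 y z : R) : 0 < x1 -> 0 < x2 -> 0 < y -> 0 < z ->
  (forall x1' x2' y' z' : R, 0 < x1' -> 0 < x2' -> 0 < y' -> 0 < z' ->
     x1' * y' + y' * z' + z' * x1' = x1 * y + y * z + z * x1 ->
     x2' * y' + y' * z' + z' * x2' = x2 * y + y * z + z * x2 ->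
     x1 + x2 + 2 * y + 2 * z <= x1' + x2' + 2 * y' + 2 * z') ->
  y = z /\ x1 + x2 = 2 * y.
Proof.
move=> x10 x20 y0 z0 opt.
have yz : y = z.
  apply/eqP/negPn/negP => neq; have [d dE] : exists d, d = (y - z) ^+ 2 by exists ((y - z) ^+ 2).
  have [S SE] : exists S, S = y + z by exists (y + z).
  have d0 : 0 < d by rewrite dE exprn_even_gt0 //= subr_eq0.
  have S0 : 0 < S by rewrite SE; lra.
  have [e [e0 e1 e2 e3 _]] := @small_pos R (1 / 2) (S * x1 / (2 * d)) (S * x2 / (2 * d)) 1
    ltac:(lra) ltac:(by rewrite divr_gt0 // mulr_gt0) ltac:(by rewrite divr_gt0 // mulr_gt0) ltr01.
  rewrite ler_pdivlMr ?mulr_gt0 // in e2; rewrite ler_pdivlMr ?mulr_gt0 // in e3.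
  (* The move raises [y z] by [e (1 - e) (y - z)^2]. Taking [g] off both [x1] and [x2] restores both
     areas at once, since each is affine in its [x] with slope [y + z]; the bounds on [e] keep [g]
     below both. *)
  pose g := e * (1 - e) * d / S.
  have g0 : 0 < g by rewrite divr_gt0 // !mulr_gt0 //; lra.
  have ge : g * S <= e * d.
    by rewrite /g divfK ?gt_eqF // ler_pM2r // ler_piMr //; lra.
  have gx x : 0 < x -> e * (2 * d) <= S * x -> g < x.
    move=> x0 h; rewrite -(ltr_pM2r S0); apply: le_lt_trans ge _.
    by have : 0 < e * d by [rewrite mulr_gt0]; have -> : x * S = S * x by [ring]; lra.
  have gE : g * (y + z) = e * (1 - e) * (y - z) ^+ 2 by rewrite -SE -dE /g divfK ?gt_eqF.
  have ar x : (x - g) * ((1 - e) * y + e * z) +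
      ((1 - e) * y + e * z) * (e * y + (1 - e) * z) + (e * y + (1 - e) * z) * (x - g) =
      x * y + y * z + z * x.
    transitivity (x * y + y * z + z * x + (e * (1 - e) * (y - z) ^+ 2 - g * (y + z))).
      by ring.
    by rewrite gE subrr addr0.
  have := opt (x1 - g) (x2 - g) ((1 - e) * y + e * z) (e * y + (1 - e) * z).
  have [p1 p2 p3 p4] : [/\ 0 < (1 - e) * y, 0 < e * z, 0 < e * y & 0 < (1 - e) * z].
    by split; rewrite mulr_gt0 //; lra.
  rewrite !subr_gt0 !gx // !addr_gt0 // => /(_ isT isT isT isT (ar _) (ar _)).
  have -> : 2 * ((1 - e) * y + e * z) = 2 * y + 2 * (e * z - e * y) by ring.
  have -> : 2 * (e * y + (1 - e) * z) = 2 * z - 2 * (e * z - e * y) by ring.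
  lra.
rewrite -{}yz in opt *; split => //.
(* [X x] is the side that restores the area when [y] and [z] become [s], positive by the hypotheses
   on [s]. The product is the increase in length times [2 s y]. *)
have comp (s : R) : 0 < s -> s ^+ 2 < y ^+ 2 + 2 * x1 * y -> s ^+ 2 < y ^+ 2 + 2 * x2 * y ->
    0 <= (s - y) * (6 * s * y - (2 * y * (x1 + x2) + 2 * y ^+ 2)).
  move=> s0 h1 h2; pose X x := (y ^+ 2 + 2 * x * y - s ^+ 2) / (2 * s).
  have X0 x : s ^+ 2 < y ^+ 2 + 2 * x * y -> 0 < X x.
    by move=> h; rewrite divr_gt0 ?subr_gt0 ?mulr_gt0.
  have XE x : X x * (2 * s) = y ^+ 2 + 2 * x * y - s ^+ 2.
    by rewrite /X divfK // gt_eqF // mulr_gt0.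
  have ar x : X x * s + s * s + s * X x = x * y + y * y + y * x.
    transitivity (X x * (2 * s) + s ^+ 2); first by ring.
    by rewrite XE; ring.
  have := opt (X x1) (X x2) s s (X0 _ h1) (X0 _ h2) s0 s0 (ar _) (ar _).
  rewrite -subr_ge0 => h.
  have : 0 <= (X x1 + X x2 + 2 * s + 2 * s - (x1 + x2 + 2 * y + 2 * y)) * (2 * s * y).
    by rewrite mulr_ge0 // !mulr_ge0 // ltW.
  congr (_ <= _).
  transitivity ((X x1 * (2 * s) + X x2 * (2 * s) + (4 * s - (x1 + x2 + 4 * y)) * (2 * s)) * y).
    by ring.
  by rewrite !XE; ring.
have [h|h|//] := ltgtP (x1 + x2) (2 * y).
(* The midpoint between [y] and the zero [C / (6 y)] of the second factor gives the two factors
   opposite strict signs. *)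
- pose s := y / 2 + (2 * (x1 + x2) + 2 * y) / 12.
  have s1 : s < y by rewrite /s; lra.
  have s0 : 0 < s by rewrite /s; lra.
  have s2 : s ^+ 2 < y ^+ 2 by rewrite ltr_pXn2r // nnegrE ltW.
  have q x : 0 < x -> s ^+ 2 < y ^+ 2 + 2 * x * y.
    by move=> ?; apply: lt_le_trans s2 _; rewrite lerDl !mulr_ge0 // ltW.
  have := comp s s0 (q _ x10) (q _ x20).
  have -> : 6 * s * y - (2 * y * (x1 + x2) + 2 * y ^+ 2) = y * (6 * s - (2 * (x1 + x2) + 2 * y)).
    by ring.
  rewrite leNgt nmulr_rlt0 ?subr_lt0 // mulr_gt0 // /s; lra.
(* Here [s] must exceed [y], and the new sides stay positive only for a small step, hence the bounds
   on [e] by [x1] and [x2]. *)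
- have [e [e0 e1 e2 e3 e4]] := @small_pos R y (x1 / 2) (x2 / 2) ((x1 + x2 - 2 * y) / 6)
    y0 ltac:(lra) ltac:(lra) ltac:(lra).
  have q x : 0 < x -> e <= x / 2 -> (y + e) ^+ 2 < y ^+ 2 + 2 * x * y.
    move=> x0 ex; have -> : (y + e) ^+ 2 = y ^+ 2 + (2 * y + e) * e by ring.
    rewrite ltrD2l; apply: (@le_lt_trans _ _ (3 * y * e)).
      by rewrite ler_pM2r //; lra.
    have -> : 2 * x * y = y * (2 * x) by ring.
    by have -> : 3 * y * e = y * (3 * e) by [ring]; rewrite ltr_pM2l //; lra.
  have := comp (y + e) ltac:(lra) (q _ x10 e2) (q _ x20 e3).
  have -> : (y + e - y) * (6 * (y + e) * y - (2 * y * (x1 + x2) + 2 * y ^+ 2)) =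
      e * y * (6 * (y + e) - (2 * (x1 + x2) + 2 * y)) by ring.
  by rewrite leNgt pmulr_rlt0 ?mulr_gt0 //; lra.
Qed.

(** * Isoperimetric patterns and their isometries *)

Section Final.
Variable R : realType.

Lemma aeq2_trans (E F G : set (pt R)) : aeq2 E F -> aeq2 F G -> aeq2 E G.
Proof.
have H (A B C : set (pt R)) : null2 (A `\` B) -> null2 (B `\` C) -> null2 (A `\` C).
  move=> h1 h2; apply: (null2_sub _ (null2U h1 h2)) => x [Ax Cx].
  by have [Bx|Bx] := pselect (B x); [right|left].
by move=> [e1 e2] [f1 f2]; split; [exact: H e1 f1|exact: H f2 e2].
Qed.

Lemma transl0 (E : set (pt R)) : transl (0, 0) E = E.
Proof.
have vE (x : pt R) : vsub x (0, 0) = x.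
  by rewrite /vsub /= !subr0 -surjective_pairing.
by apply/seteqP; split => x; rewrite translP vE.
Qed.

Lemma lat0 (a b : pt R) : lat a b 0 0 = (0, 0).
Proof. by rewrite /lat; congr pair; ring. Qed.

Lemma translK (g : pt R) (E F : set (pt R)) : transl g E = F -> E = transl (vsub (0, 0) g) F.
Proof.
move=> <-; rewrite transl_transl (_ : vadd g _ = (0, 0)) ?transl0 //.
by rewrite /vadd /vsub /=; congr pair; ring.
Qed.

Lemma pattern_measures (a b : pt R) E1 E2 H1 H2 p t (x1 x2 y z : R) :
  lmeas E1 -> lmeas E2 -> aeq2 E1 H1 -> aeq2 E2 H2 -> hex_pattern a b H1 H2 p t x1 x2 y z ->
  [/\ area E1 = (w3 R * (x1 * y + y * z + z * x1))%:E,
      area E2 = (w3 R * (x2 * y + y * z + z * x2))%:E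
    & PerT E1 E2 = (x1 + x2 + 2 * y + 2 * z)%:E].
Proof.
move=> m1 m2 a1 a2 [[x10 x20 y0 z0] E [m [n /translK]]]; rewrite transl_hex => F _.
rewrite {}E in a1; rewrite {}F in a2; split; [exact: area_hex a1|exact: area_hex a2|].
rewrite /PerT (Per_hex x10 y0 z0 m1 a1) (Per_hex x20 y0 z0 m2 a2) -EFinD -EFinM.
by congr EFin; field.
Qed.

Lemma hex_pattern_refl p t (x1 x2 y z : R) : 0 < x1 -> 0 < x2 -> 0 < y -> 0 < z ->
  hex_pattern (pattern_r t y z) (pattern_h t x1 x2 z) (hex_region p t (hexl x1 y z))
    (hex_region (pattern_base p t x1 z) t (hexl x2 y z)) p t x1 x2 y z.
Proof.
by move=> *; split => //; exists 0, 0; rewrite lat0 transl0.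
Qed.

(** The explicit patterns with the same areas are admissible competitors, which turns minimality
    into the hypothesis of [optimal_sides]. *)
Lemma isoperimetric_structure (a b : pt R) E1 E2 :
  isoperimetric a b E1 E2 -> config66 E1 E2 -> exists H1 H2 p t x1 x2 y,
    [/\ aeq2 E1 H1, aeq2 E2 H2, hex_pattern a b H1 H2 p t x1 x2 y y & x1 + x2 = 2 * y].
Proof.
move=> [til opt] cf; have [H1 [H2 [p [t [x1 [x2 [y [z [a1 a2 H]]]]]]]]] := tiling_structure til cf.
have [_ m1 m2 _ _] := til; have [A1 A2 Pe] := pattern_measures m1 m2 a1 a2 H.
have [[x10 x20 y0 z0] _ _ _] := H.
have [|yz xy] := optimal_sides x10 x20 y0 z0; last first.
  by exists H1, H2, p, t, x1, x2, y; split => //; rewrite {2}yz.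
move=> x1' x2' y' z' x10' x20' y0' z0' e1 e2.
have til' := pattern_tiling p t x10' x20' y0' z0'.
have [_ m1' m2' _ _] := til'.
have [A1' A2' Pe'] := pattern_measures m1' m2' (aeq2_refl _) (aeq2_refl _)
  (hex_pattern_refl p t x10' x20' y0' z0').
have := opt _ _ _ _ til'; rewrite A1' A2' Pe' A1 A2 Pe e1 e2 lee_fin.
exact.
Qed.

Lemma lat_inj (a b : pt R) m n m' n' : lin_indep a b -> lat a b m n = lat a b m' n' ->
  (m, n) = (m', n').
Proof.
move=> li E; have := congr1 fst E; have := congr1 snd E; rewrite /lat /= => E2 E1.
have [e1 e2] : (m%:~R - m'%:~R) * (a.1 * b.2 - a.2 * b.1) = 0 :> R /\
    (n%:~R - n'%:~R) * (a.1 * b.2 - a.2 * b.1) = 0 :> R.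
  split.
    transitivity (((m%:~R * a.1 + n%:~R * b.1) - (m'%:~R * a.1 + n'%:~R * b.1)) * b.2 -
      ((m%:~R * a.2 + n%:~R * b.2) - (m'%:~R * a.2 + n'%:~R * b.2)) * b.1); first by ring.
    by rewrite E1 E2 !subrr !mul0r subrr.
  transitivity (((m%:~R * a.2 + n%:~R * b.2) - (m'%:~R * a.2 + n'%:~R * b.2)) * a.1 -
      ((m%:~R * a.1 + n%:~R * b.1) - (m'%:~R * a.1 + n'%:~R * b.1)) * a.2); first by ring.
  by rewrite E1 E2 !subrr !mul0r subrr.
move: e1 e2 => /eqP + /eqP; rewrite !mulf_eq0 (negbTE li) !orbF !subr_eq0 !eqr_int.
by move=> /eqP-> /eqP->.
Qed.

Lemma pattern_fundamental (a b r h : pt R) D1 D2 : tiling r h D1 D2 -> lin_indep a b ->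
  (forall v, (exists m n, v = lat a b m n) <-> (exists m n, v = lat r h m n)) ->
  measurable D1 -> measurable D2 -> fundamental_domain a b (D1 `|` D2).
Proof.
move=> [_ _ _ ov unc] li GE m1 m2.
have tU g : transl g (D1 `|` D2) = transl g D1 `|` transl g D2 by rewrite /transl image_setU.
split.
- by apply: lmeas_measurable; exact: measurableU.
- apply: null2_sub unc => x /= H [k [m [n Hx]]]; apply: H.
  have [m' [n' E]] := (GE (lat r h m n)).2 (ex_intro _ m (ex_intro _ n erefl)).
  by exists m', n'; rewrite -E tU; case: k Hx; [right|left].
- move=> m n m' n' neq.
  have [M [N E]] := (GE (lat a b m n)).1 (ex_intro _ m (ex_intro _ n erefl)).
  have [M' [N' E']] := (GE (lat a b m' n')).1 (ex_intro _ m' (ex_intro _ n' erefl)).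
  have neq' (k k' : bool) : (k, M, N) <> (k', M', N').
    by move=> [_ e1 e2]; apply: neq; apply: (lat_inj li); rewrite E E' e1 e2.
  have nul k k' := ov _ _ _ _ _ _ (neq' k k').
  apply: (null2_sub _ (null2U (null2U (nul false false) (nul false true))
    (null2U (nul true false) (nul true true)))) => x; rewrite E E' !tU.
  move=> [[h1|h1] [h2|h2]]; [left; left|left; right|right; left|right; right] => //.
Qed.

Lemma hexl_regular (y : R) : hexl y y y = fun=> y.
Proof.
by apply/funext => k; rewrite /hexl; have := ltn_pmod k (isT : 0 < 3)%N;
  case: (k %% 3)%N => [|[|[|]]].
Qed.

(** The common side is side 1 of the first hexagon and side 4 of the second, run in opposite senses;
    numbering the corners from these sides gives the required form. *)
Lemma pattern_two_regular p t (y : R) : 0 < y ->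
  two_regular_hexagons (hex_region p t (hexl y y y) `|`
    hex_region (pattern_base p t y y) t (hexl y y y)).
Proof.
move=> y0; exists (vtx p t (hexl y y y) 1), (t + 1%:R * (pi / 3)), y; split => //.
rewrite -(hex_region_shift (hexl_periodic y y y) (hexl_closed p t y y y) 1).
rewrite -(hex_region_shift (hexl_periodic y y y) (hexl_closed (pattern_base p t y y) t y y y) 4).
rewrite hexl_regular; congr (_ `|` hex_region _ _ _); last by field.
rewrite -[u _]/(edir t 1) !vtxS !vtx0 edirSSS edirSS /pattern_base /vcomb edirSS.
move: (edir t 0) (edir t 1) => e e'; rewrite /line /vadd /vsub /=.
by congr pair; ring.
Qed.

(** The rotation by the angle [th] that carries [p] to [p']. *)
Definition motion (p p' : pt R) (th : R) (q : pt R) : pt R :=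
  (p'.1 + (cos th * (q.1 - p.1) - sin th * (q.2 - p.2)),
   p'.2 + (sin th * (q.1 - p.1) + cos th * (q.2 - p.2))).

Lemma motionK p p' th : cancel (motion p p' th) (motion p' p (- th)).
Proof.
move=> q; rewrite /motion cosN sinN /=; have := cos2Dsin2 th.
move: (cos th) (sin th) => c s E; rewrite [RHS]surjective_pairing; congr pair.
  transitivity (p.1 + (c ^+ 2 + s ^+ 2) * (q.1 - p.1)); first by ring.
  by rewrite E; ring.
transitivity (p.2 + (c ^+ 2 + s ^+ 2) * (q.2 - p.2)); first by ring.
by rewrite E; ring.
Qed.

Lemma motion_isometry p p' th : isometry2 (motion p p' th).
Proof.
move=> q q'; rewrite /dist2 /motion /=; have := cos2Dsin2 th.
move: (cos th) (sin th) => c s E.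
transitivity ((c ^+ 2 + s ^+ 2) * ((q.1 - q'.1) ^+ 2 + (q.2 - q'.2) ^+ 2)); first by ring.
by rewrite E mul1r.
Qed.

Lemma motion_mpres p p' th : mpres (motion p p' th).
Proof.
rewrite (_ : motion p p' th = affmap (motion p p' th (0, 0)) (cos th, sin th) (- sin th, cos th)).
  apply: mpres_affmap; rewrite /cross /= mulrN opprK -!expr2; exact: cos2Dsin2.
by apply/funext => q; rewrite /motion /affmap /=; congr pair; ring.
Qed.

Lemma aeq2_motion p p' th (E F : set (pt R)) :
  aeq2 E F -> aeq2 (motion p p' th @` E) (motion p p' th @` F).
Proof.
have H (A B : set (pt R)) : null2 (A `\` B) ->
    null2 (motion p p' th @` A `\` motion p p' th @` B).
  move=> /(null2_mpres (motion_mpres p' p (- th)) (motionK p p' th)).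
  apply: null2_sub => x [[q Aq <-] Bq]; exists q => //; split => // Bq'; apply: Bq; exists q.
by move=> [e1 e2]; split; exact: H.
Qed.

Lemma motion_edir p p' th t q k (s : R) :
  motion p p' th (line q (edir t k) s) = line (motion p p' th q) (edir (t + th) k) s.
Proof.
rewrite /motion /line /edir /u /= (_ : t + th + _ = (t + k%:R * (pi / 3)) + th); last by ring.
by move: (t + _) => f; rewrite cosD sinD; congr pair; ring.
Qed.

Lemma motion_vtx p p' th t q l k :
  motion p p' th (vtx q t l k) = vtx (motion p p' th q) (t + th) l k.
Proof. by elim: k => [|k IH]; rewrite ?vtx0 // !vtxS motion_edir IH. Qed.

Lemma motion_vcomb p p' th t q (c d : R) :
  motion p p' th (vadd q (vcomb t c d)) = vadd (motion p p' th q) (vcomb (t + th) c d).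
Proof.
have E (r : pt R) s : vadd r (vcomb s c d) = line (line r (edir s 0) c) (edir s 2) d.
  by rewrite /vcomb /line; move: (edir _ _) (edir _ _) => e e'; rewrite /vadd /=; congr pair; ring.
by rewrite !E !motion_edir.
Qed.

Lemma motion_cross p p' th t k x v : cross (edir (t + th) k)
  (vsub (motion p p' th x) (motion p p' th v)) = cross (edir t k) (vsub x v).
Proof.
rewrite /edir (_ : t + th + _ = (t + k%:R * (pi / 3)) + th); last by ring.
move: (t + _) => f0; rewrite /u /motion /cross /vsub /= cosD sinD; have := cos2Dsin2 th.
move: (cos th) (sin th) (cos f0) (sin f0) => c s f g E.
transitivity ((c ^+ 2 + s ^+ 2) * (f * (x.2 - v.2) - g * (x.1 - v.1))); first by ring.
by rewrite E mul1r.
Qed.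

Lemma motion_hex p p' th q t l :
  motion p p' th @` hex_region q t l = hex_region (motion p p' th q) (t + th) l.
Proof.
have E k x : cross (edir (t + th) k) (vsub (motion p p' th x)
    (vtx (motion p p' th q) (t + th) l k)) = cross (edir t k) (vsub x (vtx q t l k)).
  by rewrite -motion_vtx motion_cross.
apply/seteqP; split => [_ [x Hx <-] k k6|x Hx]; first by rewrite E; exact: Hx.
have xE : x = motion p p' th (motion p' p (- th) x).
  by rewrite -[in motion p p' th]( opprK th) motionK.
exists (motion p' p (- th) x) => // k k6.
by rewrite -E -xE; exact: Hx.
Qed.

(** Up to null sets the tiling and the pattern have the same tiles, but numbered differently: the
    lattice bases differ, and the second hexagon may be off by a lattice vector. *)
Lemma pattern_tiles (a b : pt R) E1 E2 H1 H2 p t (x1 x2 y z : R)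
    (r := pattern_r t y z) (h := pattern_h t x1 x2 z) (D1 := hex_region p t (hexl x1 y z))
    (D2 := hex_region (pattern_base p t x1 z) t (hexl x2 y z)) :
  aeq2 E1 H1 -> aeq2 E2 H2 -> hex_pattern a b H1 H2 p t x1 x2 y z ->
  (forall k m n, exists m' n',
     aeq2 (transl (lat a b m n) (gen E1 E2 k)) (transl (lat r h m' n') (gen D1 D2 k))) /\
  (forall k m' n', exists m n,
     aeq2 (transl (lat a b m n) (gen E1 E2 k)) (transl (lat r h m' n') (gen D1 D2 k))).
Proof.
move=> a1 a2 [_ HE1 [m0 [n0 HE2]] GE].
have {a1 a2} sh k : exists m n, aeq2 (gen E1 E2 k) (transl (lat a b m n) (gen D1 D2 k)).
  case: k; last by exists 0, 0; rewrite lat0 transl0 /= /D1 -HE1.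
  by exists (- m0), (- n0); move: (translK HE2); rewrite latN => <-.
split => k m n; have [mk [nk ak]] := sh k.
  have [m' [n' E]] := (GE (lat a b (mk + m) (nk + n))).1 (ex_intro _ _ (ex_intro _ _ erefl)).
  exists m', n'; rewrite /r /h -E -latD -transl_transl; exact: aeq2_transl.
have [m' [n' E]] := (GE (lat r h m n)).2 (ex_intro _ _ (ex_intro _ _ erefl)).
exists (m' - mk), (n' - nk); rewrite E.
have -> : lat a b m' n' = vadd (lat a b mk nk) (lat a b (m' - mk) (n' - nk)).
  by rewrite latD; congr lat; ring.
by rewrite -transl_transl; exact: aeq2_transl.
Qed.

Lemma motion_pattern p p' t t' (x1 x2 y z : R) k m n (th := t' - t) :
  motion p p' th @` transl (lat (pattern_r t y z) (pattern_h t x1 x2 z) m n)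
    (gen (hex_region p t (hexl x1 y z)) (hex_region (pattern_base p t x1 z) t (hexl x2 y z)) k) =
  transl (lat (pattern_r t' y z) (pattern_h t' x1 x2 z) m n)
    (gen (hex_region p' t' (hexl x1 y z)) (hex_region (pattern_base p' t' x1 z) t' (hexl x2 y z)) k).
Proof.
have latE s : lat (pattern_r s y z) (pattern_h s x1 x2 z) m n = vcomb s
    (m%:~R * y + n%:~R * (x1 + x2)) (m%:~R * (y + z) + n%:~R * (- (2 * z))).
  by rewrite /lat /pattern_r /pattern_h /vcomb; move: (edir _ _) (edir _ _) => e e' /=; congr pair; ring.
have tE : t + th = t' by rewrite /th; ring.
have mp : motion p p' th p = p'.
  by rewrite /motion !subrr !mulr0 subr0 !addr0 -surjective_pairing.
by rewrite !latE; case: k; rewrite /= !transl_hex motion_hex !motion_vcomb mp tE.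
Qed.

End Final.

(** The two areas add up to [6 w3 y^2], which gives [y]; each area is then affine in its own [x]. *)
Lemma areas_determine_sides (R : realType) (x1 x2 y x1' x2' y' : R) : 0 < y -> 0 < y' ->
  x1 + x2 = 2 * y -> x1' + x2' = 2 * y' ->
  w3 R * (x1' * y' + y' * y' + y' * x1') = w3 R * (x1 * y + y * y + y * x1) ->
  w3 R * (x2' * y' + y' * y' + y' * x2') = w3 R * (x2 * y + y * y + y * x2) ->
  [/\ x1' = x1, x2' = x2 & y' = y].
Proof.
have w0 : w3 R != 0 by rewrite gt_eqF // w3_gt0.
move=> y0 y0' xy xy' /(mulfI w0) e1 /(mulfI w0) e2.
have yy : y' = y.
  have q2 : x2 = 2 * y - x1 by lra.
  have q2' : x2' = 2 * y' - x1' by lra.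
  rewrite q2 q2' in e2.
  have : y' ^+ 2 = y ^+ 2 by rewrite !expr2; lra.
  by move=> /eqP; rewrite eqrXn2 // ?ltW // => /eqP.
rewrite yy in e1 e2 *; have i x x' : x' * y + y * y + y * x' = x * y + y * y + y * x -> x' = x.
  by move=> E; have := lt0r_neq0 y0 => /mulIf; apply; lra.
by split => //; exact: i.
Qed.

Theorem theorem3p2 (R : realType) (a b : pt R) (E1 E2 : set (pt R)) :
  tiling a b E1 E2 -> nondegenerate2 E1 E2 -> isoperimetric a b E1 E2 ->
  config66 E1 E2 ->
  let A1 := fine (area E1) in
  let A2 := fine (area E2) in
  [/\ exists D, fundamental_domain a b D /\ two_regular_hexagons D,
      6^-1 < A1 / (A1 + A2) < 5 / 6,
      6^-1 < A2 / (A1 + A2) < 5 / 6,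
      PerT E1 E2 = (2 * Num.sqrt (Num.sqrt 3) * Num.sqrt (A1 + A2))%:E
    & forall (a' b' : pt R) (F1 F2 : set (pt R)),
        tiling a' b' F1 F2 -> nondegenerate2 F1 F2 -> isoperimetric a' b' F1 F2 ->
        config66 F1 F2 -> area F1 = area E1 -> area F2 = area E2 ->
        exists f : pt R -> pt R, isometry2 f /\
          (forall (k : bool) (m n : int), exists m' n' : int,
             aeq2 (f @` transl (lat a b m n) (gen E1 E2 k))
                   (transl (lat a' b' m' n') (gen F1 F2 k))) /\
          (forall (k : bool) (m' n' : int), exists m n : int,
             aeq2 (f @` transl (lat a b m n) (gen E1 E2 k))
                   (transl (lat a' b' m' n') (gen F1 F2 k)))].
Proof.
move=> til _ iso cf A1 A2.
have [H1 [H2 [p [t [x1 [x2 [y [a1 a2 H xy]]]]]]]] := isoperimetric_structure iso cf.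
have [li m1 m2 _ _] := til; have [e1 e2 Pe] := pattern_measures m1 m2 a1 a2 H.
have [[x10 x20 y0 _] _ _ GE] := H; have w0 := w3_gt0 R.
(* In these three positive products the areas and the relation [x1 + x2 = 2 y] are linear, so the
   bounds 1/6 and 5/6 follow by linear arithmetic. *)
have yy : 0 < w3 R * (y * y) by rewrite !mulr_gt0.
have xy1 : 0 < w3 R * (x1 * y) by rewrite !mulr_gt0.
have xy2 : 0 < w3 R * (x2 * y) by rewrite !mulr_gt0.
have sE : w3 R * (x1 * y) + w3 R * (x2 * y) = 2 * (w3 R * (y * y)).
  by rewrite -mulrDr -mulrDl xy; ring.
have A1E : A1 = 2 * (w3 R * (x1 * y)) + w3 R * (y * y) by rewrite /A1 e1 /=; ring.
have A2E : A2 = 2 * (w3 R * (x2 * y)) + w3 R * (y * y) by rewrite /A2 e2 /=; ring.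
have AE : A1 + A2 = 6 * (w3 R * (y * y)) by lra.
have A0 : 0 < A1 + A2 by lra.
split.
- exists (hex_region p t (hexl y y y) `|` hex_region (pattern_base p t y y) t (hexl y y y)).
  split; last exact: pattern_two_regular.
  apply: pattern_fundamental (pattern_tiling p t y0 y0 y0 y0) li _ _ _;
    [|exact: measurable_hex|exact: measurable_hex].
  have -> // : pattern_h t y y y = pattern_h t x1 x2 y.
  by rewrite /pattern_h xy; congr vcomb; ring.
- by rewrite ltr_pdivlMr // ltr_pdivrMr // AE A1E; apply/andP; split; lra.
- by rewrite ltr_pdivlMr // ltr_pdivrMr // AE A2E; apply/andP; split; lra.
- rewrite Pe -mulrA -sqrtrM ?sqrtr_ge0 // AE /w3; congr EFin.
  (* The perimeter is [6 y], twice the root of this square. *)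
  have -> : Num.sqrt 3 * (6 * (Num.sqrt 3 / 2 * (y * y))) = (3 * y) ^+ 2 :> R.
    transitivity (3 * (Num.sqrt 3 ^+ 2) * (y * y) : R); first by field.
    by rewrite sqr_sqrtr //; ring.
  by rewrite sqrtr_sqr ger0_norm; lra.
- move=> a' b' F1 F2 til' _ iso' cf' eA1 eA2.
  have [K1 [K2 [p' [t' [x1' [x2' [y' [b1 b2 K xy']]]]]]]] := isoperimetric_structure iso' cf'.
  have [_ n1 n2 _ _] := til'; have [f1 f2 _] := pattern_measures n1 n2 b1 b2 K.
  have [[_ _ y0' _] _ _ _] := K.
  rewrite f1 e1 in eA1; rewrite f2 e2 in eA2; case: eA1 eA2 => eA1 [eA2].
  have [xE1 xE2 yE] := areas_determine_sides y0 y0' xy xy' eA1 eA2.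
  rewrite xE1 xE2 yE in K.
  have [S1 S2] := pattern_tiles a1 a2 H; have [T1 T2] := pattern_tiles b1 b2 K.
  exists (motion p p' (t' - t)); split; first exact: motion_isometry.
  split => k m n.
    have [M [N /(aeq2_motion p p' (t' - t))]] := S1 k m n; rewrite motion_pattern => h1.
    have [m' [n' /aeq2_sym h2]] := T2 k M N.
    by exists m', n'; exact: aeq2_trans h2.
  have [M [N /aeq2_sym h2]] := T1 k m n.
  have [m' [n' /(aeq2_motion p p' (t' - t))]] := S2 k M N; rewrite motion_pattern => h1.
  by exists m', n'; exact: aeq2_trans h2.
Qed.
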